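(* In the setting described in the context (measures $\gamma_n$, $\eta_n$ and their $N$-particle approximations $\gamma_n^N$, $\eta_n^N$ built from McKean kernels $K_{n+1,(m,\eta)}$), the following hold. (a) For all $n\ge0$ and $N\ge1$, $\gamma_n(1)\in I_n$ and $\gamma_n^N(1)\in I_n$, where $$I_n:=[m_-(n),m_+(n)],\qquad m_{\pm}(n):=\sum_{p=0}^n\mu_p(1)\,g_{\pm}(n)^{n-p}.$$ (b) For every $r\ge1$ there is a constant $a_r<\infty$ depending only on $r$ such that for all $n\ge 0$, $N\ge1$ and $f\in\mathrm{Osc}_1(E_n)$, $$\sqrt N\;\mathbb E\left(\left|[\eta_n^N-\eta_n](f)\right|^r\right)^{1/r}\le a_r\,b_n$$ for some constants $b_n$ (not depending on $N$, $f$, $r$) with $b_n\le\sum_{p=0}^n b_{p,n}$, where $$b_{p,n}:=2\,(1\wedge m_{p,n})\,q_{p,n}\left[q_{p,n}\,\beta(P_{p,n})+\sum_{p<q\le n}\frac{c_{q,n}}{\sum_{p<r\le n}c_{r,n}}\,\beta(P_{q,n})\right],$$ $$m_{p,n}=\frac{m_+(p)\,\|Q_{p,n}(1)\|}{\sum_{p<q\le n}c_{q,n}},\qquad c_{p,n}:=\mu_pQ_{p,n}(1).$$ (c) The particle measures are unbiased: $\mathbb E(\gamma_n^N(f))=\gamma_n(f)$ for all $n\ge0$, $N\ge1$ and bounded measurable $f$ on $E_n$. (d) Suppose the model is time homogeneous, i.e. $(E_n,G_n)=(E,G)$ for $n\ge0$ and $(M_n,\mu_n)=(M,\mu)$ for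 $n\ge1$, that there are $k\ge1$ and $\epsilon>0$ with $M^k(x,\cdot)\ge\epsilon M^k(y,\cdot)$ for all $x,y\in E$, and that one of the following three conditions holds: $G\equiv1$; or $\sup_EG<1$; or $\inf_EG>1$. Then the constants $b_n$ in (b) can be chosen so that $\sup_{n\ge0}b_n<\infty$. In addition there is $d<\infty$ such that for all $n\ge1$ and $N>1$, $$\mathbb E\left(\left[\frac{\gamma_n^N(1)}{\gamma_n(1)}-1\right]^2\right)\le d\,\frac{n+1}{N-1}\left(1+\frac d{N-1}\right)^{n-1}.$$
   Context: Model. $(E_n)_{n\ge0}$ are measurable spaces; $G_n:E_n\to\mathbb R$ measurable with $0<g_{n,-}\le G_n\le g_{n,+}<\infty$ for constants $g_{n,\pm}$; $M_{n+1}$ is a Markov kernel from $E_n$ to $E_{n+1}$; $\mu_n$ is a finite positive measure on $E_n$, with $\mu_0(1)>0$. Set $Q_{n+1}(x,dy)=G_n(x)M_{n+1}(x,dy)$, $\gamma_0=\mu_0$, $\gamma_{n+1}=\gamma_nQ_{n+1}+\mu_{n+1}$, $\eta_n=\gamma_n/\gamma_n(1)$. Here $\nu(f)=\int f\,d\nu$, $K(f)(x)=\int K(x,dy)f(y)$, $(\nu K)(f)=\nu(K(f))$. McKean kernels. For each $n\ge 0$, $m\in(0,\infty)$ and probability measure $\eta$ on $E_n$, $K_{n+1,(m,\eta)}$ is a Markov kernel from $E_n$ to $E_{n+1}$ satisfying $$\eta K_{n+1,(m,\eta)}(f)=\frac{m\,\eta(Q_{n+1}(f))+\mu_{n+1}(f)}{m\,\eta(G_n)+\mu_{n+1}(1)}$$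 for all bounded measurable $f$ (the choice is not unique; any choice is allowed), and such that the corresponding kernels at empirical measures $\eta=\frac1N\sum_{i=1}^N\delta_{x^i}$ depend measurably on $(m,x^1,\dots,x^N)$. Particle system. $\xi_0=(\xi_0^i)_{1\le i\le N}$ are i.i.d. with law $\eta_0$, and $\gamma_0^N(1)=\gamma_0(1)$. With $\eta_n^N=\frac1N\sum_{i=1}^N\delta_{\xi_n^i}$: $\gamma_{n+1}^N(1)=\gamma_n^N(1)\,\eta_n^N(G_n)+\mu_{n+1}(1)$, and, given $(\xi_0,\dots,\xi_n)$, the variables $\xi_{n+1}^i$, $1\le i\le N$, are independent with respective laws $K_{n+1,(\gamma_n^N(1),\eta_n^N)}(\xi_n^i,\cdot)$. Finally $\gamma_n^N:=\gamma_n^N(1)\,\eta_n^N$. Notation. $g_-(n)=\inf_{0\le p<n}\inf_{E_p}G_p$ and $g_+(n)=\sup_{0\le p<n}\sup_{E_p}G_p$ (for $n=0$, $m_\pm(0)=\mu_0(1)$). $Q_{p,n}=Q_{p+1}\cdots Q_n$ with $Q_{n,n}=Id$; $P_{p,n}(f)=Q_{p,n}(f)/Q_{p,n}(1)$; $q_{p,n}=\sup_{x,y\in E_p}Q_{p,n}(1)(x)/Q_{p,n}(1)(y)$; $\beta(P_{p,n})=\sup_{x,y\in E_p}\|P_{p,n}(x,\cdot)-P_{p,n}(y,\cdot)\|_{\mathrm{tv}}$, where $\|\nu\|_{\mathrm{tv}}=\sup\{|\nu(f)|:\mathrm{osc}(f)\le1\}$ and $\mathrm{osc}(f)=\sup_{x,y}|f(x)-f(y)|$.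 $\mathrm{Osc}_1(E)$ is the set of measurable functions $f$ on $E$ with $\mathrm{osc}(f)\le1$; $\|\cdot\|$ is the uniform norm. Convention: when $\sum_{p<q\le n}c_{q,n}=0$ (in particular when $p=n$), $1\wedge m_{p,n}:=1$ and the weighted sum of the $\beta(P_{q,n})$ is $0$. *)

(* Defs.v *)
From HB Require Import structures.
From mathcomp Require Import all_boot all_order all_algebra.
From mathcomp Require Import interval_inference.
From mathcomp Require Import all_classical all_reals all_analysis.
From mathcomp Require Import measurable_realfun.

Set Implicit Arguments.
Unset Strict Implicit.
Unset Printing Implicit Defensive.

Import Order.TTheory GRing.Theory Num.Theory.
Import numFieldNormedType.Exports.

Local Open Scope classical_set_scope.
Local Open Scope ring_scope.

Section kernels.
Context (R : realType).

(** The total mass [nu(1)]. *)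
Definition mass d (T : measurableType d) (nu : {measure set T -> \bar R}) : R :=
  fine (nu setT).

(** [K(f)(x)], the integral of [f] against [K(x, dy)]. *)
Definition kfun d d' (T : measurableType d) (T' : measurableType d')
    (K : T -> {measure set T' -> \bar R}) (f : T' -> R) (x : T) : R :=
  \int[K x]_y f y.

Section kpush.
Context d d' (T : measurableType d) (T' : measurableType d').
Variables (nu : {measure set T -> \bar R}) (K : R.-ker T ~> T').

(** The measure [nu K]. *)
Definition kpush (A : set T') : \bar R := (\int[nu]_x K x A)%E.

Let kpush0 : kpush set0 = 0%E.
Proof. by apply: integral0_eq => x _; rewrite measure0. Qed.

Let kpush_ge0 A : (0 <= kpush A)%E.
Proof. by apply: integral_ge0 => x _; exact: measure_ge0. Qed.

Let kpush_sigma_additive : semi_sigma_additive kpush.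
Proof.
move=> F mF tF mUF.
have mK i : measurable_fun setT (K ^~ (F i)) by exact: measurable_kernel.
have -> : kpush (\bigcup_n F n) = (\sum_(n <oo) kpush (F n))%E.
  rewrite -integral_nneseries//.
  by apply: eq_integral => x _; rewrite measure_semi_bigcup.
by apply: is_cvg_ereal_nneg_natsum => n _; exact: kpush_ge0.
Qed.

HB.instance Definition _ :=
  isMeasure.Build d' T' R kpush kpush0 kpush_ge0 kpush_sigma_additive.

End kpush.

Section kweight.
Context d d' (T : measurableType d) (T' : measurableType d').
Variables (g : T -> R) (g0 : forall x, 0 <= g x) (K : R.-ker T ~> T').

(** The kernel [g(x) K(x, dy)]; the measurability proof is an argument so that
    the kernel structure can be inferred. *)
Definition kweight (mg : measurable_fun setT g) (x : T) : {measure set T' -> \bar R} :=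
  mscale (NngNum (g0 x)) (K x).

Let measurable_kweight (mg : measurable_fun setT g) U :
  measurable U -> measurable_fun [set: T] ((kweight mg) ^~ U).
Proof.
move=> mU; rewrite /kweight /mscale /=.
apply: emeasurable_funM; last exact: measurable_kernel.
exact/measurable_EFinP.
Qed.

HB.instance Definition _ (mg : measurable_fun setT g) :=
  isKernel.Build _ _ _ _ _ (kweight mg) (measurable_kweight mg).

End kweight.

(** [M^k(x, .)]. *)
Fixpoint kpow d (T : measurableType d) (M : R.-ker T ~> T) (k : nat) :
    T -> {measure set T -> \bar R} :=
  match k with
  | 0 => fun x => dirac x
  | k'.+1 => fun x => kpush (kpow M k' x) M
  end.

(** The oscillation takes values in [\bar R]: a supremum in [R] would be [0] on
    functions of unbounded oscillation. *)
Definition osc (T : Type) (f : T -> R) : \bar R :=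
  ereal_sup [set `|f z.1 - f z.2|%:E | z in [set: T * T]].

Definition Osc1 d (T : measurableType d) : set (T -> R) :=
  [set f | measurable_fun setT f /\ (osc f <= 1)%E].

(** [‖nu‖_tv], for a signed measure [nu] given through its values [nu(f)]. *)
Definition tvnorm d (T : measurableType d) (nu : (T -> R) -> R) : R :=
  sup [set `|nu f| | f in @Osc1 d T].

(** [N^-1 (\d_(x^1) + ... + \d_(x^N))]; the default [dirac point] of [mnormalize]
    is reached only when [N = 0]. *)
Definition emp d (T : measurableType d) (N : nat) (x : N.-tuple T) :
    probability T R :=
  mnormalize (msum (fun i => dirac (nth point x i)) N) (dirac point).

End kernels.

(** Index shift: [mutation n] is the kernel [M_{n+1}] from [E_n] to [E_{n+1}]. *)
Record model (R : realType) (d : nat -> measure_display)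
    (E : forall n, measurableType (d n)) := Model {
  pot : forall n, E n -> R;
  measurable_pot : forall n, measurable_fun setT (@pot n);
  pot_bounds : forall n, exists lo hi : R,
    0 < lo /\ forall x, lo <= @pot n x <= hi;
  mutation : forall n, R.-pker (E n) ~> (E n.+1);
  source : forall n, {finite_measure set (E n) -> \bar R};
  source0_gt0 : (0 < source 0%N setT)%E }.

Arguments pot {R d E} X n x : rename.
Arguments measurable_pot {R d E} X n : rename.
Arguments pot_bounds {R d E} X n : rename.
Arguments mutation {R d E} X n : rename.
Arguments source {R d E} X n : rename.

Section model_flow.
Context (R : realType) (d : nat -> measure_display).
Context (E : forall n, measurableType (d n)) (X : model R E).

Lemma pot_ge0 n x : 0 <= pot X n x.
Proof.
have [lo [hi [lo0 /(_ x)/andP[lox _]]]] := pot_bounds X n.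
exact: le_trans (ltW lo0) lox.
Qed.

(** [Q_{n+1}] *)
Definition Qker n : R.-ker (E n) ~> (E n.+1) :=
  kweight (@pot_ge0 n) (mutation X n) (measurable_pot X n).

Fixpoint gamma n : {measure set (E n) -> \bar R} :=
  match n with
  | 0 => source X 0
  | n'.+1 => measure_add (kpush (gamma n') (Qker n')) (source X n'.+1)
  end.

(** [gamma n] has finite positive mass, so the default [dirac point] of
    [mnormalize] is not used. *)
Definition eta n : probability (E n) R := mnormalize (gamma n) (dirac point).

(** [Q_{p,k+p}] *)
Fixpoint Qiter p k : E p -> {measure set (E (k + p)%N) -> \bar R} :=
  match k with
  | 0 => fun x => dirac x
  | k'.+1 => fun x => kpush (@Qiter p k' x) (Qker (k' + p))
  end.

(** [Q_{p,n}] for [p <= n], in which case [n - p + p = n]. *)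
Definition Qpn p n : E p -> {measure set (E (n - p + p)%N) -> \bar R} :=
  @Qiter p (n - p).

Definition Qone p n (x : E p) : R := kfun (@Qpn p n) (cst 1) x.

Definition Pop p n (f : E (n - p + p)%N -> R) (x : E p) : R :=
  kfun (@Qpn p n) f x / Qone n x.

(** [‖Q_{p,n}(1)‖] *)
Definition Qnorm p n : R := sup [set `|@Qone p n x| | x in [set: E p]].

Definition qpn p n : R :=
  sup [set @Qone p n z.1 / @Qone p n z.2 | z in [set: E p * E p]].

Definition betaP p n : R :=
  sup [set tvnorm (fun f => @Pop p n f z.1 - @Pop p n f z.2)
      | z in [set: E p * E p]].

Definition gminus n : R :=
  inf [set g | exists p (x : E p), (p < n)%N /\ g = pot X p x].

Definition gplus n : R :=
  sup [set g | exists p (x : E p), (p < n)%N /\ g = pot X p x].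

Definition mminus n : R :=
  \sum_(0 <= p < n.+1) mass (source X p) * gminus n ^+ (n - p).

Definition mplus n : R :=
  \sum_(0 <= p < n.+1) mass (source X p) * gplus n ^+ (n - p).

Definition cpn p n : R := \int[source X p]_x Qone n x.

Definition csum p n : R := \sum_(p.+1 <= q < n.+1) cpn q n.

Definition mpn p n : R := mplus p * Qnorm p n / csum p n.

(** [1 ∧ m_{p,n}], with its convention for an empty or zero sum. *)
Definition min1m p n : R :=
  if csum p n == 0 then 1 else Num.min 1 (mpn p n).

(** When [csum p n = 0] the weighted sum vanishes since [x / 0 = 0]. *)
Definition bpn p n : R :=
  2 * min1m p n * qpn p n *
  (qpn p n * betaP p n +
   \sum_(p.+1 <= q < n.+1) cpn q n / csum p n * betaP q n).

(** A choice of McKean kernels: [K n m eta] is [K_{n+1,(m,eta)}]. *)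
Definition kernel_family : Type :=
  forall n, R -> probability (E n) R -> R.-pker (E n) ~> (E n.+1).

Record McKean (K : kernel_family) : Prop := {
  McKean_compatible : forall n (m : R) (eta : probability (E n) R)
      (f : E n.+1 -> R),
    0 < m -> measurable_fun setT f -> bounded_fun f ->
    \int[eta]_x kfun (K n m eta) f x =
    (m * (\int[eta]_x kfun (Qker n) f x) + \int[source X n.+1]_y f y) /
    (m * (\int[eta]_x pot X n x) + mass (source X n.+1));
  McKean_measurable : forall n N (A : set (E n.+1)),
    (0 < N)%N -> measurable A ->
    measurable_fun [set z : R * N.-tuple (E n) * E n | 0 < z.1.1]
      (fun z => K n z.1.1 (emp R z.1.2) z.2 A) }.

Section particles.
Context (K : kernel_family) (N : nat).

(** [gamma_n^N(1)] along the trajectory [x] of the particles. *)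
Fixpoint massN (x : forall n, N.-tuple (E n)) n : R :=
  match n with
  | 0 => mass (gamma 0)
  | n'.+1 => massN x n' * (\int[emp R (x n')]_y pot X n' y)
             + mass (source X n'.+1)
  end.

Context d' (Omega : measurableType d') (P : probability Omega R).
Variable xi : forall n, Omega -> N.-tuple (E n).

(** The sigma-algebra generated by [xi_0, ..., xi_n]. *)
Definition past n : set (set Omega) :=
  <<s [set B | exists p, (p <= n)%N /\
                 exists U, measurable U /\ B = xi p @^-1` U] >>.

(** [particle_step] says that, given the past, the [N] particles at time [n+1]
    are independent with laws [K_{n+1,(gamma_n^N(1),eta_n^N)}(xi_n^i, .)]: the
    product of these laws is a conditional probability given [past n]. *)
Record particle_system : Prop := {
  particle_measurable : forall n, measurable_fun setT (xi n);
  particle_init : forall A : 'I_N -> set (E 0%N),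
    (forall i, measurable (A i)) ->
    P [set w | forall i, A i (tnth (xi 0%N w) i)] =
    (\prod_(i < N) fine (eta 0%N (A i)))%:E;
  particle_step : forall n (F : set Omega) (A : 'I_N -> set (E n.+1)),
    past n F -> (forall i, measurable (A i)) ->
    P (F `&` [set w | forall i, A i (tnth (xi n.+1 w) i)]) =
    (\int[P]_(w in F)
      (\prod_(i < N) fine (@K n (massN (xi ^~ w) n) (emp R (xi n w))
                              (tnth (xi n w) i) (A i)))%:E)%E }.

End particles.

(** The constants [b] satisfy the L^r estimates with the constants [a r], and are
    bounded by the sums of the [b_{p,n}]. *)
Definition Lr_constants (K : kernel_family) (a : R -> R) (b : nat -> R) : Prop :=
  (forall n, 0 <= b n <= \sum_(0 <= p < n.+1) bpn p n) /\
  forall r : R, 1 <= r ->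
  forall (n N : nat) (d' : measure_display) (Omega : measurableType d')
    (P : probability Omega R) (xi : forall n, Omega -> N.-tuple (E n))
    (f : E n -> R),
    (0 < N)%N -> particle_system K P xi -> @Osc1 R _ (E n) f ->
    ((Num.sqrt N%:R)%:E *
      ('E_P[(fun w => `|\int[emp R (xi n w)]_x f x - \int[eta n]_x f x| `^ r)%R])
        `^ r^-1
     <= (a r * b n)%:E)%E.

End model_flow.

Definition homogeneous (R : realType) (d : measure_display)
    (E : measurableType d) (X : @model R (fun=> d) (fun=> E)) (G : E -> R)
    (M : R.-pker E ~> E) (mu : {finite_measure set E -> \bar R}) : Prop :=
  [/\ forall n, pot X n = G, forall n, mutation X n = M &
      forall n, source X n.+1 = mu].

(* Main.v *)
Require Import Defs.
From HB Require Import structures.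
From mathcomp Require Import all_boot all_order all_algebra.
From mathcomp Require Import finmap interval_inference.
From mathcomp Require Import all_classical all_reals all_analysis.
From mathcomp Require Import measurable_realfun.
From mathcomp Require Import ring lra zify.

Set Implicit Arguments.
Unset Strict Implicit.
Unset Printing Implicit Defensive.

Import Order.TTheory GRing.Theory Num.Theory.
Import numFieldNormedType.Exports.

Local Open Scope classical_set_scope.
Local Open Scope ring_scope.

(** Write [U_p = gamma^N_p Q_{p,n}(f)] plus the mass [mu_q Q_{q,n}(f)] of the sources at
    times [p < q <= n], and [V_p] for the same quantity with [f = 1]. Since the McKean
    transition reproduces [gamma^N_p Q_{p+1} + mu_{p+1}] in mean, the increments of [U]
    and [V] are [gamma^N_p(1)] times local sampling errors that are centered given the
    past; [U] is thus a martingale from [gamma_n(f)] to [gamma^N_n(f)], which gives (c).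
    The difference [eta^N_n(f) - eta_n(f)] telescopes into differences of successive
    ratios [U_p / V_p]; each of them is a sampling error of [Q_{p,n}(f - l)], with [l]
    a deterministic centering, divided by [V_p], and is of order [b_{p,n} / sqrt N].
    Sampling errors are controlled by exponential moments, from which all the
    [L^r]-norms follow by convexity of the exponential. In (d), mixing makes
    [beta(P_{p,n})] decay geometrically and [q_{p,n}] bounded, and the second moment
    of [V_n] satisfies a discrete Gronwall inequality. *)

(** The weight [gamma^N_p(1) / V_p] of an increment depends on the particles of time [p] themselves,
    so the differences of ratios are not centered and their sum is no martingale. The weight is
    therefore bounded by a constant, and the sum by the triangle inequality. The exact centering of
    [Q_{p,n}(f)] is the quotient of the conditional means of [U_p] and [V_p], which is random; it is
    replaced by the value [l] of [P_{p,n}(f)] at a fixed point, and the discrepancy is charged to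
    the sampling error of [Q_{p,n}(1)]. Only the errors of two deterministic functions then remain.
    Convexity of the exponential plays the part of Minkowski's inequality for all [r] at once, and
    [x^r <= r^r e^x] makes [a_r] proportional to [r]. The particle law is prescribed on product sets
    only, hence a preliminary extension to bounded functions. In (d), mixing alone sums the terms
    [beta(P_{p,n})], but it does not control the terms due to the sources: these call for a separate
    argument in each of the three cases for [G]. *)

(** * Bounded measurable functions and their real integrals *)

Section bounded_measurable.
Context (R : realType) d (T : measurableType d).
Implicit Types f g : T -> R.

Definition bmeas f := measurable_fun setT f /\ exists C : R, forall x, `|f x| <= C.

Lemma bmeas_cst (c : R) : bmeas (fun=> c).
Proof. by split => //; exists `|c|. Qed.

Lemma bmeasD f g : bmeas f -> bmeas g -> bmeas (fun x => f x + g x).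
Proof.
move=> [mf [C fC]] [mg [D gD]]; split; first exact: measurable_funD.
by exists (C + D) => x; rewrite (le_trans (ler_normD _ _))// lerD.
Qed.

Lemma bmeasM f g : bmeas f -> bmeas g -> bmeas (fun x => f x * g x).
Proof.
move=> [mf [C fC]] [mg [D gD]]; split; first exact: measurable_funM.
by exists (C * D) => x; rewrite normrM ler_pM.
Qed.

Lemma bmeasZ (c : R) f : bmeas f -> bmeas (fun x => c * f x).
Proof. exact: bmeasM (bmeas_cst c). Qed.

Lemma bmeasN f : bmeas f -> bmeas (fun x => - f x).
Proof.
move=> [mf [C fC]]; split; first exact: measurable_funN.
by exists C => x; rewrite normrN.
Qed.

Lemma bmeasB f g : bmeas f -> bmeas g -> bmeas (fun x => f x - g x).
Proof. by move=> bf bg; apply: bmeasD => //; exact: bmeasN. Qed.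

Lemma bmeas_norm f : bmeas f -> bmeas (fun x => `|f x|).
Proof.
move=> [mf [C fC]]; split; first exact: measurableT_comp.
by exists C => x; rewrite normr_id.
Qed.

Lemma bmeas_exp f : bmeas f -> bmeas (fun x => expR (f x)).
Proof.
move=> [mf [C fC]]; split; first exact: measurableT_comp.
exists (expR C) => x; rewrite ger0_norm ?expR_ge0// ler_expR.
by rewrite (le_trans (ler_norm _)).
Qed.

Lemma bmeas_sum (I : Type) (r : seq I) (F : I -> T -> R) :
  (forall i, bmeas (F i)) -> bmeas (fun x => \sum_(i <- r) F i x).
Proof.
move=> bF; elim: r => [|i r IH].
  by rewrite (_ : (fun _ => _) = fun=> 0);
    [exact: bmeas_cst|apply/funext => x; rewrite big_nil].
rewrite (_ : (fun _ => _) = fun x => F i x + \sum_(i <- r) F i x).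
  exact: bmeasD.
by apply/funext => x; rewrite big_cons.
Qed.

Lemma bmeas_prod (I : Type) (r : seq I) (F : I -> T -> R) :
  (forall i, bmeas (F i)) -> bmeas (fun x => \prod_(i <- r) F i x).
Proof.
move=> bF; elim: r => [|i r IH].
  by rewrite (_ : (fun _ => _) = fun=> 1);
    [exact: bmeas_cst|apply/funext => x; rewrite big_nil].
rewrite (_ : (fun _ => _) = fun x => F i x * \prod_(i <- r) F i x).
  exact: bmeasM.
by apply/funext => x; rewrite big_cons.
Qed.

Lemma bmeas_indic (A : set T) : measurable A -> bmeas (\1_A).
Proof.
move=> mA; split; first exact: measurable_indic.
by exists 1 => x; rewrite indicE; case: (_ \in _); rewrite ?normr1 ?normr0.
Qed.

Lemma bmeas_comp d' (T' : measurableType d') f (h : T' -> T) :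
  measurable_fun setT h -> bmeas f ->
  measurable_fun setT (fun x => f (h x)) /\
    exists C : R, forall x, `|f (h x)| <= C.
Proof.
move=> mh [mf [C fC]]; split; first exact: measurableT_comp.
by exists C => x; exact: fC.
Qed.

Lemma bounded_bmeas f : measurable_fun setT f -> bounded_fun f -> bmeas f.
Proof.
move=> mf bf; split => //; have [C [_ /(_ (C + 1))]] := bf.
by rewrite ltrDl ltr01 => /(_ isT) bC; exists (C + 1) => x; exact: bC.
Qed.

Lemma bmeas_bounded f : bmeas f -> bounded_fun f.
Proof.
move=> [_ [C fC]]; exists C; split; first exact: num_real.
by move=> y Cy x _; apply: le_trans (ltW Cy).
Qed.

Section finite_measure.
Variable mu : {measure set T -> \bar R}.
Hypothesis fin_mu : (mu setT < +oo)%E.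

Lemma bmeas_integrable f : bmeas f -> mu.-integrable setT (EFin \o f).
Proof.
move=> bf; apply: measurable_bounded_integrable => //; first by case: bf.
exact: bmeas_bounded.
Qed.

Lemma rint_EFin f : bmeas f -> (\int[mu]_x f x)%:E = (\int[mu]_x (f x)%:E)%E.
Proof.
by move=> bf; rewrite /Rintegral fineK// integrable_fin_num//; exact: bmeas_integrable.
Qed.

Lemma rintD f g : bmeas f -> bmeas g ->
  \int[mu]_x (f x + g x) = \int[mu]_x f x + \int[mu]_x g x.
Proof. by move=> bf bg; rewrite RintegralD//; exact: bmeas_integrable. Qed.

Lemma rintB f g : bmeas f -> bmeas g ->
  \int[mu]_x (f x - g x) = \int[mu]_x f x - \int[mu]_x g x.
Proof. by move=> bf bg; rewrite RintegralB//; exact: bmeas_integrable. Qed.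

Lemma rintZ (c : R) f : bmeas f -> \int[mu]_x (c * f x) = c * \int[mu]_x f x.
Proof. by move=> bf; rewrite RintegralZl//; exact: bmeas_integrable. Qed.

Lemma rint_cst (c : R) : \int[mu]_x c = c * mass mu.
Proof. by rewrite Rintegral_cst. Qed.

Lemma rint_le f g : bmeas f -> bmeas g -> (forall x, f x <= g x) ->
  \int[mu]_x f x <= \int[mu]_x g x.
Proof. by move=> bf bg fg; apply: le_Rintegral => //; exact: bmeas_integrable. Qed.

Lemma rint_sum (I : Type) (r : seq I) (F : I -> T -> R) :
  (forall i, bmeas (F i)) ->
  \int[mu]_x (\sum_(i <- r) F i x) = \sum_(i <- r) \int[mu]_x F i x.
Proof.
move=> bF; elim: r => [|i r IH].
  by under eq_Rintegral do rewrite big_nil; rewrite big_nil rint_cst mul0r.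
under eq_Rintegral do rewrite big_cons.
by rewrite big_cons -IH rintD//; exact: bmeas_sum.
Qed.

Lemma rint_norm_le f (C : R) : bmeas f -> (forall x, `|f x| <= C) ->
  `|\int[mu]_x f x| <= C * mass mu.
Proof.
move=> bf fC; apply: (le_trans (le_normr_Rintegral _ _)) => //.
  exact: bmeas_integrable.
by rewrite -rint_cst; apply: rint_le => //;
  [exact: bmeas_norm|exact: bmeas_cst].
Qed.

End finite_measure.

Lemma mass_ge0 (mu : {measure set T -> \bar R}) : 0 <= mass mu.
Proof. exact: fine_ge0. Qed.

Lemma mass_EFin (mu : {measure set T -> \bar R}) : (mu setT < +oo)%E ->
  (mass mu)%:E = mu setT.
Proof. by move=> fmu; rewrite /mass fineK// ge0_fin_numE. Qed.

Lemma prob_finite (P : probability T R) : (P setT < +oo)%E.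
Proof. by rewrite probability_setT ltry. Qed.

Lemma mass_prob (P : probability T R) : mass P = 1.
Proof. by rewrite -[mass P]/(fine (P setT)) probability_setT. Qed.

Lemma expectation_rint (P : probability T R) f : bmeas f ->
  'E_P[f]%E = (\int[P]_x f x)%:E.
Proof. by move=> bf; rewrite unlock rint_EFin//; exact: prob_finite. Qed.

(** Reduces identities between real integrals to nonnegative integrands: the identity is proved for
    [f + C], and the contribution of the constant is cancelled. *)
Lemma bmeas_shift f : bmeas f -> exists C : R, forall x, 0 <= f x + C.
Proof.
move=> [_ [C fC]]; exists C => x.
by move: (fC x); rewrite ler_norml => /andP[]; lra.
Qed.

End bounded_measurable.

(** * Integration against kernels, normalized, empirical and scaled measures *)

Import HBNNSimple.

(** Approximation by an increasing sequence of simple functions. The limit case needs finite-valued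
    sequences only, because the approximants are simple. *)
Lemma nonneg_measurable_ind (R : realType) d (T : measurableType d)
    (P : (T -> \bar R) -> Prop) :
  (forall (c : R) (A : set T), 0 <= c -> measurable A ->
     P (fun x => c%:E * (\1_A x : R)%:E)%E) ->
  (forall f g, measurable_fun setT f -> measurable_fun setT g ->
     (forall x, 0 <= f x)%E -> (forall x, 0 <= g x)%E ->
     P f -> P g -> P (fun x => f x + g x)%E) ->
  (forall f_ : nat -> T -> R, (forall n, measurable_fun setT (f_ n)) ->
     (forall n x, 0 <= f_ n x) -> (forall x, nondecreasing_seq (f_ ^~ x)) ->
     (forall n, P (EFin \o f_ n)) ->
     P (fun x => limn (fun n => (f_ n x)%:E))) ->
  forall f, measurable_fun setT f -> (forall x, 0 <= f x)%E -> P f.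
Proof.
move=> Pi PD Pl f mf f0.
have Ps (h : {nnsfun T >-> R}) : P (EFin \o h).
  (* A simple function is a sum over its finitely many values; an arbitrary list of nonnegative
     values allows induction on the list. *)
  suff Pr (s : seq R) : (forall r, r \in s -> 0 <= r) ->
      P (fun x => (\sum_(r <- s) r * \1_(h @^-1` [set r]) x)%:E).
    rewrite (_ : EFin \o h = fun x =>
      (\sum_(r <- fset_set (range h)) r * \1_(h @^-1` [set r]) x)%:E).
      by apply: Pr => r; rewrite in_fset_set// inE => -[x _ <-].
    by apply/funext => x /=; rewrite {1}fimfunE fsbig_finite.
  elim: s => [_|r s IH rs].
    have -> : (fun x => (\sum_(r <- [::]) r * \1_(h @^-1` [set r]) x : R)%:E) =
       (fun x => (0 : R)%:E * (\1_set0 x : R)%:E)%E.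
      by apply/funext => x; rewrite big_nil mul0e.
    exact: Pi.
  have rs' y : y \in s -> 0 <= y by move=> ys; apply: rs; rewrite inE ys orbT.
  have m1 y : measurable_fun setT (fun x => y * \1_(h @^-1` [set y]) x).
    by apply: measurable_funM => //; apply: measurable_indic.
  rewrite (_ : (fun _ => _) = fun x => (r%:E * (\1_(h @^-1` [set r]) x : R)%:E +
    (\sum_(r <- s) r * \1_(h @^-1` [set r]) x)%:E)%E); last first.
    by apply/funext => x; rewrite big_cons EFinD EFinM.
  apply: PD.
  - by apply: measurable_funeM; exact/measurable_EFinP/measurable_indic.
  - by apply/measurable_EFinP; exact: measurable_sum.
  - by move=> x; rewrite -EFinM lee_fin mulr_ge0// rs// mem_head.
  - by move=> x; rewrite lee_fin big_seq sumr_ge0// => y ys; rewrite mulr_ge0// rs'.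
  - by apply: Pi => //; rewrite rs// mem_head.
  - exact: IH.
pose f_ := nnsfun_approx measurableT mf.
have -> : f = (fun x => limn (fun n => (f_ n x)%:E)).
  apply/funext => x; apply/esym/cvg_lim => //.
  exact: (@cvg_nnsfun_approx _ _ _ _ measurableT f mf (fun x _ => f0 x) x).
apply: (Pl (fun n => f_ n)) => //.
by move=> x m n mn; exact/lefP/nd_nnsfun_approx.
Qed.

Section kpush.
Context (R : realType) d d' (T : measurableType d) (T' : measurableType d').
Variables (nu : {measure set T -> \bar R}) (K : R.-ker T ~> T').
Local Open Scope ereal_scope.

(** On indicators this is the definition of [kpush]; sums and monotone limits pass through both
    integrals on the right. *)
Lemma ge0_integral_kpush (f : T' -> \bar R) : measurable_fun setT f ->
  (forall y, 0 <= f y) ->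
  \int[kpush nu K]_y f y = \int[nu]_x \int[K x]_y f y.
Proof.
have mI g : measurable_fun setT g -> (forall x, 0 <= g x) ->
    measurable_fun setT (fun x => \int[K x]_y g y).
  move=> mg g0; apply: measurable_fun_integral_kernel => // U.
  exact: measurable_kernel.
move: f; apply: nonneg_measurable_ind => [c A c0 mA|f g mf mg f0 g0 Pf Pg|f_ mf f0 ndf Pf].
- have mE : measurable_fun setT (fun x : T' => (\1_A x)%:E : \bar R).
    by apply/measurable_EFinP; exact: measurable_indic.
  rewrite ge0_integralZl//.
  under [RHS]eq_integral => x _ do rewrite ge0_integralZl// integral_indic// setIT.
  rewrite ge0_integralZl//; last exact: measurable_kernel.
  by rewrite integral_indic// setIT.
- rewrite ge0_integralD// Pf Pg -ge0_integralD//; last first.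
  - exact: mI.
  - by move=> x _; exact: integral_ge0.
  - exact: mI.
  - by move=> x _; exact: integral_ge0.
  by apply: eq_integral => x _; rewrite ge0_integralD.
- have mcvg (m : {measure set T' -> \bar R}) :
      \int[m]_y limn (fun n => (f_ n y)%:E) = limn (fun n => \int[m]_y (f_ n y)%:E).
    apply: monotone_convergence => //.
    + by move=> n; exact/measurable_EFinP.
    + by move=> n y _; rewrite lee_fin.
    + by move=> y _ m1 n1 mn; rewrite lee_fin ndf.
  rewrite mcvg; under eq_fun do rewrite Pf/=.
  rewrite -monotone_convergence//.
  + by apply: eq_integral => x _; rewrite mcvg.
  + move=> n; apply: mI => [|x]; first exact/measurable_EFinP.
    by rewrite lee_fin.
  + by move=> n x _; apply: integral_ge0 => y _; rewrite lee_fin.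
  + move=> x _ m1 n1 mn; apply: ge0_le_integral => //.
    * by move=> y _; rewrite lee_fin.
    * exact/measurable_EFinP.
    * exact/measurable_EFinP.
    * by move=> y _; rewrite lee_fin ndf.
Qed.

End kpush.

Section bounded_kernel.
Context (R : realType) d d' (T : measurableType d) (T' : measurableType d').
Variable (K : R.-ker T ~> T') (C : R).
Hypothesis K_le : forall x, (K x setT <= C%:E)%E.

Lemma bounded_kernel_finite x : (K x setT < +oo)%E.
Proof. exact: le_lt_trans (K_le x) (ltry _). Qed.

Lemma kfun_bmeas (f : T' -> R) : bmeas f -> bmeas (kfun K f).
Proof.
move=> bf; have [D Df] := bmeas_shift bf.
have fK := bounded_kernel_finite.
split; last first.
  have [_ [B fB]] := bf; exists (B * C) => x.
  apply: (le_trans (rint_norm_le (fK x) bf fB)).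
  rewrite ler_wpM2l//; first exact: le_trans (fB point).
  by rewrite -lee_fin mass_EFin.
(* The kernel integral of the nonnegative function [f + D] is measurable in [x], and so is the mass
   of [K x]; [K(f)] is recovered from these two. *)
rewrite (_ : kfun K f =
    fun x => (fine (\int[K x]_y (f y + D)%:E) - D * fine (K x setT))%R).
  apply: measurable_funB.
    apply: measurableT_comp => //; apply: measurable_fun_integral_kernel.
    - by move=> U; exact: measurable_kernel.
    - by move=> y; rewrite lee_fin.
    - by apply/measurable_EFinP; apply: measurable_funD => //; case: bf.
  apply: measurable_funM => //; apply: measurableT_comp => //.
  exact: measurable_kernel.
apply/funext => x; rewrite /kfun.
rewrite -[fine (\int[_]_y (f y + D)%:E)]/(\int[K x]_y (f y + D)).
by rewrite rintD// ?rint_cst ?addrK//; exact: bmeas_cst.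
Qed.

Lemma mass_bmeas : bmeas (fun x => mass (K x)).
Proof.
rewrite (_ : (fun _ => _) = kfun K (fun=> 1)); first exact/kfun_bmeas/bmeas_cst.
by apply/funext => x; rewrite /kfun rint_cst ?mul1r.
Qed.

Lemma kpush_finite (nu : {measure set T -> \bar R}) :
  (nu setT < +oo)%E -> (kpush nu K setT < +oo)%E.
Proof.
move=> fnu; rewrite /= /kpush (eq_integral (fun x => (mass (K x))%:E)).
  by rewrite -rint_EFin ?ltry//; exact: mass_bmeas.
by move=> x _; rewrite mass_EFin//; exact: bounded_kernel_finite.
Qed.

Lemma rint_kpush (nu : {measure set T -> \bar R}) (f : T' -> R) :
  (nu setT < +oo)%E -> bmeas f ->
  \int[kpush nu K]_y f y = \int[nu]_x kfun K f x.
Proof.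
move=> fnu bf; have [D Df] := bmeas_shift bf.
have fK := bounded_kernel_finite.
have bD : bmeas (fun=> D : R) := bmeas_cst _ D.
have K1 := mass_bmeas.
have fkp := kpush_finite fnu.
have bfD : bmeas (fun y => f y + D) by exact: bmeasD.
suff E : \int[kpush nu K]_y (f y + D) = \int[nu]_x kfun K (fun y => f y + D) x.
  move: E; rewrite rintD// rint_cst//.
  rewrite (@eq_Rintegral _ _ _ nu setT (fun x => kfun K f x + D * mass (K x))); last first.
    by move=> x _; rewrite /kfun rintD// rint_cst.
  rewrite rintD//; [|exact: kfun_bmeas|exact: bmeasZ].
  rewrite rintZ// => /eqP; rewrite (_ : \int[nu]_x mass (K x) = mass (kpush nu K)).
    by move=> /eqP/addIr.
  by rewrite /mass/= /kpush /Rintegral; congr fine;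
    apply: eq_integral => x _; rewrite mass_EFin.
rewrite /Rintegral; congr fine; rewrite ge0_integral_kpush//.
- by apply: eq_integral => x _; rewrite -rint_EFin.
- by apply/measurable_EFinP; case: bfD.
Qed.

End bounded_kernel.

Section elementary_measures.
Context (R : realType) d (T : measurableType d).

Lemma rint_mnormalize (mu : {measure set T -> \bar R}) (P : probability T R)
    (f : T -> R) : (0 < mu setT < +oo)%E -> bmeas f ->
  \int[mnormalize mu P]_x f x = (mass mu)^-1 * \int[mu]_x f x.
Proof.
move=> /andP[mu0 mufin] bf; have [D Df] := bmeas_shift bf.
have bD : bmeas (fun=> D : R) := bmeas_cst _ D.
have m0 : 0 < mass mu by rewrite -lte_fin mass_EFin.
have fN : (mnormalize mu P setT < +oo)%E by exact: prob_finite.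
have bfD : bmeas (fun y => f y + D) by exact: bmeasD.
have i0 : 0 <= (mass mu)^-1 by rewrite invr_ge0 ltW.
have E : \int[mnormalize mu P]_x (f x + D) = (mass mu)^-1 * \int[mu]_x (f x + D).
  rewrite /Rintegral (eq_measure_integral (mscale (NngNum i0) mu)).
    rewrite ge0_integral_mscale//; first by rewrite fineM// -rint_EFin.
    - by apply/measurable_EFinP; case: bfD.
    - by move=> y _; rewrite lee_fin.
  move=> A mA _ /=; rewrite /mnormalize gt_eqF//= lt_eqF//=.
  by rewrite /mscale/= muleC.
move: E; rewrite !rintD// !rint_cst// mass_prob mulr1 mulrDr.
by rewrite [_ * (D * _)]mulrCA mulVf ?mulr1 ?gt_eqF// => /addIr.
Qed.

Lemma rint_dirac (a : T) (f : T -> R) : measurable_fun setT f ->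
  \int[dirac a]_x f x = f a.
Proof.
move=> mf; rewrite /Rintegral integral_dirac//; last exact/measurable_EFinP.
by rewrite diracT mul1e.
Qed.

Lemma rint_emp N (x : N.-tuple T) (f : T -> R) : (0 < N)%N -> bmeas f ->
  \int[emp R x]_y f y = N%:R^-1 * \sum_(i < N) f (tnth x i).
Proof.
move=> N0 bf; rewrite /emp; set mu := (X in mnormalize X _).
have muT : mu setT = N%:R%:E.
  rewrite /mu/= /msum (eq_bigr (fun=> (1 : R)%:E)); last by move=> i _; exact: diracT.
  by rewrite sumEFin sumr_const card_ord.
have bmu : (0 < mu setT < +oo)%E by rewrite muT lte_fin ltr0n N0 ltry.
rewrite rint_mnormalize// /mass muT; congr (_ * _).
have [D Df] := bmeas_shift bf.
have /andP[_ fmu] := bmu.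
have bfD : bmeas (fun y => f y + D) by apply: bmeasD => //; exact: bmeas_cst.
suff : \int[mu]_y (f y + D) = \sum_(i < N) (f (tnth x i) + D).
  rewrite rintD//; last exact: bmeas_cst.
  rewrite rint_cst// /mass muT/= big_split/= sumr_const card_ord.
  by rewrite mulr_natr => /addIr.
rewrite /Rintegral ge0_integral_measure_sum//.
- rewrite (eq_bigr (fun i : 'I_N => (f (tnth x i) + D)%:E)).
    by rewrite sumEFin.
  move=> i _; rewrite integral_dirac//; last by apply/measurable_EFinP; case: bfD.
  by rewrite diracT mul1e (tnth_nth point).
- by move=> y _; rewrite lee_fin.
- by apply/measurable_EFinP; case: bfD.
Qed.

Lemma rint_measure_add (m1 m2 : {measure set T -> \bar R}) (f : T -> R) :
  (m1 setT < +oo)%E -> (m2 setT < +oo)%E -> bmeas f ->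
  \int[measure_add m1 m2]_x f x = \int[m1]_x f x + \int[m2]_x f x.
Proof.
move=> f1 f2 bf; rewrite /Rintegral integral_measure_add//.
- by rewrite fineD//; apply: integrable_fin_num => //; exact: bmeas_integrable.
- exact: bmeas_integrable.
- exact: bmeas_integrable.
Qed.

Lemma rint_mscale (c : R) (c0 : 0 <= c) (mu : {measure set T -> \bar R})
    (f : T -> R) : (mu setT < +oo)%E -> bmeas f ->
  \int[mscale (NngNum c0) mu]_x f x = c * \int[mu]_x f x.
Proof.
move=> fmu bf; have [D Df] := bmeas_shift bf.
have bD : bmeas (fun=> D : R) := bmeas_cst _ D.
have bfD : bmeas (fun y => f y + D) by exact: bmeasD.
have fs : (mscale (NngNum c0) mu setT < +oo)%E.
  by rewrite /= /mscale/= -mass_EFin// -EFinM ltry.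
have ms : mass (mscale (NngNum c0) mu) = c * mass mu.
  by rewrite {1}/mass/= /mscale/= -mass_EFin.
suff : \int[mscale (NngNum c0) mu]_x (f x + D) = c * \int[mu]_x (f x + D).
  by rewrite !rintD// !rint_cst// mulrDr ms mulrCA => /addIr.
rewrite /Rintegral ge0_integral_mscale//.
- by rewrite fineM// -rint_EFin.
- by apply/measurable_EFinP; case: bfD.
- by move=> y _; rewrite lee_fin.
Qed.

End elementary_measures.

(** * Conditionally independent samples and their deviations *)

Section kernel_pullback.
Context (R : realType) d d' d'' (X : measurableType d) (Y : measurableType d')
  (Z : measurableType d'').
Variables (h : X -> Y) (K : R.-ker Y ~> Z).

(** Turns a kernel on the space of conditioning values into a kernel on the sample space. The
    measurability proof is an argument so that the kernel structure can be inferred. *)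
Definition kpullback (mh : measurable_fun setT h) (x : X) :
  {measure set Z -> \bar R} := K (h x).

Let measurable_kpullback (mh : measurable_fun setT h) U : measurable U ->
  measurable_fun [set: X] (kpullback mh ^~ U).
Proof. by move=> mU; exact: (measurableT_comp (measurable_kernel K _ mU) mh). Qed.

HB.instance Definition _ (mh : measurable_fun setT h) :=
  isKernel.Build _ _ _ _ _ (kpullback mh) (measurable_kpullback mh).

End kernel_pullback.

Section probability_kernels.
Context (R : realType) d d' (T : measurableType d) (S : measurableType d').
Variable K : R.-ker T ~> S.
Hypothesis K1 : forall x, K x setT = 1%E.

Lemma pker_le x : (K x setT <= 1%:E)%E. Proof. by rewrite K1. Qed.

Lemma pker_finite x : (K x setT < +oo)%E. Proof. by rewrite K1 ltry. Qed.

Lemma mass_pker x : mass (K x) = 1. Proof. by rewrite /mass K1. Qed.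

Lemma kfun_bmeas1 f : bmeas f -> bmeas (kfun K f).
Proof. exact: kfun_bmeas pker_le f. Qed.

Lemma kfun_indic A x : measurable A -> kfun K (\1_A) x = fine (K x A).
Proof. by move=> mA; rewrite /kfun /Rintegral integral_indic// setIT. Qed.

Lemma kfun_ge0 f x : (forall y, 0 <= f y) -> 0 <= kfun K f x.
Proof. by move=> f0; apply: Rintegral_ge0. Qed.

Lemma kfun_norm_le f x C : bmeas f -> (forall y, `|f y| <= C) -> `|kfun K f x| <= C.
Proof.
move=> bf fC; apply: le_trans (rint_norm_le (pker_finite x) bf fC) _.
by rewrite mass_pker mulr1.
Qed.

End probability_kernels.

Section extension_from_sets.
Context (R : realType) d d' (Om : measurableType d) (S : measurableType d').
Variables (P : probability Om R) (k1 k2 : R.-ker Om ~> S).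
Hypotheses (k11 : forall x, k1 x setT = 1%E) (k21 : forall x, k2 x setT = 1%E).
Variables (U V : Om -> R).
Hypotheses (bU : bmeas U) (bV : bmeas V).
Hypotheses (U0 : forall w, 0 <= U w) (V0 : forall w, 0 <= V w).

Let kw_le (k : R.-ker Om ~> S) W (W0 : forall w, 0 <= W w) (bW : bmeas W) :
  (forall x, k x setT = 1%E) ->
  exists C : R, forall x, (kweight W0 k bW.1 x setT <= C%:E)%E.
Proof.
move=> k1'; have [_ [C WC]] := bW; exists C => x.
by rewrite /kweight/= /mscale/= k1' mule1 lee_fin (le_trans (ler_norm _)).
Qed.

Let rint_kw (k : R.-ker Om ~> S) W (W0 : forall w, 0 <= W w) (bW : bmeas W) f :
  (forall x, k x setT = 1%E) -> bmeas f ->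
  \int[kpush P (kweight W0 k bW.1)]_y f y = \int[P]_w (W w * kfun k f w).
Proof.
move=> k1' bf; have [C WC] := kw_le W0 bW k1'.
rewrite (rint_kpush WC)//; last exact: prob_finite.
apply: eq_Rintegral => w _; rewrite /kfun /kweight rint_mscale//.
by rewrite k1' ltry.
Qed.

(** Both sides are integrals of [f] against measures on [S], namely [P] weighted by [U] or [V] and
    pushed through the kernel; these measures agree on every measurable set, hence on functions. *)
Lemma eq_rint_kernels :
  (forall A, measurable A ->
    \int[P]_w (U w * fine (k1 w A)) = \int[P]_w (V w * fine (k2 w A))) ->
  forall f, bmeas f ->
    \int[P]_w (U w * kfun k1 f w) = \int[P]_w (V w * kfun k2 f w).
Proof.
move=> UV f bf; rewrite -(rint_kw U0 bU)// -(rint_kw V0 bV)//.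
rewrite /Rintegral; congr fine; apply: eq_measure_integral => A mA _.
have fin W (W0 : forall w, 0 <= W w) (bW : bmeas W) (k : R.-ker Om ~> S) :
    (forall x, k x setT = 1%E) -> kpush P (kweight W0 k bW.1) A =
    (\int[P]_w (W w * fine (k w A)))%:E.
  move=> k1'; rewrite rint_EFin//; last 2 first.
  - exact: prob_finite.
  - apply: bmeasM => //; rewrite (_ : (fun _ => _) = kfun k (\1_A)).
      by apply: kfun_bmeas1 => //; exact: bmeas_indic.
    by apply/funext => w; rewrite kfun_indic.
  apply: eq_integral => w _; rewrite /kweight/= /mscale/= EFinM fineK//.
  rewrite ge0_fin_numE//; apply: le_lt_trans (pker_finite k1' w).
  by apply: le_measure => //; rewrite inE.
by rewrite [LHS]fin// [RHS]fin// UV.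
Qed.

End extension_from_sets.

Section conditional_independence.
Context (R : realType) d d' d'' (Om : measurableType d) (Om' : measurableType d')
  (T : measurableType d'').
Variables (P : probability Om R) (pi : Om -> Om') (N : nat)
  (Y : Om -> N.-tuple T) (kap : 'I_N -> R.-ker Om' ~> T).
Hypothesis mpi : measurable_fun setT pi.
Hypothesis mY : measurable_fun setT Y.
Hypothesis kap1 : forall i w, kap i w setT = 1%E.

(** The conditioning information is carried by [pi]. Two instances serve below: the identity into
    the sample space with the smaller sigma-algebra of the past, and the constant map to [unit] for
    the initial particles. *)
Definition conditional_product : Prop :=
  forall (F : set Om') (A : 'I_N -> set T),
  measurable F -> (forall i, measurable (A i)) ->
  P (pi @^-1` F `&` [set w | forall i, A i (tnth (Y w) i)]) =
  (\int[P]_(w in pi @^-1` F) (\prod_(i < N) fine (kap i (pi w) (A i)))%:E)%E.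

Hypothesis step : conditional_product.

Let mYi i : measurable_fun setT (fun w => tnth (Y w) i).
Proof. exact: measurableT_comp (measurable_tnth i) mY. Qed.

Let bh (f : T -> R) i : bmeas f -> bmeas (fun w => f (tnth (Y w) i)).
Proof. exact: bmeas_comp. Qed.

Let bW (f : Om' -> R) : bmeas f -> bmeas (fun w => f (pi w)).
Proof. exact: bmeas_comp. Qed.

Let bk (f : T -> R) i : bmeas f -> bmeas (fun w => kfun (kap i) f (pi w)).
Proof. by move=> bf; apply: bW; apply: kfun_bmeas1. Qed.

(** Indicators are replaced by functions one coordinate at a time: coordinates from [j] on are still
    indicators. To free coordinate [j], the other factors are frozen into weights, and the induction
    hypothesis, used with an indicator in position [j], is the equality on sets that
    [eq_rint_kernels] extends. *)
Let step_fun (F : set Om') (mF : measurable F) (j : nat) :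
  (j <= N)%N -> forall H : 'I_N -> T -> R,
  (forall i, bmeas (H i)) -> (forall i y, 0 <= H i y) ->
  (forall i : 'I_N, (j <= i)%N -> exists2 A, measurable A & H i = \1_A) ->
  \int[P]_w (\1_F (pi w) * \prod_i H i (tnth (Y w) i)) =
  \int[P]_w (\1_F (pi w) * \prod_i kfun (kap i) (H i) (pi w)).
Proof.
elim: j => [_|j IH jN] H bH H0 HA.
  pose A i := projT1 (cid2 (HA i (leq0n _))).
  have mA i : measurable (A i) by rewrite /A; case: cid2.
  have HE i : H i = \1_(A i) by rewrite /A; case: cid2.
  have mpF : measurable (pi @^-1` F) by rewrite -[_ @^-1` _]setTI; exact: mpi.
  have := step mF mA; rewrite /Rintegral.
  move=> E; congr fine.
  rewrite (eq_integral (fun w =>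
    (\1_(pi @^-1` F `&` [set w | forall i, A i (tnth (Y w) i)]) w : R)%:E)).
    rewrite integral_indic//; last first.
      apply: measurableI => //.
      rewrite (_ : [set w | _] = \bigcap_(i in [set: 'I_N])
        ((fun w => tnth (Y w) i) @^-1` A i)).
        apply: fin_bigcap_measurable => // i _.
        by rewrite -[_ @^-1` _]setTI; exact: mYi.
      by apply/seteqP; split => w /= h i; [move=> _|]; exact: h.
    rewrite setIT; apply: (etrans E); rewrite [LHS]integral_mkcond.
    apply: eq_integral => w _.
    rewrite patchE; under [in RHS]eq_bigr => i _ do rewrite HE kfun_indic//.
    rewrite indicE; have -> : (w \in pi @^-1` F) = (pi w \in F).
      by apply/idP/idP; rewrite !inE.
    by case: ifP; rewrite ?mul1r ?mul0r.
  move=> w _; congr EFin; rewrite !indicE in_setI.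
  have -> : (w \in pi @^-1` F) = (pi w \in F) by apply/idP/idP; rewrite !inE.
  case: (pi w \in F) => /=; last by rewrite mul0r.
  rewrite mul1r; have [wA|wA] := boolP (w \in _).
    by rewrite big1// => i _; rewrite HE indicE mem_set//; move: wA; rewrite inE.
  move: wA; rewrite notin_setE/= => /existsNP[i iA].
  by rewrite (bigD1 i)//= HE indicE memNset// mul0r.
pose j0 := Ordinal jN.
(* The value at coordinate [j0] is written as an integral against a Dirac kernel, so that both sides
   become a weight times a kernel integral. *)
rewrite (@eq_Rintegral _ _ _ P setT (fun w =>
  (\1_F (pi w) * \prod_(i | i != j0) H i (tnth (Y w) i)) *
   kfun (kdirac (mYi j0)) (H j0) w)); last first.
  move=> w _; rewrite (bigD1 j0)//= /kfun rint_dirac; last by case: (bH j0).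
  by rewrite mulrAC mulrA.
rewrite [RHS](@eq_Rintegral _ _ _ P setT (fun w =>
  (\1_F (pi w) * \prod_(i | i != j0) kfun (kap i) (H i) (pi w)) *
   kfun (kpullback (kap j0) mpi) (H j0) w)); last first.
  by move=> w _; rewrite (bigD1 j0)//= [in RHS]mulrAC mulrA.
have bF : bmeas (fun w => \1_F (pi w) : R) by apply: bW; exact: bmeas_indic.
have bprod (G : 'I_N -> Om -> R) : (forall i, bmeas (G i)) ->
    bmeas (fun w => \prod_(i | i != j0) G i w).
  move=> bG; rewrite (_ : (fun _ => _) =
    (fun w => \prod_(i <- [seq i <- index_enum 'I_N | i != j0]) G i w)).
    exact: bmeas_prod.
  by apply/funext => w; rewrite big_filter.
apply: eq_rint_kernels => //.
- by move=> w; rewrite /= /kdirac/= diracT.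
- by move=> w; exact: kap1.
- by apply: bmeasM => //; apply: bprod => i; exact: bh.
- by apply: bmeasM => //; apply: bprod => i; exact: bk.
- by move=> w; rewrite mulr_ge0// prodr_ge0.
- by move=> w; rewrite mulr_ge0// prodr_ge0// => i _; exact: kfun_ge0.
move=> A mA.
pose H' i := if i == j0 then \1_A else H i.
have := IH (ltnW jN) H'; rewrite /H'.
have h1 i : bmeas (if i == j0 then \1_A else H i).
  by case: ifP => // _; exact: bmeas_indic.
have h2 i y : 0 <= (if i == j0 then \1_A else H i) y by case: ifP.
have h3 (i : 'I_N) : (j <= i)%N ->
    exists2 A0, measurable A0 & (if i == j0 then \1_A else H i) = \1_A0.
  case: eqP => [_ _|ij ji]; first by exists A.
  by apply: HA; rewrite ltn_neqAle ji andbT; apply/eqP => jj; apply/ij/val_inj.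
move=> /(_ h1 h2 h3) E.
transitivity (\int[P]_w (\1_F (pi w) * \prod_i H' i (tnth (Y w) i))).
  apply: eq_Rintegral => w _; rewrite [in RHS](bigD1 j0)//= {1}/H' eqxx.
  rewrite /kdirac/= [in RHS]mulrCA mulrC; congr (_ * (_ * _)).
  by apply: eq_bigr => i; rewrite /H' => /negPf ->.
rewrite [LHS]E; apply: eq_Rintegral => w _; rewrite (bigD1 j0)//= eqxx kfun_indic//.
rewrite mulrCA mulrC; congr (_ * _ * _).
by apply: eq_bigr => i; rewrite /H' => /negPf ->.
Qed.

(** The same device extends the factor [\1_F] to [W]: here the products are the weights and [W] is
    integrated against the Dirac kernel at [pi w], so [W] may change sign. *)
Lemma conditional_prod (W : Om' -> R) (h : 'I_N -> T -> R) :
  bmeas W -> (forall i, bmeas (h i)) -> (forall i y, 0 <= h i y) ->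
  \int[P]_w (W (pi w) * \prod_i h i (tnth (Y w) i)) =
  \int[P]_w (W (pi w) * \prod_i kfun (kap i) (h i) (pi w)).
Proof.
move=> bWW mh h0.
have d1 x : kdirac (R := R) mpi x setT = 1%E by rewrite /= /kdirac/= diracT.
have E w : kfun (kdirac mpi) W w = W (pi w) by rewrite /kfun rint_dirac//; case: bWW.
transitivity (\int[P]_w ((\prod_i h i (tnth (Y w) i)) * kfun (kdirac mpi) W w)).
  by apply: eq_Rintegral => w _; rewrite mulrC E.
transitivity (\int[P]_w ((\prod_i kfun (kap i) (h i) (pi w)) *
                         kfun (kdirac mpi) W w)); last first.
  by apply: eq_Rintegral => w _; rewrite mulrC E.
apply: eq_rint_kernels => //.
- by apply: bmeas_prod => i; exact: bh.
- by apply: bmeas_prod => i; exact: bk.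
- by move=> w; rewrite prodr_ge0.
- by move=> w; rewrite prodr_ge0// => i _; exact: kfun_ge0.
move=> A mA; under eq_Rintegral do rewrite mulrC.
under [RHS]eq_Rintegral do rewrite mulrC.
apply: (step_fun mA (leqnn N)) => // i.
by rewrite leqNgt ltn_ord.
Qed.

Definition cdev (f : T -> R) (w : Om) : R :=
  N%:R^-1 * \sum_(i < N) (f (tnth (Y w) i) - kfun (kap i) f (pi w)).

Lemma bmeas_cdev f : bmeas f -> bmeas (cdev f).
Proof.
by move=> bf; apply: bmeasZ; apply: bmeas_sum => i; apply: bmeasB; [exact: bh|exact: bk].
Qed.

Lemma conditional_one (W : Om' -> R) (f : T -> R) i : bmeas W -> bmeas f ->
  \int[P]_w (W (pi w) * f (tnth (Y w) i)) =
  \int[P]_w (W (pi w) * kfun (kap i) f (pi w)).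
Proof.
move=> bWW bf; have [D fD] := bmeas_shift bf.
have bD d0 (S : measurableType d0) : bmeas (fun _ : S => D) by exact: bmeas_cst.
have finP := prob_finite P.
have bfD : bmeas (fun y => f y + D) by exact: bmeasD.
(* All factors but the [i]-th are 1. The shift by [D] provides the nonnegativity required by
   [conditional_prod] and cancels at the end. *)
pose h j : T -> R := if j == i then (fun y => f y + D) else (fun=> 1).
have bhj j : bmeas (h j) by rewrite /h; case: ifP => // _; exact: bmeas_cst.
have h0 j y : 0 <= h j y by rewrite /h; case: ifP.
have := conditional_prod bWW bhj h0.
have kc j (c : R) w : kfun (kap j) (fun=> c) w = c.
  by rewrite /kfun rint_cst mass_pker ?mulr1.
have bWp := bW bWW.
rewrite (@eq_Rintegral _ _ _ P setT
  (fun w => W (pi w) * f (tnth (Y w) i) + D * W (pi w))); last first.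
  move=> w _; rewrite (bigD1 i)//= big1 ?mulr1; last first.
    by move=> j ji; rewrite /h (negPf ji).
  by rewrite /h eqxx mulrDr [D * _]mulrC.
rewrite [X in _ = X -> _](@eq_Rintegral _ _ _ P setT
  (fun w => W (pi w) * kfun (kap i) f (pi w) + D * W (pi w))); last first.
  move=> w _; rewrite (bigD1 i)//= big1 ?mulr1; last first.
    by move=> j ji; rewrite /h (negPf ji) kc.
  rewrite /h eqxx /kfun rintD//; last exact: pker_finite.
  by rewrite -[\int[_]_x D]/(kfun _ _ _) kc mulrDr [D * _]mulrC.
have bf1 := bh i bf.
have bf2 := bk i bf.
have b3 : bmeas (fun w => W (pi w) * f (tnth (Y w) i)) by exact: bmeasM.
have b4 : bmeas (fun w => W (pi w) * kfun (kap i) f (pi w)) by exact: bmeasM.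
have b5 : bmeas (fun w => D * W (pi w)) by exact: bmeasZ.
by rewrite !rintD// => /addIr.
Qed.

Lemma cdev_mean0 (W : Om' -> R) (f : T -> R) : bmeas W -> bmeas f ->
  \int[P]_w (W (pi w) * cdev f w) = 0.
Proof.
move=> bWW bf; have finP := prob_finite P; have bWp := bW bWW.
have b1 i := bh i bf; have b2 i := bk i bf.
rewrite (@eq_Rintegral _ _ _ P setT (fun w => N%:R^-1 * \sum_(i < N)
  (W (pi w) * f (tnth (Y w) i) - W (pi w) * kfun (kap i) f (pi w)))); last first.
  move=> w _; rewrite /cdev mulrCA mulr_sumr; congr (_ * _).
  by apply: eq_bigr => i _; rewrite mulrBr.
have b3 i : bmeas (fun w => W (pi w) * f (tnth (Y w) i)) by exact: bmeasM.
have b4 i : bmeas (fun w => W (pi w) * kfun (kap i) f (pi w)) by exact: bmeasM.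
have b5 i := bmeasB (b3 i) (b4 i).
rewrite rintZ//; last exact: bmeas_sum.
rewrite rint_sum// big1 ?mulr0// => i _.
by rewrite rintB// conditional_one// subrr.
Qed.

(** From [expR x <= 1 / (1 - x)], since [(1 - x)(1 + x + 2 x^2) = 1 + x^2 (1 - 2 x)] is at least 1
    on this range. *)
Let expR_le_quad (x : R) : `|x| <= 2^-1 -> expR x <= 1 + x + 2 * x ^+ 2.
Proof.
rewrite ler_norml => /andP[x1 x2].
have := expR_ge1Dx (- x); rewrite expRN => h.
have p : 0 < 1 + - x by lra.
apply: (@le_trans _ _ (1 + - x)^-1).
  by rewrite -[expR x]invrK lef_pV2// posrE ?invr_gt0 ?expR_gt0.
rewrite -[_^-1]mul1r ler_pdivrMr//.
have : 0 <= x ^+ 2 * (1 - 2 * x) by rewrite mulr_ge0 ?sqr_ge0//; lra.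
by rewrite !expr2; nra.
Qed.

(** A Hoeffding-type bound with crude constants. Each of the [N] independent centered factors
    contributes at most [expR (1 / N)], whence [expR 1]; the factor 2 pays for the absolute value,
    through [e^|x| <= e^x + e^-x]. The weight [W] allows later use under masses known from the
    past. *)
Lemma cdev_exp (W : Om' -> R) (f : T -> R) (C : R) : (0 < N)%N -> bmeas W ->
  (forall w, 0 <= W w) -> bmeas f -> 0 < C -> (forall y, `|f y| <= C) ->
  \int[P]_w (W (pi w) * expR (Num.sqrt N%:R / (4 * C) * `|cdev f w|)) <=
  2 * expR 1 * \int[P]_w W (pi w).
Proof.
move=> N0 bWW W0 bf C0 fC; have finP := prob_finite P; have bWp := bW bWW.
have NR : (0 : R) < N%:R by rewrite ltr0n.
have sN : 0 < Num.sqrt (N%:R : R) by rewrite sqrtr_gt0.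
have sN1 : 1 <= Num.sqrt (N%:R : R) by rewrite -[leLHS]sqrtr1 ler_wsqrtr// ler1n.
have NE : (N%:R : R) = Num.sqrt N%:R ^+ 2 by rewrite sqr_sqrtr// ltW.
(* The scale per particle: the exponent is [t] times the absolute value of the unnormalized sum, and
   [t * C <= 1/4] keeps each centered term within the range of [expR_le_quad]. *)
pose t : R := (4 * C * Num.sqrt N%:R)^-1.
have t0 : 0 < t by rewrite invr_gt0 !mulr_gt0.
have tC : t * C * 4 * Num.sqrt N%:R = 1.
  by rewrite /t; field; rewrite !gt_eqF.
have fin i w := pker_finite (kap1 i) w.
have one (s : R) : `|s| = t ->
    \int[P]_w (W (pi w) * expR (s * \sum_(i < N) (f (tnth (Y w) i) - kfun (kap i) f (pi w))))
    <= expR 1 * \int[P]_w W (pi w).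
  move=> st.
  (* The conditional means are functions of [pi], so their exponentials join the weight; what
     remains is a product of functions of single particles. *)
  pose W' (w : Om') : R := W w * \prod_(i < N) expR (- (s * kfun (kap i) f w)).
  have bsf : bmeas (fun y => s * f y) by exact: bmeasZ.
  have bW' : bmeas W'.
    apply: bmeasM => //; apply: bmeas_prod => i; apply: bmeas_exp; apply: bmeasN.
    by apply: bmeasZ; exact: kfun_bmeas1.
  have be : bmeas (fun y => expR (s * f y)) by exact: bmeas_exp.
  rewrite (@eq_Rintegral _ _ _ P setT (fun w => W' (pi w) *
      \prod_(i < N) expR (s * f (tnth (Y w) i)))); last first.
    move=> w _; rewrite /W' -mulrA -big_split/= mulr_sumr expR_sum.
    congr (_ * _); apply: eq_bigr => i _.
    by rewrite -expRD mulrBr addrC.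
  rewrite (conditional_prod bW' (fun=> be)); last by move=> _ y; exact: expR_ge0.
  rewrite -rintZ//; apply: rint_le => //.
  - apply: bmeasM; first exact: bW.
    by apply: bmeas_prod => i; exact: bk.
  - exact: bmeasZ.
  move=> w; rewrite /W' -mulrA -big_split/= mulrC ler_wpM2r//.
  apply: (@le_trans _ _ (\prod_(i < N) expR N%:R^-1)); last first.
    by rewrite prodr_const card_ord -expRM_natl divff// gt_eqF.
  apply: ler_prod => i _; apply/andP; split.
    by rewrite mulr_ge0 ?expR_ge0// kfun_ge0// => y; exact: expR_ge0.
  set a := s * kfun (kap i) f (pi w).
  have aC : `|a| <= t * C.
    by rewrite /a normrM st ler_wpM2l ?(ltW t0)// kfun_norm_le.
  have sfC y : `|s * f y| <= t * C by rewrite normrM st ler_wpM2l// ltW.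
  have tCN : t * C <= 4^-1.
    have : t * C * 4 <= t * C * 4 * Num.sqrt N%:R by rewrite ler_peMr// !mulr_ge0// ltW.
    by rewrite tC; lra.
  have -> : expR (- a) * kfun (kap i) (fun y => expR (s * f y)) (pi w) =
      kfun (kap i) (fun y => expR (s * f y - a)) (pi w).
    rewrite /kfun -rintZ//.
    by apply: eq_Rintegral => y _; rewrite -expRD addrC.
  have bsfa : bmeas (fun y => s * f y - a) by apply: bmeasB => //; exact: bmeas_cst.
  (* The quadratic term is at most [2 (2 t C)^2 = 1 / (2 N)], and the linear term has conditional
     mean 0, so only [1 + 1 / N] survives. *)
  apply: (@le_trans _ _ (kfun (kap i) (fun y => (1 + N%:R^-1) + (s * f y - a)) (pi w))).
    apply: rint_le => //; first exact: bmeas_exp.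
      by apply: bmeasD => //; exact: bmeas_cst.
    move=> y; set x := s * f y - a.
    have xC : `|x| <= 2 * (t * C).
      by rewrite (le_trans (ler_normB _ _))//; move: (sfC y) aC; lra.
    have x2 : `|x| <= 2^-1 by lra.
    apply: (le_trans (expR_le_quad x2)).
    have : x ^+ 2 <= (2 * (t * C)) ^+ 2.
      by rewrite -(real_normK (num_real x)) lerXn2r// nnegrE (le_trans _ xC).
    have : (t * C) ^+ 2 * 16 = N%:R^-1.
      by rewrite NE /t; field; rewrite !gt_eqF.
    have : 0 < (N%:R : R)^-1 by rewrite invr_gt0.
    rewrite !expr2; lra.
  rewrite /kfun rintD//; last exact: bmeas_cst.
  rewrite rint_cst// mass_pker// mulr1 rintB//; last exact: bmeas_cst.
  rewrite rintZ// rint_cst// mass_pker// mulr1 -/(kfun (kap i) f (pi w)) -/a subrr addr0.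
  exact: expR_ge1Dx.
pose S w := \sum_(i < N) (f (tnth (Y w) i) - kfun (kap i) f (pi w)).
have bS : bmeas S.
  by apply: bmeas_sum => i; apply: bmeasB; [exact: bh|exact: bk].
have b1 : bmeas (fun w => W (pi w) * expR (t * S w)).
  by apply: bmeasM => //; apply: bmeas_exp; exact: bmeasZ.
have b2 : bmeas (fun w => W (pi w) * expR (- t * S w)).
  by apply: bmeasM => //; apply: bmeas_exp; exact: bmeasZ.
apply: (@le_trans _ _ (\int[P]_w (W (pi w) * expR (t * S w) + W (pi w) * expR (- t * S w)))).
  apply: rint_le => //; last 2 first.
  - exact: bmeasD.
  - move=> w; rewrite -mulrDr ler_wpM2l//.
    have -> : Num.sqrt N%:R / (4 * C) * `|cdev f w| = t * `|S w|.
      rewrite /cdev -/(S w) normrM gtr0_norm ?invr_gt0// mulrA; congr (_ * _).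
      by rewrite {2}NE /t; field; rewrite !gt_eqF.
    have [h|h] := ger0P (S w).
      by rewrite lerDl expR_ge0.
    by rewrite mulrN mulNr lerDr expR_ge0.
  - apply: bmeasM => //; apply: bmeas_exp; apply: bmeasZ; apply: bmeas_norm.
    exact: bmeas_cdev.
rewrite rintD//.
have := one t (gtr0_norm t0).
have := one (- t); rewrite normrN => /(_ (gtr0_norm t0)).
rewrite -/(S _); lra.
Qed.

End conditional_independence.

(** * The semigroup [Q_{p,n}], its normalization, and the flow [gamma_n] *)

Section flow.
Context (R : realType) (d : nat -> measure_display)
  (E : forall n, measurableType (d n)) (X : model R E).
Implicit Type F : forall m, E m -> R.

Lemma pot_gt0 n x : 0 < pot X n x.
Proof.
have [lo [hi [lo0 /(_ x)/andP[lox _]]]] := pot_bounds X n.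
exact: lt_le_trans lo0 lox.
Qed.

Lemma bmeas_pot n : bmeas (pot X n).
Proof.
split; first exact: measurable_pot.
have [lo [hi [lo0 H]]] := pot_bounds X n; exists hi => x.
by rewrite gtr0_norm ?pot_gt0//; case/andP: (H x).
Qed.

Lemma mutation1 n x : mutation X n x setT = 1%E.
Proof. exact: prob_kernel. Qed.

Lemma source_finite n : (source X n setT < +oo)%E.
Proof. by rewrite ltey_eq fin_num_measure. Qed.

Lemma Qker_le n : exists C : R, forall x, (Qker X n x setT <= C%:E)%E.
Proof.
have [_ [C HC]] := bmeas_pot n; exists C => x.
by rewrite /Qker/= /kweight/= /mscale/= mutation1 mule1 lee_fin (le_trans (ler_norm _)).
Qed.

Definition Qop n (f : E n.+1 -> R) (x : E n) : R := kfun (Qker X n) f x.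

Lemma bmeas_Qop n f : bmeas f -> bmeas (@Qop n f).
Proof. by move=> bf; have [C HC] := Qker_le n; exact: kfun_bmeas HC _ bf. Qed.

Lemma QopE n f x : bmeas f -> @Qop n f x = pot X n x * kfun (mutation X n) f x.
Proof.
by move=> bf; rewrite /Qop /kfun /Qker /kweight rint_mscale// mutation1 ltry.
Qed.

Lemma Qker_finite n x : (Qker X n x setT < +oo)%E.
Proof. by have [C HC] := Qker_le n; exact: bounded_kernel_finite HC x. Qed.

Lemma QopZ n (g : E n.+1 -> R) (c : R) x : bmeas g ->
  Qop (fun y => c * g y) x = c * Qop g x.
Proof. by move=> bg; have fQ := Qker_finite x; rewrite /Qop /kfun rintZ. Qed.

Lemma Qop_le n (f g : E n.+1 -> R) x : bmeas f -> bmeas g ->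
  (forall y, f y <= g y) -> Qop f x <= Qop g x.
Proof. by move=> bf bg fg; apply: rint_le => //; exact: Qker_finite. Qed.

(** Unrolled from the first transition, whereas [Qiter] appends the last one: the time index of the
    argument then reduces by computation and no sum [k + p] appears in a type. *)
Fixpoint bwd (F : forall m, E m -> R) k p : E p -> R :=
  match k with
  | 0 => F p
  | k'.+1 => @Qop p (@bwd F k' p.+1)
  end.

Arguments bwd F k p x : clear implicits.

(** [phi F n p] is [Q_{p,n}(F n)]: a family of functions, of which only the one
    at time [n] matters, avoids transporting along [n - p + p = n]. *)
Definition phi F n p := bwd F (n - p) p.

Arguments phi F n p x : clear implicits.

Lemma phinn F n : phi F n n = F n.
Proof. by rewrite /phi subnn. Qed.

Lemma phi_rec F n p : (p < n)%N -> phi F n p = Qop (phi F n p.+1).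
Proof. by move=> pn; rewrite /phi -subSS subSn. Qed.

Lemma bmeas_bwd F k p : (forall m, bmeas (F m)) -> bmeas (bwd F k p).
Proof. by move=> bF; elim: k p => [|k IH] p //=; exact: bmeas_Qop. Qed.

Lemma bmeas_phi F n p : (forall m, bmeas (F m)) -> bmeas (phi F n p).
Proof. exact: bmeas_bwd. Qed.

Lemma bwdSr F k p : bwd F k.+1 p = bwd (fun m => Qop (F m.+1)) k p.
Proof. by elim: k p => [|k IH] p //=; rewrite -IH. Qed.

Lemma Qiter_finite p k x : (@Qiter _ _ _ X p k x setT < +oo)%E.
Proof.
elim: k => [|k IH] /=; first by rewrite diracT ltry.
by have [C HC] := Qker_le (k + p); exact: kpush_finite HC _ IH.
Qed.

(** Induction over all families: the last transition of [Qiter] is absorbed into the family by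
    [bwdSr]. *)
Lemma Qiter_bwd F p k x : (forall m, bmeas (F m)) ->
  kfun (@Qiter _ _ _ X p k) (F (k + p)%N) x = bwd F k p x.
Proof.
elim: k F => [|k IH] F bF.
  by rewrite /kfun/= rint_dirac//; case: (bF p).
rewrite bwdSr -IH; last by move=> m; exact: bmeas_Qop.
rewrite /kfun/=; have [C HC] := Qker_le (k + p).
by rewrite (rint_kpush HC)//; exact: Qiter_finite.
Qed.

Definition ones m (x : E m) : R := 1.

Arguments ones m x : clear implicits.

Lemma bmeas_ones m : bmeas (ones m).
Proof. exact: bmeas_cst. Qed.

Lemma Qone_phi n p (x : E p) : Qone X n x = phi ones n p x.
Proof. by rewrite -[RHS]Qiter_bwd//; move=> m; exact: bmeas_ones. Qed.

Lemma Pop_phi F n p (x : E p) : (forall m, bmeas (F m)) ->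
  Pop X (F (n - p + p)%N) x = phi F n p x / phi ones n p x.
Proof. by move=> bF; rewrite /Pop Qone_phi -[phi F n p x]Qiter_bwd. Qed.

(** Away from time [m0] the family is the constant [f point]; as all its values are values of [f],
    bounds and oscillations carry over. *)
Lemma extend_family m0 (f : E m0 -> R) : bmeas f ->
  exists F : forall m, E m -> R,
    [/\ F m0 = f, forall m, bmeas (F m) & forall m x, exists y, F m x = f y].
Proof.
move=> bf; pose F m : E m -> R :=
  match eqVneq m0 m with
  | EqNotNeq e => eq_rect m0 (fun m => E m -> R) f m e
  | NeqNotEq _ => fun=> f point
  end.
exists F; split.
- by rewrite /F; case: eqVneq => [e|/eqP//]; rewrite (eq_irrelevance e erefl).
- rewrite /F => m; case: eqVneq => [e|_]; last exact: bmeas_cst.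
  by case: _ / e.
- rewrite /F => m x; case: eqVneq x => [e|_] x; last by exists point.
  by case: _ / e x => x; exists x.
Qed.

Lemma descend (P : nat -> Prop) p q : (p <= q)%N ->
  (forall i, (p <= i < q)%N -> P i.+1 -> P i) -> P q -> P p.
Proof.
elim: q => [|q IH]; first by rewrite leqn0 => /eqP ->.
rewrite leq_eqVlt => /predU1P[->//|pq] st Pq; apply: IH => //.
  by move=> i /andP[pi iq]; apply: st; rewrite pi ltnS ltnW.
by apply: st => //; rewrite -ltnS pq ltnSn.
Qed.

(** Positivity and linearity of each [Q_{i+1}] carry the comparison from time [q] down to time
    [p]. *)
Lemma phi_le_scale (F G : forall m, E m -> R) (c : R) n p q :
  (forall m, bmeas (F m)) -> (forall m, bmeas (G m)) -> (p <= q <= n)%N ->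
  (forall y, phi F n q y <= c * phi G n q y) ->
  forall x, phi F n p x <= c * phi G n p x.
Proof.
move=> bF bG /andP[pq qn] H.
apply: (@descend (fun i => forall x, phi F n i x <= c * phi G n i x) p q pq _ H).
move=> i /andP[_ iq] IH x.
have lin := leq_trans iq qn.
rewrite (phi_rec F lin) (phi_rec G lin) -QopZ; last exact: bmeas_phi.
by apply: Qop_le => //; [exact: bmeas_phi|apply: bmeasZ; exact: bmeas_phi].
Qed.

Lemma phiN F n p x : (forall m, bmeas (F m)) ->
  phi (fun m y => - F m y) n p x = - phi F n p x.
Proof.
move=> bF; suff H (k q : nat) (y : E q) : bwd (fun m y => - F m y) k q y = - bwd F k q y.
  exact: H.
elim: k q y => [//|k IH] q y /=.
rewrite (_ : bwd _ k q.+1 = fun y => -1 * bwd F k q.+1 y).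
  by rewrite QopZ ?mulN1r//; exact: bmeas_bwd.
by apply/funext => z; rewrite IH mulN1r.
Qed.

Lemma phi_ge_scale (F G : forall m, E m -> R) (c : R) n p q :
  (forall m, bmeas (F m)) -> (forall m, bmeas (G m)) -> (p <= q <= n)%N ->
  (forall y, c * phi G n q y <= phi F n q y) ->
  forall x, c * phi G n p x <= phi F n p x.
Proof.
move=> bF bG pqn H x.
have bN m : bmeas (fun y : E m => - F m y) by exact: bmeasN.
have := @phi_le_scale (fun m y => - F m y) G (- c) n p q bN bG pqn _ x.
rewrite phiN// mulNr lerN2; apply => y; rewrite phiN// mulNr lerN2; exact: H.
Qed.

(** Makes the real-valued suprema [Qnorm] and [qpn] genuine suprema; without an upper bound they
    would take the default value 0. *)
Lemma phi_ones_bounds n p : exists lo hi : R,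
  0 < lo /\ forall x, lo <= phi ones n p x <= hi.
Proof.
suff H (k q : nat) : exists lo hi : R,
    0 < lo /\ forall x, lo <= bwd ones k q x <= hi by exact: H.
elim: k q => [|k IH] q /=.
  by exists 1, 1; split => // x; rewrite /ones lexx.
have [lo [hi [lo0 H]]] := IH q.+1.
have [lo' [hi' [lo0' H']]] := pot_bounds X q.
exists (lo' * lo), (hi' * hi); split; first exact: mulr_gt0.
have bb := @bmeas_bwd _ k q.+1 bmeas_ones.
move=> x; rewrite QopE//; have /andP[a1 a2] := H' x.
have bc c : kfun (mutation X q) (fun=> c) x = c.
  by rewrite /kfun rint_cst mass_pker ?mulr1// => y; exact: mutation1.
have fm : (mutation X q x setT < +oo)%E by rewrite mutation1 ltry.
apply/andP; split; apply: ler_pM => //; try exact: ltW; try exact: pot_ge0.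
- by rewrite -[leLHS]bc; apply: rint_le => //; [exact: bmeas_cst|move=> y; case/andP: (H y)].
- apply: kfun_ge0 => y; case/andP: (H y) => + _; apply: le_trans; exact: ltW.
- by rewrite -[leRHS]bc; apply: rint_le => //; [exact: bmeas_cst|move=> y; case/andP: (H y)].
Qed.

Lemma phi_ones_gt0 n p x : 0 < phi ones n p x.
Proof.
have [lo [hi [lo0 /(_ x)/andP[h _]]]] := phi_ones_bounds n p.
exact: lt_le_trans lo0 h.
Qed.

Lemma Qnorm_ge n p x : phi ones n p x <= Qnorm X p n.
Proof.
rewrite -Qone_phi (le_trans (ler_norm _))//; apply: ub_le_sup; last by exists x.
have [lo [hi [lo0 H]]] := phi_ones_bounds n p; exists hi => _ [y _ <-].
by rewrite Qone_phi gtr0_norm ?phi_ones_gt0//; case/andP: (H y).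
Qed.

Lemma Qnorm_le n p C : (forall x, phi ones n p x <= C) -> Qnorm X p n <= C.
Proof.
move=> H; apply: ge_sup; first by exists `|Qone X n (point : E p)|; exists point.
by move=> _ [y _ <-]; rewrite Qone_phi gtr0_norm ?phi_ones_gt0.
Qed.

Lemma Qnorm_gt0 n p : 0 < Qnorm X p n.
Proof. exact: lt_le_trans (phi_ones_gt0 n point) (Qnorm_ge n point). Qed.

Lemma qpn_ge n p x y : phi ones n p x / phi ones n p y <= qpn X p n.
Proof.
rewrite -!Qone_phi; apply: ub_le_sup; last by exists (x, y).
have [lo [hi [lo0 H]]] := phi_ones_bounds n p; exists (hi / lo) => _ [[u v] _ <-] /=.
rewrite !Qone_phi; have /andP[_ a] := H u; have /andP[b _] := H v.
apply: ler_pM => //; first by rewrite ltW// phi_ones_gt0.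
  by rewrite invr_ge0 ltW// phi_ones_gt0.
by rewrite lef_pV2// posrE phi_ones_gt0.
Qed.

Lemma qpn_le n p C : (forall x y, phi ones n p x <= C * phi ones n p y) -> qpn X p n <= C.
Proof.
move=> H; apply: ge_sup.
  by exists (Qone X n (point : E p) / Qone X n (point : E p)); exists (point, point).
move=> _ [[u v] _ <-] /=; rewrite !Qone_phi ler_pdivrMr ?phi_ones_gt0//.
Qed.

Lemma qpn_ge1 n p : 1 <= qpn X p n.
Proof.
have := @qpn_ge n p point point; rewrite divff//.
by rewrite gt_eqF// phi_ones_gt0.
Qed.

Lemma qpn_gt0 n p : 0 < qpn X p n.
Proof. exact: lt_le_trans (qpn_ge1 n p). Qed.

(** The supremum is at most [qpn] times any single value. This is the lower bound used for all
    denominators. *)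
Lemma Qnorm_qpn n p y : Qnorm X p n / qpn X p n <= phi ones n p y.
Proof.
rewrite ler_pdivrMr ?qpn_gt0//; apply: Qnorm_le => x.
by rewrite mulrC -ler_pdivrMr ?phi_ones_gt0// qpn_ge.
Qed.

Lemma Osc1P n (f : E n -> R) : Osc1 f <->
  measurable_fun setT f /\ forall x y, `|f x - f y| <= 1.
Proof.
split=> -[mf H]; split => //.
  move=> x y; rewrite -lee_fin (le_trans _ H)//; apply: ereal_sup_ubound.
  by exists (x, y).
by apply: ge_ereal_sup => _ [[x y] _ <-]; rewrite lee_fin; exact: H.
Qed.

Lemma Osc1_bmeas n (f : E n -> R) : Osc1 f -> bmeas f.
Proof.
move=> /Osc1P[mf H]; split => //; exists (`|f point| + 1) => x.
by have := ler_normD (f x - f point) (f point); rewrite subrK; have := H x point; lra.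
Qed.

(** This is [P_{p,n}(F n)]; [Pop_phi] identifies it with [Pop]. *)
Definition Pnorm F n p (x : E p) := phi F n p x / phi ones n p x.

Lemma Pnorm_le F n p q C : (forall m, bmeas (F m)) ->
  (p <= q <= n)%N ->
  (forall y : E q, Pnorm F n y <= C) -> forall x : E p, Pnorm F n x <= C.
Proof.
move=> bF pqn H x; rewrite ler_pdivrMr ?phi_ones_gt0//.
by apply: (phi_le_scale bF bmeas_ones pqn) => y; rewrite -ler_pdivrMr ?phi_ones_gt0//; exact: H.
Qed.

Lemma Pnorm_ge F n p q C : (forall m, bmeas (F m)) ->
  (p <= q <= n)%N ->
  (forall y : E q, C <= Pnorm F n y) -> forall x : E p, C <= Pnorm F n x.
Proof.
move=> bF pqn H x; rewrite ler_pdivlMr ?phi_ones_gt0//.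
by apply: (phi_ge_scale bF bmeas_ones pqn) => y; rewrite -ler_pdivlMr ?phi_ones_gt0//; exact: H.
Qed.

(** [P_{p,n}(F)] at a point is a weighted average of the values of [P_{q,n}(F)], so it stays within
    their range. *)
Lemma Pnorm_dist F n p q C : (forall m, bmeas (F m)) ->
  (p <= q <= n)%N ->
  (forall y z : E q, `|Pnorm F n y - Pnorm F n z| <= C) ->
  forall (x : E p) (y : E q), `|Pnorm F n x - Pnorm F n y| <= C.
Proof.
move=> bF pqn H x y; rewrite ler_norml; apply/andP; split.
  suff : Pnorm F n y - C <= Pnorm F n x by lra.
  apply: Pnorm_ge bF pqn _ x => z; have := H z y; rewrite ler_norml => /andP[]; lra.
suff : Pnorm F n x <= Pnorm F n y + C by lra.
apply: Pnorm_le bF pqn _ x => z; have := H z y; rewrite ler_norml => /andP[]; lra.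
Qed.

Lemma Pnormnn F n (x : E n) : Pnorm F n x = F n x.
Proof. by rewrite /Pnorm !phinn /ones divr1. Qed.

Lemma Pnorm_osc1 F n p (x y : E p) : (forall m, Osc1 (F m)) -> (p <= n)%N ->
  `|Pnorm F n x - Pnorm F n y| <= 1.
Proof.
move=> oF pn; have bF m : bmeas (F m) by exact: Osc1_bmeas.
have ppn : (p <= n <= n)%N by rewrite pn leqnn.
have H (z u : E n) : `|Pnorm F n z - Pnorm F n u| <= 1.
  by rewrite !Pnormnn; case/Osc1P: (oF n).
have Hx u := Pnorm_dist bF ppn H x u.
have : Pnorm F n x - 1 <= Pnorm F n y.
  by apply: Pnorm_ge bF ppn _ y => u; move: (Hx u); rewrite ler_norml => /andP[]; lra.
have : Pnorm F n y <= Pnorm F n x + 1.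
  by apply: Pnorm_le bF ppn _ y => u; move: (Hx u); rewrite ler_norml => /andP[]; lra.
by move=> ? ?; rewrite ler_norml; apply/andP; split; lra.
Qed.

Lemma extend_Osc1 m0 (f : E m0 -> R) : Osc1 f ->
  exists F : forall m, E m -> R, F m0 = f /\ forall m, Osc1 (F m).
Proof.
move=> of1; have [F [Ff bF Fr]] := extend_family (Osc1_bmeas of1).
exists F; split => // m; apply/Osc1P; split; first by case: (bF m).
move=> x y; have [u ->] := Fr m x; have [v ->] := Fr m y.
by have /Osc1P[_] := of1; exact.
Qed.

(** The bound 1 makes both nested suprema in [betaP] genuine. *)
Let Pop_osc1 n p (x y : E p) (f : E (n - p + p)%N -> R) : (p <= n)%N -> Osc1 f ->
  `|Pop X f x - Pop X f y| <= 1.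
Proof.
move=> pn /extend_Osc1[F [<- oF]]; have bF m := Osc1_bmeas (oF m).
by rewrite !Pop_phi//; exact: (Pnorm_osc1 x y oF pn).
Qed.

Let Osc1_0 n : @Osc1 R _ (E n) (cst 0).
Proof. by apply/Osc1P; split => // x y; rewrite subrr normr0. Qed.

Let tv_nonempty n p (x y : E p) :
  [set `|Pop X f x - Pop X f y| | f in @Osc1 R _ (E (n - p + p)%N)] !=set0.
Proof. by eexists; exists (cst 0). Qed.

Lemma betaP_ge F n p (x y : E p) : (p <= n)%N -> (forall m, Osc1 (F m)) ->
  `|Pnorm F n x - Pnorm F n y| <= betaP X p n.
Proof.
move=> pn oF; have bF m := Osc1_bmeas (oF m).
apply: (@le_trans _ _ (tvnorm (fun f => @Pop _ _ _ X p n f x - @Pop _ _ _ X p n f y))).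
  apply: ub_le_sup; last by exists (F (n - p + p)%N) => //; rewrite !Pop_phi.
  by exists 1 => _ [f of1 <-]; exact: Pop_osc1.
apply: ub_le_sup; last by exists (x, y).
exists 1 => _ [[u v] _ <-] /=; apply: ge_sup; first exact: tv_nonempty.
by move=> _ [f of1 <-]; exact: Pop_osc1.
Qed.

Lemma betaP_le n p C :
  (forall F (x y : E p), (forall m, Osc1 (F m)) -> `|Pnorm F n x - Pnorm F n y| <= C) ->
  betaP X p n <= C.
Proof.
move=> H; apply: ge_sup.
  by eexists; exists (point, point) => //; reflexivity.
move=> _ [[u v] _ <-] /=; apply: ge_sup; first exact: tv_nonempty.
move=> _ [f /extend_Osc1[F [<- oF]] <-]; have bF m := Osc1_bmeas (oF m).
by rewrite !Pop_phi//; exact: H.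
Qed.

Lemma betaP_ge0 n p : (p <= n)%N -> 0 <= betaP X p n.
Proof.
move=> pn; have := @betaP_ge (fun m => cst 0) n p point point pn (fun m => Osc1_0 m).
by rewrite subrr normr0.
Qed.

Lemma betaP_le1 n p : (p <= n)%N -> betaP X p n <= 1.
Proof. by move=> pn; apply: betaP_le => F x y oF; exact: Pnorm_osc1. Qed.

Lemma gamma_finite n : (gamma X n setT < +oo)%E.
Proof.
elim: n => [|n IH]; first exact: source_finite.
have [C HC] := Qker_le n.
have -> : gamma X n.+1 setT =
    (kpush (gamma X n) (Qker X n) setT + source X n.+1 setT)%E by exact: measure_addE.
by rewrite lte_add_pinfty//; [exact: kpush_finite HC _ IH|exact: source_finite].
Qed.

Lemma rint_gammaS n f : bmeas f ->
  \int[gamma X n.+1]_x f x = \int[gamma X n]_x Qop f x + \int[source X n.+1]_x f x.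
Proof.
have [C HC] := Qker_le n; have fg := gamma_finite n; move=> bf.
rewrite /= rint_measure_add//; last exact: source_finite; last exact: kpush_finite HC _ fg.
by rewrite (rint_kpush HC).
Qed.

Lemma massE n (mu : {measure set (E n) -> \bar R}) : mass mu = \int[mu]_x ones n x.
Proof. by rewrite rint_cst mul1r. Qed.

Lemma mass_gammaS n :
  mass (gamma X n.+1) = \int[gamma X n]_x pot X n x + mass (source X n.+1).
Proof.
rewrite massE rint_gammaS; last exact: bmeas_ones.
rewrite -massE; congr (_ + _); apply: eq_Rintegral => x _.
rewrite QopE; last exact: bmeas_ones.
by rewrite /kfun -massE mass_pker ?mulr1// => y; exact: mutation1.
Qed.

Lemma mass_source0_gt0 : 0 < mass (source X 0).
Proof. by rewrite -lte_fin mass_EFin ?source0_gt0//; exact: source_finite. Qed.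

Lemma mass_gamma_gt0 n : 0 < mass (gamma X n).
Proof.
elim: n => [|n IH]; first exact: mass_source0_gt0.
rewrite mass_gammaS ltr_pwDl ?mass_ge0//.
have [lo [hi [lo0 H]]] := pot_bounds X n.
apply: (@lt_le_trans _ _ (lo * mass (gamma X n))); first exact: mulr_gt0.
have fg := gamma_finite n; rewrite -rint_cst; apply: rint_le => //.
- exact: bmeas_cst.
- exact: bmeas_pot.
- by move=> x; case/andP: (H x).
Qed.

Lemma rint_eta n f : bmeas f ->
  \int[Defs.eta X n]_x f x = \int[gamma X n]_x f x / mass (gamma X n).
Proof.
move=> bf; rewrite /Defs.eta rint_mnormalize// 1?mulrC//.
by rewrite gamma_finite andbT -mass_EFin ?gamma_finite// lte_fin mass_gamma_gt0.
Qed.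

(** [sum_(p < q <= n) mu_q Q_{q,n}(F n)] *)
Definition ssum F n p : R := \sum_(p.+1 <= q < n.+1) \int[source X q]_x phi F n q x.

Lemma ssumnn F n : ssum F n n = 0.
Proof. by rewrite /ssum big_geq. Qed.

Lemma ssum_rec F n p : (p < n)%N ->
  ssum F n p = \int[source X p.+1]_x phi F n p.+1 x + ssum F n p.+1.
Proof. by move=> pn; rewrite /ssum big_ltn. Qed.

Lemma csum_ssum n p : csum X p n = ssum ones n p.
Proof.
rewrite /csum /ssum; apply: eq_bigr => q _; apply: eq_Rintegral => x _.
exact: Qone_phi.
Qed.

Lemma gamma_phi F n p : (forall m, bmeas (F m)) -> (p <= n)%N ->
  \int[gamma X n]_x F n x = \int[gamma X p]_x phi F n p x + ssum F n p.
Proof.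
move=> bF pn; apply: (@descend
    (fun p => \int[gamma X n]_x F n x = \int[gamma X p]_x phi F n p x + ssum F n p)
    p n pn) => [i /andP[_ ilt] ->|].
  rewrite rint_gammaS; last exact: bmeas_phi.
  by rewrite (ssum_rec _ ilt) addrA (phi_rec F ilt).
by rewrite phinn ssumnn addr0.
Qed.

End flow.

Arguments bwd {R d E} X F k p x.
Arguments phi {R d E} X F n p x.
Arguments ones {R d E} m x.

Section kernel_of.
Context (R : realType) d d' (T : measurableType d) (S : measurableType d').
Variable k : T -> {measure set S -> \bar R}.

(** An identity carrying the measurability proof, on which a kernel structure can be declared. *)
Definition kernel_of
  (mk : forall U, measurable U -> measurable_fun setT (k ^~ U)) := k.

HB.instance Definition _ mk :=
  isKernel.Build _ _ _ _ _ (kernel_of mk) mk.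

End kernel_of.

(** * Bounds on the masses of [gamma_n] and [gamma^N_n] *)

Section mass_bounds.
Context (R : realType) (d : nat -> measure_display)
  (E : forall n, measurableType (d n)) (X : model R E).

Lemma pot_le_gplus n p x : (p < n)%N -> pot X p x <= gplus X n.
Proof.
move=> pn; apply: ub_le_sup; last by exists p, x.
have /choice[hi hiP] : forall q, exists h, forall y, pot X q y <= h.
  by move=> q; have [lo [h [_ H]]] := pot_bounds X q; exists h => y; case/andP: (H y).
(* The bounds [hi] are nonnegative, so their sum dominates each of them. *)
exists (\sum_(q < n) hi q) => _ [q [y [qn ->]]].
rewrite (bigD1 (Ordinal qn))//= (le_trans (hiP q y))// lerDl sumr_ge0// => j _.
by rewrite (le_trans _ (hiP j point))// pot_ge0.
Qed.

Lemma gminus_le_pot n p x : (p < n)%N -> gminus X n <= pot X p x.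
Proof.
move=> pn; apply: ge_inf; last by exists p, x.
by exists 0 => _ [q [y [_ ->]]]; exact: pot_ge0.
Qed.

Lemma gminus_ge0 n : 0 <= gminus X n.
Proof.
case: n => [|n].
  rewrite /gminus (_ : [set g | _] = set0) ?inf0//.
  by apply/seteqP; split => // g [p [x [/=]]]; rewrite ltn0.
apply: lb_le_inf; first by exists (pot X 0 point); exists 0%N, point.
by move=> _ [q [y [_ ->]]]; exact: pot_ge0.
Qed.

Let polyS (g : R) j :
  \sum_(0 <= p < j.+2) mass (source X p) * g ^+ (j.+1 - p) =
  g * (\sum_(0 <= p < j.+1) mass (source X p) * g ^+ (j - p)) + mass (source X j.+1).
Proof.
rewrite big_nat_recr//= subnn expr0 mulr1; congr (_ + _); rewrite mulr_sumr.
rewrite big_nat [RHS]big_nat; apply: eq_bigr => p /andP[_ pj].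
by rewrite subSn// exprS mulrCA.
Qed.

(** Common to [gamma_j(1)] and [gamma^N_j(1)]: both multiply the mass by a mean of [G_j] and add a
    source. The horizon [n] stays fixed, since [gminus X n] and [gplus X n] bound the potentials at
    all times before [n]; the induction runs over [j <= n]. *)
Lemma affine_mass_bounds (a : nat -> R) n : a 0%N = mass (source X 0) ->
  (forall j, (j < n)%N ->
     gminus X n * a j + mass (source X j.+1) <= a j.+1 <=
     gplus X n * a j + mass (source X j.+1)) ->
  mminus X n <= a n <= mplus X n.
Proof.
move=> a0 aS.
have gp0 : (0 < n)%N -> 0 <= gplus X n.
  by move=> n0; rewrite (le_trans (pot_ge0 X (point : E 0%N)))// (pot_le_gplus _ n0).
suff H j : (j <= n)%N ->
    \sum_(0 <= p < j.+1) mass (source X p) * gminus X n ^+ (j - p) <= a j <=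
    \sum_(0 <= p < j.+1) mass (source X p) * gplus X n ^+ (j - p).
  exact: H.
elim: j => [|j IH] jn.
  by rewrite !big_nat1 subnn !expr0 !mulr1 a0 lexx.
have /andP[l1 u1] := IH (ltnW jn); have /andP[l2 u2] := aS j jn.
rewrite !polyS; apply/andP; split.
  by rewrite (le_trans _ l2)// lerD2r ler_wpM2l// gminus_ge0.
by rewrite (le_trans u2)// lerD2r ler_wpM2l// gp0// (leq_ltn_trans _ jn).
Qed.

Lemma mass_gamma_bounds n : mminus X n <= mass (gamma X n) <= mplus X n.
Proof.
apply: (@affine_mass_bounds (fun j => mass (gamma X j))) => // j jn.
have fg := gamma_finite X j.
rewrite mass_gammaS !lerD2r -!rint_cst; apply/andP; split; apply: rint_le => //;
  try exact: bmeas_cst; try exact: bmeas_pot.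
- by move=> x; exact: gminus_le_pot.
- by move=> x; exact: pot_le_gplus.
Qed.

Section empirical.
Variables (N : nat) (N0 : (0 < N)%N).

Lemma massN_rec (x : forall n, N.-tuple (E n)) n :
  massN X x n.+1 = massN X x n * (\int[emp R (x n)]_y pot X n y) + mass (source X n.+1).
Proof. by []. Qed.

Lemma massN_gt0 (x : forall n, N.-tuple (E n)) n : 0 < massN X x n.
Proof.
elim: n => [|n IH]; first exact: mass_source0_gt0.
rewrite massN_rec ltr_pwDl ?mass_ge0// mulr_gt0//.
have [lo [hi [lo0 H]]] := pot_bounds X n.
apply: (@lt_le_trans _ _ lo) => //.
have fe := prob_finite (emp R (x n)).
rewrite -[leLHS]mulr1 -(mass_prob (emp R (x n))) -rint_cst; apply: rint_le => //.
- exact: bmeas_cst.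
- exact: bmeas_pot.
- by move=> y; case/andP: (H y).
Qed.

Lemma massN_bounds (x : forall n, N.-tuple (E n)) n :
  mminus X n <= massN X x n <= mplus X n.
Proof.
apply: (@affine_mass_bounds (massN X x)) => // j jn.
have fe := prob_finite (emp R (x j)).
rewrite massN_rec !lerD2r ![_ * massN _ _ _]mulrC.
have m1 := mass_prob (emp R (x j)).
rewrite !ler_pM2l ?massN_gt0//.
rewrite -[gminus _ _]mulr1 -[gplus _ _]mulr1 -m1 -!rint_cst.
apply/andP; split; apply: rint_le => //; try exact: bmeas_cst; try exact: bmeas_pot.
- by move=> y; exact: gminus_le_pot.
- by move=> y; exact: pot_le_gplus.
Qed.

(** Only particles strictly before time [n] enter, so the mass is known one step before the
    particles it multiplies. *)
Lemma bmeas_massN d' (Om : measurableType d') (z : forall n, Om -> N.-tuple (E n)) n :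
  (forall p, (p < n)%N -> measurable_fun setT (z p)) ->
  bmeas (fun w => massN X (z ^~ w) n).
Proof.
elim: n => [|n IH] mz /=; first exact: bmeas_cst.
apply: bmeasD; last exact: bmeas_cst.
apply: bmeasM; first by apply: IH => p pn; apply: mz; exact: ltnW.
rewrite (_ : (fun _ => _) =
    fun w => N%:R^-1 * \sum_(i < N) pot X n (tnth (z n w) i)).
  apply: bmeasZ; apply: bmeas_sum => i; apply: bmeas_comp; last exact: bmeas_pot.
  by apply: measurableT_comp (measurable_tnth i) _; exact: mz.
by apply/funext => w; rewrite rint_emp//; exact: bmeas_pot.
Qed.

End empirical.
End mass_bounds.

(** * The constants [b_n] and the deterministic estimates behind them *)

Section sharp_constants.
Context (R : realType) (d : nat -> measure_display)
  (E : forall n, measurableType (d n)) (X : model R E).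

Definition cbeta p n := \sum_(p.+1 <= q < n.+1) cpn X q n * betaP X q n.

(** A deterministic lower bound for [gamma^N_p Q_{p,n}(1)] and for its conditional mean: the least
    possible mass times the least possible value of [Q_{p,n}(1)]. *)
Definition low_mass p n := mminus X p * (Qnorm X p n / qpn X p n).

(** The weight [c / (A + c)] of the sources, lost in [b_{p,n}], is kept: for
    [G = 1] the sum of the [b_{p,n}] diverges logarithmically in [n]. *)
Definition bsharp n := \sum_(0 <= p < n.+1)
  min1m X p n * qpn X p n *
    (betaP X p n + cbeta p n / (low_mass p n + csum X p n)).

Lemma cpn_ge0 p n : 0 <= cpn X p n.
Proof. by apply: Rintegral_ge0 => x _; rewrite Qone_phi ltW// phi_ones_gt0. Qed.

Lemma csum_ge0 p n : 0 <= csum X p n.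
Proof. by apply: sumr_ge0 => q _; exact: cpn_ge0. Qed.

Lemma cbeta_ge0 p n : 0 <= cbeta p n.
Proof.
rewrite /cbeta big_nat; apply: sumr_ge0 => q /andP[_ qn].
by rewrite mulr_ge0 ?cpn_ge0 ?betaP_ge0.
Qed.

Lemma cbeta_le p n : cbeta p n <= csum X p n.
Proof.
rewrite /cbeta /csum big_nat [leRHS]big_nat; apply: ler_sum => q /andP[_ qn].
by rewrite -[leRHS]mulr1 ler_wpM2l ?cpn_ge0// betaP_le1.
Qed.

Lemma mminus_ge0 n : 0 <= mminus X n.
Proof.
by apply: sumr_ge0 => p _; rewrite mulr_ge0 ?mass_ge0// exprn_ge0// gminus_ge0.
Qed.

Lemma mplus_gt0 n : 0 < mplus X n.
Proof.
by apply: lt_le_trans (mass_gamma_gt0 X n) _; case/andP: (mass_gamma_bounds X n).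
Qed.

Lemma low_mass_ge0 p n : 0 <= low_mass p n.
Proof.
by rewrite mulr_ge0 ?mminus_ge0// divr_ge0// ltW// ?Qnorm_gt0 ?qpn_gt0.
Qed.

Lemma mpn_ge0 p n : 0 <= mpn X p n.
Proof.
by rewrite /mpn divr_ge0 ?csum_ge0// mulr_ge0// ltW// ?mplus_gt0 ?Qnorm_gt0.
Qed.

Lemma min1m_ge0 p n : 0 <= min1m X p n.
Proof.
by rewrite /min1m; case: ifP => // _; rewrite le_min ler01 mpn_ge0.
Qed.

Lemma min1m_le1 p n : min1m X p n <= 1.
Proof. by rewrite /min1m; case: ifP => // _; rewrite ge_min lexx. Qed.

Lemma bsharp_term_ge0 p n : (p <= n)%N ->
  0 <= min1m X p n * qpn X p n *
    (betaP X p n + cbeta p n / (low_mass p n + csum X p n)).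
Proof.
move=> pn; apply: mulr_ge0; first by rewrite mulr_ge0 ?min1m_ge0// ltW// qpn_gt0.
by rewrite addr_ge0 ?betaP_ge0// divr_ge0 ?cbeta_ge0// addr_ge0 ?low_mass_ge0 ?csum_ge0.
Qed.

Lemma bsharp_ge0 n : 0 <= bsharp n.
Proof.
by rewrite /bsharp big_nat; apply: sumr_ge0 => p /andP[_ pn]; exact: bsharp_term_ge0.
Qed.

Lemma cbeta_ratio_le p n (a : R) : 0 <= a ->
  cbeta p n / (a + csum X p n) <= cbeta p n / csum X p n.
Proof.
move=> a0; have [c0|c0] := eqVneq (csum X p n) 0.
  have -> : cbeta p n = 0 by apply: le_anti; rewrite cbeta_ge0 -c0 cbeta_le.
  by rewrite !mul0r.
have cp : 0 < csum X p n by rewrite lt0r c0 csum_ge0.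
rewrite ler_wpM2l ?cbeta_ge0// lef_pV2 ?posrE ?lerDr//.
by rewrite ltr_wpDl.
Qed.

(** Three losses lead to [bpn]: the weight [low_mass] is dropped from the denominator, [betaP X p n]
    is multiplied by [qpn >= 1], and a factor 2 is inserted. *)
Lemma bsharp_le n : bsharp n <= \sum_(0 <= p < n.+1) bpn X p n.
Proof.
rewrite /bsharp big_nat [leRHS]big_nat; apply: ler_sum => p /andP[_ pn].
rewrite ltnS in pn; rewrite /bpn -!mulrA.
have b0 := betaP_ge0 X pn; have q1 := qpn_ge1 X n p; have m0 := min1m_ge0 p n.
have -> : \sum_(p.+1 <= q < n.+1) cpn X q n / csum X p n * betaP X q n =
    cbeta p n / csum X p n.
  by rewrite /cbeta mulr_suml; apply: eq_bigr => q _; rewrite mulrAC.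
have h := cbeta_ratio_le p n (low_mass_ge0 p n).
have h0 : 0 <= cbeta p n / csum X p n by rewrite divr_ge0 ?cbeta_ge0 ?csum_ge0.
set S := _ / (_ + _) in h *; set S' := _ / csum _ _ _ in h h0 *.
have : betaP X p n + S <= qpn X p n * betaP X p n + S'.
  by rewrite lerD// ler_peMl.
set u := _ + S; set v := _ + S' => uv.
have v0 : 0 <= v by rewrite addr_ge0// mulr_ge0// (le_trans ler01).
have q0 : 0 <= qpn X p n by exact: le_trans q1.
apply: (@le_trans _ _ (min1m X p n * (qpn X p n * v))).
  by rewrite !ler_wpM2l.
by rewrite ler_peMl ?ler1n// !mulr_ge0.
Qed.

Section term_bound.
Variables (p n : nat).
Hypothesis pn : (p <= n)%N.

(** [V] has two lower bounds: the transported mass, which yields the factor [qpn], and the mass of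
    the later sources, which yields [mpn]. Their combination is the minimum of 1 and [m_{p,n}]. *)
Lemma normalized_weight_le m V : 0 < m <= mplus X p ->
  m * (Qnorm X p n / qpn X p n) + csum X p n <= V ->
  m * Qnorm X p n / V <= min1m X p n * qpn X p n.
Proof.
move=> /andP[m0 mM] HV.
have q0 := qpn_gt0 X n p; have q1 := qpn_ge1 X n p; have Q0 := Qnorm_gt0 X n p.
have mQ0 : 0 < m * (Qnorm X p n / qpn X p n) by rewrite mulr_gt0// divr_gt0.
have c0 := csum_ge0 p n; have V0 : 0 < V by lra.
have h1 : m * Qnorm X p n / V <= qpn X p n.
  rewrite ler_pdivrMr// [_ * V]mulrC -ler_pdivrMr// -mulrA; lra.
rewrite /min1m; case: eqP => [_|/eqP cn0]; first by rewrite mul1r.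
have cp : 0 < csum X p n by rewrite lt0r cn0.
rewrite minr_pMl ?(ltW q0)// le_min mul1r h1/=.
apply: (@le_trans _ _ (mpn X p n)); last by rewrite ler_peMr ?mpn_ge0.
rewrite /mpn; apply: ler_pM.
- by rewrite mulr_ge0// ltW.
- by rewrite invr_ge0 ltW.
- by rewrite ler_wpM2r// ltW.
- by rewrite lef_pV2 ?posrE//; lra.
Qed.

Variable F : forall m, E m -> R.
Arguments F : clear implicits.
Hypothesis oF : forall m, Osc1 (F m).
Variable l0 : R.
Hypothesis Hl0 : forall q, (p <= q <= n)%N -> forall y : E q,
  `|Pnorm X F n y - l0| <= betaP X q n.

Let bF m : bmeas (F m). Proof. exact: Osc1_bmeas. Qed.

Lemma phi_center q (y : E q) : (p <= q <= n)%N ->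
  `|phi X F n q y - l0 * phi X ones n q y| <= betaP X q n * phi X ones n q y.
Proof.
move=> pqn; have p1 := phi_ones_gt0 X n y.
have -> : phi X F n q y - l0 * phi X ones n q y =
    (Pnorm X F n y - l0) * phi X ones n q y.
  by rewrite mulrBl /Pnorm divfK// gt_eqF.
by rewrite normrM (gtr0_norm p1) ler_wpM2r ?(ltW p1)// Hl0.
Qed.

Lemma ssum_center : `|ssum X F n p - l0 * ssum X ones n p| <= cbeta p n.
Proof.
rewrite /ssum /cbeta mulr_sumr -sumrB (le_trans (ler_norm_sum _ _ _))//.
rewrite big_nat [leRHS]big_nat; apply: ler_sum => q /andP[pq qn].
have pqn : (p <= q <= n)%N by rewrite (ltnW pq) -ltnS.
have fs := source_finite X q.
have b1 := bmeas_phi X n q bF; have b2 := bmeas_phi X n q (@bmeas_ones R _ E).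
have b3 := bmeasZ l0 b2.
rewrite -rintZ// -rintB//.
apply: (le_trans (le_normr_Rintegral _ _)) => //.
  by apply: bmeas_integrable => //; exact: bmeasB.
have -> : cpn X q n = \int[source X q]_x phi X ones n q x.
  by apply: eq_Rintegral => x _; rewrite Qone_phi.
rewrite mulrC -rintZ//; apply: rint_le => //.
- by apply: bmeas_norm; exact: bmeasB.
- exact: bmeasZ.
- by move=> y; exact: phi_center.
Qed.

End term_bound.

(** A single value taken at time [p] centers [P_{q,n}(F)] for all [q >= p] at once, being an average
    of its values. *)
Lemma Pnorm_near_point p n F q (y : E q) : (forall m, Osc1 (F m)) ->
  (p <= q <= n)%N ->
  `|Pnorm X F n y - Pnorm X F n (point : E p)| <= betaP X q n.
Proof.
move=> oF pqn; have bF m : bmeas (F m) by exact: Osc1_bmeas.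
have /andP[pq qn] := pqn; rewrite distrC.
by apply: (Pnorm_dist bF pqn) => u v; exact: betaP_ge.
Qed.

End sharp_constants.

(** * Convexity of the exponential and moments *)

Section convex_exponential.
Context (R : realType) d (Om : measurableType d) (P : probability Om R).

Lemma expR_tangent (x z : R) : expR z * (1 + x - z) <= expR x.
Proof.
have -> : expR x = expR z * expR (x - z) by rewrite -expRD addrC subrK.
by rewrite ler_wpM2l ?expR_ge0// -addrA expR_ge1Dx.
Qed.

(** Jensen's inequality with the missing weight [1 - W] placed at 0; each point is compared with the
    tangent at the barycenter [z]. *)
Lemma expR_convex n (w x : nat -> R) : (forall i, (i < n)%N -> 0 <= w i) ->
  \sum_(0 <= i < n) w i <= 1 ->
  expR (\sum_(0 <= i < n) w i * x i) <=
  \sum_(0 <= i < n) w i * expR (x i) + (1 - \sum_(0 <= i < n) w i).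
Proof.
move=> w0 w1; set z := \sum_(0 <= i < n) w i * x i; set W := \sum_(0 <= i < n) w i.
have h1 : expR z * (W + z - W * z) <= \sum_(0 <= i < n) w i * expR (x i).
  have -> : W + z - W * z = \sum_(0 <= i < n) (w i + w i * x i - w i * z).
    by rewrite sumrB big_split/= -mulr_suml.
  rewrite mulr_sumr big_nat [leRHS]big_nat; apply: ler_sum => i /andP[_ iN].
  have -> : expR z * (w i + w i * x i - w i * z) =
      w i * (expR z * (1 + x i - z)) by ring.
  by rewrite ler_wpM2l ?w0// expR_tangent.
have := expR_tangent 0 z; rewrite expR0 addr0 => h2.
have h3 : (1 - W) * (expR z * (1 - z)) <= (1 - W) * 1 by rewrite ler_wpM2l// subr_ge0.
have -> : expR z = expR z * (W + z - W * z) + (1 - W) * (expR z * (1 - z)) by ring.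
by rewrite lerD// (le_trans h3)// mulr1.
Qed.

(** The triangle inequality for exponential moments: [D / B] lies below a convex combination of the
    [V i] and 0, each of which has exponential moment at most [M]. *)
Lemma convex_exp_moment n (w : nat -> R) (V : nat -> Om -> R) (D : Om -> R) (B M : R) :
  (forall i, (i < n)%N -> 0 <= w i) -> (forall i, (i < n)%N -> bmeas (V i)) ->
  bmeas D -> 0 < B -> 1 <= M ->
  (forall i, (i < n)%N -> \int[P]_u expR (V i u) <= M) ->
  \sum_(0 <= i < n) w i <= B ->
  (forall u, D u <= \sum_(0 <= i < n) w i * V i u) ->
  \int[P]_u expR (D u / B) <= M.
Proof.
move=> w0 bV bD B0 M1 HV wB HD; have fP := prob_finite P.
(* Extension by 0 outside the range, because the lemmas on sums ask for all indices. *)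
pose V' i := if (i < n)%N then V i else fun=> 0.
have bV' i : bmeas (V' i).
  by rewrite /V'; case: ifP => [/bV//|_]; exact: bmeas_cst.
have wB1 : \sum_(0 <= i < n) w i / B <= 1 by rewrite -mulr_suml ler_pdivrMr ?mul1r.
have beV i : bmeas (fun u => w i / B * expR (V' i u)).
  by apply: bmeasZ; exact: bmeas_exp.
have bc : bmeas (fun _ : Om => 1 - \sum_(0 <= i < n) w i / B) by exact: bmeas_cst.
apply: (@le_trans _ _ (\int[P]_u (\sum_(0 <= i < n) w i / B * expR (V' i u) +
    (1 - \sum_(0 <= i < n) w i / B)))).
  apply: rint_le => //.
  - apply: bmeas_exp; rewrite (_ : (fun _ => _) = fun u => B^-1 * D u).
      exact: bmeasZ.
    by apply/funext => u; rewrite mulrC.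
  - by apply: bmeasD => //; exact: bmeas_sum.
  - move=> u; apply: le_trans (expR_convex (fun i => V' i u) _ wB1).
      rewrite ler_expR ler_pdivrMr// mulr_suml (le_trans (HD u))//.
      rewrite big_nat [leRHS]big_nat; apply: ler_sum => i /andP[_ iN].
      by rewrite /V' iN [leRHS]mulrAC divfK// gt_eqF.
    by move=> i iN; rewrite divr_ge0 ?w0// ltW.
rewrite rintD//; last exact: bmeas_sum.
rewrite rint_sum// rint_cst mass_prob mulr1.
apply: (@le_trans _ _ (\sum_(0 <= i < n) w i / B * M + (1 - \sum_(0 <= i < n) w i / B) * M)).
  apply: lerD; last by rewrite ler_peMr// subr_ge0.
  rewrite big_nat [leRHS]big_nat; apply: ler_sum => i /andP[_ iN].
  rewrite rintZ//; last exact: bmeas_exp.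
  by rewrite ler_wpM2l ?divr_ge0 ?w0 ?(ltW B0)// /V' iN HV.
by rewrite -mulr_suml -mulrDl addrC subrK mul1r.
Qed.

(** [x^r = r^r (x / r)^r], and [ln (x / r) <= x / r]. *)
Lemma powR_le_expR (x r : R) : 0 <= x -> 1 <= r -> x `^ r <= r `^ r * expR x.
Proof.
move=> x0 r1; have r0 : 0 < r by lra.
have [->|xn0] := eqVneq x 0.
  by rewrite powR0 ?gt_eqF// mulr_ge0 ?powR_ge0 ?expR_ge0.
have xp : 0 < x by rewrite lt0r xn0.
have -> : x `^ r = r `^ r * (x / r) `^ r.
  by rewrite -powRM ?divr_ge0 ?(ltW r0)// mulrC divfK// gt_eqF.
rewrite ler_wpM2l ?powR_ge0// /powR gt_eqF ?divr_gt0// ler_expR.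
have : ln (x / r) <= x / r.
  rewrite -ler_expR lnK ?posrE ?divr_gt0//.
  by have := expR_ge1Dx (x / r); lra.
by move=> h; rewrite -ler_pdivlMl// [r^-1 * _]mulrC.
Qed.

End convex_exponential.

(** * The particle system and its martingales *)

Section particles.
Context (R : realType) (d : nat -> measure_display)
  (E : forall n, measurableType (d n)) (X : model R E) (K : kernel_family R E).
Hypothesis mcK : McKean X K.
Context (N : nat) (d' : measure_display) (Om : measurableType d')
  (P : probability Om R) (xi : forall n, Om -> N.-tuple (E n)).
Hypothesis N0 : (0 < N)%N.
Hypothesis ps : particle_system X K P xi.

Notation mN n w := (massN X (xi ^~ w) n).

Definition etaN n (f : E n -> R) (w : Om) : R := \int[emp R (xi n w)]_x f x.

Definition past_gen n : set (set Om) :=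
  [set B | exists p, (p <= n)%N /\ exists U, measurable U /\ B = xi p @^-1` U].

Notation Past n := (g_sigma_algebraType (past_gen n)).

(** Functions known before the particles of time [p] are drawn. At [p = 0] nothing is known yet, so
    only constants qualify; this lets time 0 share the later statements. *)
Definition past_fun p (W : Om -> R) : Prop :=
  match p with
  | 0 => exists c, W = fun=> c
  | n.+1 => bmeas (W : Past n -> R)
  end.

Lemma past_gen_meas n (B : set Om) : <<s past_gen n>> B -> measurable B.
Proof.
apply: smallest_sub; first exact: sigma_algebra_measurable.
move=> _ [p [_ [U [mU ->]]]]; rewrite -[_ @^-1` _]setTI.
exact: (particle_measurable ps) measurableT _ mU.
Qed.

Lemma measurable_to_past n : measurable_fun setT (id : Om -> Past n).
Proof. by move=> _ B mB; rewrite setTI; exact: past_gen_meas mB. Qed.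

Lemma measurable_xi_past n p : (p <= n)%N ->
  measurable_fun setT (xi p : Past n -> N.-tuple (E p)).
Proof.
move=> pn _ B mB; rewrite setTI; apply: sub_sigma_algebra.
by exists p; split => //; exists B.
Qed.

Lemma bmeas_xi d0 (Om0 : measurableType d0) n (z : Om0 -> N.-tuple (E n))
    (f : E n -> R) i :
  measurable_fun setT z -> bmeas f -> bmeas (fun w => f (tnth (z w) i) : R).
Proof.
move=> mz bf; have mt := measurableT_comp (measurable_tnth i) mz.
exact: (bmeas_comp mt bf).
Qed.

Lemma etaNE n f w : bmeas f ->
  etaN f w = N%:R^-1 * \sum_(i < N) f (tnth (xi n w) i).
Proof. exact: rint_emp. Qed.

Lemma past_const p c : past_fun p (fun=> c).
Proof. by case: p => [|p]; [exists c|exact: bmeas_cst]. Qed.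

Lemma past_bmeas p W : past_fun p W -> bmeas W.
Proof.
case: p => [[c ->]|n bW]; first exact: bmeas_cst.
exact: (bmeas_comp (@measurable_to_past n) bW).
Qed.

Lemma past_mul p W V : past_fun p W -> past_fun p V -> past_fun p (fun w => W w * V w).
Proof.
case: p => [[c ->] [c' ->]|n]; first by exists (c * c').
exact: bmeasM.
Qed.

Lemma past_massN p : past_fun p (fun w => mN p w).
Proof.
case: p => [|n]; first by exists (mass (gamma X 0)).
by apply: (@bmeas_massN _ _ _ X N N0 _ (Past n)) => p pn; exact: measurable_xi_past.
Qed.

Lemma past_massN_pre n : past_fun n.+1 (fun w => mN n w).
Proof.
apply: (@bmeas_massN _ _ _ X N N0 _ (Past n)) => p pn.
by apply: measurable_xi_past; exact: ltnW.
Qed.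

Lemma past_etaN n (f : E n -> R) : bmeas f -> past_fun n.+1 (etaN f).
Proof.
move=> bf; rewrite (_ : etaN f = fun w => N%:R^-1 * \sum_(i < N) f (tnth (xi n w) i)).
  apply: (@bmeasZ _ _ (Past n)); apply: bmeas_sum => i.
  by apply: bmeas_xi => //; exact: measurable_xi_past.
by apply/funext => w; rewrite etaNE.
Qed.

(** The subtracted term is the conditional mean of [etaN f] given the past. *)
Definition Delta p : (E p -> R) -> Om -> R :=
  match p with
  | 0 => fun f w => etaN f w - \int[Defs.eta X 0]_x f x
  | n.+1 => fun f w => etaN f w -
      N%:R^-1 * \sum_(i < N) kfun (@K n (mN n w) (emp R (xi n w))) f (tnth (xi n w) i)
  end.

Let kstep n i (w : Past n) : {measure set (E n.+1) -> \bar R} :=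
  @K n (mN n w) (emp R (xi n w)) (tnth (xi n w) i).

Let kstep_meas n i U : measurable U -> measurable_fun setT (@kstep n i ^~ U).
Proof.
move=> mU; pose g (w : Past n) := ((mN n w, xi n w), tnth (xi n w) i).
have mxi := @measurable_xi_past n n (leqnn n).
have mg : measurable_fun setT g.
  apply: measurable_fun_pair.
    by apply: measurable_fun_pair => //; case: (past_massN_pre n).
  exact: measurableT_comp (measurable_tnth i) mxi.
have := McKean_measurable mcK N0 mU (n := n) (N := N).
pose D : set (R * N.-tuple (E n) * E n) := [set z | 0 < z.1.1].
(* McKean kernels are measurable on the region of positive mass only; [massN_gt0] shows that [g]
   takes its values there. *)
move=> mf; apply: (@measurable_comp _ _ _ _ _ _ D _ _ g _ _ mf mg).
- rewrite (_ : D = (fun z => z.1.1) @^-1` `]0, +oo[%classic).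
    rewrite -[_ @^-1` _]setTI.
    by apply: (measurableT_comp measurable_fst measurable_fst) => //.
  by apply/seteqP; split => z /=; rewrite /D/= in_itv/= andbT.
- by move=> _ [w _ <-]; rewrite /D /g/=; exact: massN_gt0.
Qed.

Let kstep_cond n :
  conditional_product P (id : Om -> Past n) (xi n.+1) (fun i => kernel_of (@kstep_meas n i)).
Proof. by move=> F A mF mA; exact: (particle_step ps). Qed.

Let kinit (w : unit) : {measure set (E 0%N) -> \bar R} := Defs.eta X 0.

Let kinit_meas U : measurable U -> measurable_fun setT (kinit ^~ U).
Proof. by move=> mU; exact: measurable_cst. Qed.

Let kinit_cond : conditional_product P (fun _ : Om => tt) (xi 0%N)
  (fun i : 'I_N => kernel_of kinit_meas).
Proof.
move=> F A mF mA; have [Ft|Ft] := pselect (F tt).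
  rewrite (_ : _ @^-1` F = setT); last by apply/seteqP; split.
  rewrite setTI (particle_init ps)// integral_cst//.
  by rewrite [X in (_ * X)%E](@probability_setT _ _ _ P) mule1.
rewrite (_ : _ @^-1` F = set0); last by apply/seteqP; split.
by rewrite set0I measure0 integral_set0.
Qed.

Let mxi n : measurable_fun setT (xi n). Proof. exact: particle_measurable ps n. Qed.

Let kstep1 n i w : kernel_of (@kstep_meas n i) w setT = 1%E.
Proof. exact: prob_kernel. Qed.

Let kinit1 (i : 'I_N) w : kernel_of kinit_meas w setT = 1%E.
Proof. by rewrite /kernel_of /kinit; exact: probability_setT. Qed.

Let Delta0E (f : E 0%N -> R) : bmeas f ->
  Delta f = cdev (fun _ : Om => tt) (xi 0%N) (fun i : 'I_N => kernel_of kinit_meas) f.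
Proof.
move=> bf; apply/funext => w; rewrite /Delta /cdev etaNE//.
rewrite sumrB mulrBr; congr (_ - _).
rewrite sumr_const card_ord -[kfun _ _ _]/(\int[Defs.eta X 0]_x f x).
rewrite -(mulr_natl (\int[Defs.eta X 0]_x f x) N) mulKf//.
by rewrite gt_eqF// ltr0n.
Qed.

Let DeltaSE n (f : E n.+1 -> R) : bmeas f ->
  Delta f = cdev (id : Om -> Past n) (xi n.+1) (fun i => kernel_of (@kstep_meas n i)) f.
Proof.
move=> bf; apply/funext => w; rewrite /Delta /cdev etaNE//.
by rewrite sumrB mulrBr.
Qed.

Lemma bmeas_Delta p f : bmeas f -> bmeas (@Delta p f).
Proof.
case: p f => [|n] f bf; rewrite ?Delta0E ?DeltaSE//.
- exact: bmeas_cdev.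
- exact: (bmeas_cdev (@measurable_to_past n) (@mxi n.+1) (@kstep1 n) bf).
Qed.

Lemma Delta_mean0 p W f : past_fun p W -> bmeas f ->
  \int[P]_w (W w * @Delta p f w) = 0.
Proof.
case: p f => [|n] f pW bf; rewrite ?Delta0E ?DeltaSE//.
  case: pW => c ->; have bc := @bmeas_cst _ _ unit c.
  exact: (cdev_mean0 (measurable_cst tt) (@mxi 0) kinit1 kinit_cond bc bf).
have pW' : bmeas (W : Past n -> R) := pW.
exact: (cdev_mean0 (@measurable_to_past n) (@mxi n.+1) (@kstep1 n) (@kstep_cond n) pW' bf).
Qed.

Lemma Delta_exp p W f C : past_fun p W -> (forall w, 0 <= W w) -> bmeas f ->
  0 < C -> (forall y, `|f y| <= C) ->
  \int[P]_w (W w * expR (Num.sqrt N%:R / (4 * C) * `|@Delta p f w|)) <=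
  2 * expR 1 * \int[P]_w W w.
Proof.
case: p f => [|n] f pW W0 bf C0 fC; rewrite ?Delta0E ?DeltaSE//.
  case: pW W0 => c -> c0; have bc := @bmeas_cst _ _ unit c.
  have c0' (u : unit) : 0 <= c by exact: c0 point.
  exact: (cdev_exp (measurable_cst tt) (@mxi 0) kinit1 kinit_cond N0 bc c0' bf C0 fC).
have pW' : bmeas (W : Past n -> R) := pW.
exact: (cdev_exp (@measurable_to_past n) (@mxi n.+1) (@kstep1 n) (@kstep_cond n)
  N0 pW' W0 bf C0 fC).
Qed.

Lemma massN_Delta0 (f : E 0%N -> R) w : bmeas f ->
  mN 0%N w * Delta f w = mN 0%N w * etaN f w - \int[gamma X 0]_x f x.
Proof.
move=> bf; rewrite /Delta mulrBr rint_eta//; congr (_ - _).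
by rewrite mulrC divfK// gt_eqF// mass_gamma_gt0.
Qed.

(** The denominator in the McKean condition is exactly [gamma^N_{n+1}(1)], so multiplication by this
    mass leaves the conditional mean in the linear form [gamma^N_n Q_{n+1} + mu_{n+1}], whatever the
    choice of kernels. *)
Lemma massN_DeltaS n (f : E n.+1 -> R) w : bmeas f ->
  mN n.+1 w * Delta f w = mN n.+1 w * etaN f w -
    (mN n w * etaN (Qop X f) w + \int[source X n.+1]_x f x).
Proof.
move=> bf; rewrite mulrBr; congr (_ - _).
have m0 := massN_gt0 X (xi ^~ w) n.
rewrite -(rint_emp (xi n w) (f := kfun (@K n (mN n w) (emp R (xi n w))) f))//; last first.
  by apply: kfun_bmeas1 => // x; exact: prob_kernel.
rewrite (McKean_compatible mcK)//; last 2 first.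
- by case: bf.
- exact: bmeas_bounded.
rewrite -massN_rec mulrC divfK//.
by rewrite gt_eqF// massN_gt0.
Qed.

(** [U F n p] is [gamma^N_p Q_{p,n}(F n)] completed by the sources after time [p];
    its increments are the local sampling errors, whence a martingale from
    [gamma_n (F n)] to [gamma^N_n (F n)]. *)
Definition U (F : forall m, E m -> R) n p w :=
  mN p w * etaN (phi X F n p) w + ssum X F n p.

(** The conditional mean of [U F n p] given the past, that is, the preceding value of the
    martingale. *)
Definition Upre (F : forall m, E m -> R) n p w :=
  match p with
  | 0 => \int[gamma X n]_x F n x
  | p'.+1 => U F n p' w
  end.

Implicit Type F : forall m, E m -> R.

Lemma U_incr F n p w : (forall m, bmeas (F m)) -> (p <= n)%N ->
  U F n p w = Upre F n p w + mN p w * Delta (phi X F n p) w.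
Proof.
move=> bF; case: p => [|p] pn.
  rewrite massN_Delta0; last exact: bmeas_phi.
  by rewrite /Upre (gamma_phi X bF pn) /U; ring.
rewrite massN_DeltaS; last exact: bmeas_phi.
by rewrite /Upre /U (ssum_rec X F pn) (phi_rec X F pn); ring.
Qed.

Lemma Unn F n w : U F n n w = mN n w * etaN (F n) w.
Proof. by rewrite /U ssumnn addr0 phinn. Qed.

Lemma past_Upre F n p : (forall m, bmeas (F m)) -> past_fun p (Upre F n p).
Proof.
move=> bF; case: p => [|p]; first by exists (\int[gamma X n]_x F n x).
apply: (@bmeasD _ _ (Past p)); last exact: bmeas_cst.
apply: (@bmeasM _ _ (Past p)); first exact: (past_massN_pre p).
exact/past_etaN/bmeas_phi.
Qed.

Lemma bmeas_U F n p : (forall m, bmeas (F m)) -> bmeas (U F n p).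
Proof. by move=> bF; exact: (past_bmeas (@past_Upre F n p.+1 bF)). Qed.

Lemma rint_U F n p : (forall m, bmeas (F m)) -> (p <= n)%N ->
  \int[P]_w U F n p w = \int[gamma X n]_x F n x.
Proof.
move=> bF; have fP := prob_finite P.
have step q : (q <= n)%N -> \int[P]_w U F n q w = \int[P]_w Upre F n q w.
  move=> qn; rewrite (@eq_Rintegral _ _ _ P setT
    (fun w => Upre F n q w + mN q w * Delta (phi X F n q) w)).
    have bp := bmeas_phi X n q bF.
    rewrite rintD//; last 2 first.
    - exact: past_bmeas (past_Upre n q bF).
    - by apply: bmeasM; [exact: past_bmeas (past_massN q)|exact: bmeas_Delta].
    by rewrite Delta_mean0 ?addr0//; exact: past_massN.
  by move=> w _; rewrite U_incr.
elim: p => [|p IH] pn; rewrite step//.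
  by rewrite rint_cst mass_prob mulr1.
exact/IH/ltnW.
Qed.

Lemma etaN_ones n w : etaN (ones (R := R) n) w = 1 :> R.
Proof. by rewrite /etaN rint_cst mass_prob mulr1. Qed.

Lemma bmeas_etaN n (f : E n -> R) : bmeas f -> bmeas (etaN f).
Proof. by move=> bf; exact: (past_bmeas (past_etaN bf)). Qed.

Lemma etaN_le n (f g : E n -> R) w : bmeas f -> bmeas g -> (forall y, f y <= g y) ->
  etaN f w <= etaN g w.
Proof. by move=> bf bg fg; apply: rint_le => //; exact: prob_finite. Qed.

Lemma etaN_comb n (f g : E n -> R) c w : bmeas f -> bmeas g ->
  etaN (fun y => f y - c * g y) w = etaN f w - c * etaN g w.
Proof.
move=> bf bg; have fe := prob_finite (emp R (xi n w)).
by rewrite /etaN rintB ?rintZ//; exact: bmeasZ.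
Qed.

Lemma Delta_comb p (f g : E p -> R) c w : bmeas f -> bmeas g ->
  Delta (fun y => f y - c * g y) w = Delta f w - c * Delta g w.
Proof.
case: p f g => [|n] f g bf bg; rewrite /Delta etaN_comb//.
  have fe := prob_finite (Defs.eta X 0).
  by rewrite rintB ?rintZ//; [ring|exact: bmeasZ].
have -> : \sum_(i < N) kfun (@K n (mN n w) (emp R (xi n w)))
      (fun y => f y - c * g y) (tnth (xi n w) i) =
    \sum_(i < N) kfun (@K n (mN n w) (emp R (xi n w))) f (tnth (xi n w) i) -
    c * \sum_(i < N) kfun (@K n (mN n w) (emp R (xi n w))) g (tnth (xi n w) i).
  rewrite mulr_sumr -sumrB; apply: eq_bigr => i _; rewrite /kfun.
  have fk : (@K n (mN n w) (emp R (xi n w)) (tnth (xi n w) i) setT < +oo)%E.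
    by rewrite prob_kernel ltry.
  by rewrite rintB ?rintZ//; exact: bmeasZ.
by ring.
Qed.

(** The mean of [gamma^N_p] given the past. *)
Definition Lpre p (w : Om) : (E p -> R) -> R :=
  match p with
  | 0 => fun g => \int[gamma X 0]_x g x
  | q.+1 => fun g => mN q w * etaN (Qop X g) w + \int[source X q.+1]_x g x
  end.

Lemma Upre_Lpre F n p w : (forall m, bmeas (F m)) -> (p <= n)%N ->
  Upre F n p w = Lpre w (phi X F n p) + ssum X F n p.
Proof.
move=> bF; case: p => [|p] pn; first by rewrite /Upre (gamma_phi X bF pn).
by rewrite /Upre /U (ssum_rec X F pn) (phi_rec X F pn) addrA.
Qed.

Lemma Lpre_le p w (f g : E p -> R) : bmeas f -> bmeas g -> (forall y, f y <= g y) ->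
  Lpre w f <= Lpre w g.
Proof.
case: p f g => [|p] f g bf bg fg /=.
  by apply: rint_le => //; exact: (gamma_finite X 0).
apply: lerD; last by apply: rint_le => //; exact: source_finite.
rewrite ler_wpM2l//; first by rewrite ltW// massN_gt0.
by apply: etaN_le => [| |y]; [exact: bmeas_Qop|exact: bmeas_Qop|exact: Qop_le].
Qed.

Lemma LpreZ p w (g : E p -> R) c : bmeas g -> Lpre w (fun y => c * g y) = c * Lpre w g.
Proof.
case: p g => [|p] g bg /=; first by rewrite rintZ//; exact: (gamma_finite X 0).
rewrite rintZ//; last exact: source_finite.
have fe := prob_finite (emp R (xi p w)).
rewrite (_ : Qop X (fun y => c * g y) = fun y => c * Qop X g y).
  by rewrite /etaN rintZ//; [ring|exact: bmeas_Qop].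
by apply/funext => y; rewrite QopZ.
Qed.

Lemma Lpre_ones p w : Lpre w (ones (R := R) p) = mN p w.
Proof.
case: p => [|p] /=; first by rewrite -massE.
rewrite -massE; congr (_ * _ + _); apply: eq_Rintegral => y _.
rewrite QopE; last exact: bmeas_ones.
rewrite /kfun /ones rint_cst mass_pker ?mulr1// => z; exact: mutation1.
Qed.

(** * Increments of the ratios [U / V] *)

Section increment_bound.
Variables (n p : nat) (F : forall m, E m -> R).
Arguments F : clear implicits.
Hypothesis pn : (p <= n)%N.
Hypothesis oF : forall m, Osc1 (F m).

Let bF m : bmeas (F m). Proof. exact: Osc1_bmeas. Qed.
Let b1 m : bmeas (ones (R := R) (E := E) m). Proof. exact: bmeas_ones. Qed.

Let l0 := Pnorm X F n (point : E p).

(** This is [Q_{p,n}(F n - l0)], where [l0] is [P_{p,n}(F n)] at an arbitrary fixed point. It is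
    deterministic, as the exponential bound on sampling errors requires. *)
Definition centered (y : E p) : R := phi X F n p y - l0 * phi X ones n p y.

Lemma bmeas_centered : bmeas centered.
Proof. by apply: bmeasB; [|apply: bmeasZ]; exact: bmeas_phi. Qed.

Let Hl0 q : (p <= q <= n)%N -> forall y : E q,
  `|Pnorm X F n y - l0| <= betaP X q n.
Proof. by move=> pqn y; exact: Pnorm_near_point. Qed.

Lemma centered_le y : `|centered y| <= betaP X p n * Qnorm X p n.
Proof.
have ppn : (p <= p <= n)%N by rewrite leqnn.
apply: (le_trans (phi_center Hl0 y ppn)).
by rewrite ler_wpM2l ?betaP_ge0// Qnorm_ge.
Qed.

Let massN_range w : 0 < mN p w <= mplus X p.
Proof. by rewrite massN_gt0/=; case/andP: (massN_bounds X (xi ^~ w) p). Qed.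

Let low w : low_mass X p n <= mN p w * (Qnorm X p n / qpn X p n).
Proof.
have q0 : 0 <= Qnorm X p n / qpn X p n.
  by rewrite divr_ge0// ltW// ?Qnorm_gt0 ?qpn_gt0.
rewrite /low_mass ler_wpM2r//.
by case/andP: (massN_bounds X (xi ^~ w) p).
Qed.

Let Lpre_low w : mN p w * (Qnorm X p n / qpn X p n) <= Lpre w (phi X ones n p).
Proof.
rewrite -Lpre_ones mulrC -LpreZ; last exact: b1.
apply: Lpre_le => [| |y]; [exact: bmeasZ|exact: bmeas_phi|].
by rewrite /ones mulr1 Qnorm_qpn.
Qed.

Let low0 w : 0 < mN p w * (Qnorm X p n / qpn X p n).
Proof. by rewrite mulr_gt0 ?massN_gt0// divr_gt0 ?Qnorm_gt0 ?qpn_gt0. Qed.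

Let etaN_low w : mN p w * (Qnorm X p n / qpn X p n) + csum X p n <= U ones n p w.
Proof.
rewrite /U csum_ssum lerD2r ler_wpM2l//; first by rewrite ltW// massN_gt0.
rewrite -[leLHS]mulr1 -(mass_prob (emp R (xi p w))) -rint_cst; apply: etaN_le.
- exact: bmeas_cst.
- exact: bmeas_phi.
- by move=> y; exact: Qnorm_qpn.
Qed.

Lemma U_ones_gt0 w : 0 < U ones n p w.
Proof.
by apply: lt_le_trans (etaN_low w); rewrite ltr_pwDl ?csum_ge0.
Qed.

Lemma Upre_ones_gt0 w : 0 < Upre ones n p w.
Proof.
rewrite Upre_Lpre// -csum_ssum ltr_pwDl ?csum_ge0//.
exact: lt_le_trans (low0 w) (Lpre_low w).
Qed.

Let lambda w := Upre F n p w / Upre ones n p w.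

(** [lambda] averages the functions [P_{q,n}(F)] over the mass [A] transported from time [p] and
    over the later sources. The first part deviates from [l0] by at most [betaP X p n], the second
    by [cbeta] in total, and the full mass is at least [low_mass + csum]. *)
Let lambda_le w : `|lambda w - l0| <=
  betaP X p n + cbeta X p n / (low_mass X p n + csum X p n).
Proof.
have V0 := Upre_ones_gt0 w.
have -> : lambda w - l0 = (Upre F n p w - l0 * Upre ones n p w) / Upre ones n p w.
  by rewrite mulrBl mulfK// gt_eqF.
rewrite normrM normfV (gtr0_norm V0) ler_pdivrMr//.
have := V0; rewrite !Upre_Lpre// -csum_ssum.
set A := Lpre w (phi X ones n p); set B := Lpre w (phi X F n p) => V0'.
have A0 : 0 < A := lt_le_trans (low0 w) (Lpre_low w).
have lA : low_mass X p n <= A := le_trans (low w) (Lpre_low w).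
have hB : `|B - l0 * A| <= betaP X p n * A.
  have c1 := bmeas_phi X n p b1; have c2 := bmeas_phi X n p bF.
  have ppn : (p <= p <= n)%N by rewrite leqnn.
  rewrite ler_norml; apply/andP; split.
    suff : (l0 - betaP X p n) * A <= B by rewrite mulrBl; lra.
    rewrite -LpreZ//; apply: Lpre_le => [| |y]; [exact: bmeasZ|exact: c2|].
    by have := phi_center Hl0 y ppn; rewrite ler_norml mulrBl => /andP[]; lra.
  suff : B <= (l0 + betaP X p n) * A by rewrite mulrDl; lra.
  rewrite -LpreZ//; apply: Lpre_le => [| |y]; [exact: c2|exact: bmeasZ|].
  by have := phi_center Hl0 y ppn; rewrite ler_norml mulrDl => /andP[]; lra.
have hs := ssum_center oF Hl0; rewrite -csum_ssum in hs.
have -> : B + ssum X F n p - l0 * (A + csum X p n) =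
    (B - l0 * A) + (ssum X F n p - l0 * csum X p n) by ring.
apply: (le_trans (ler_normD _ _)); rewrite mulrDl; apply: lerD.
  apply: (le_trans hB); rewrite ler_wpM2l ?betaP_ge0//.
  by rewrite lerDl csum_ge0.
apply: (le_trans hs).
have [c0|c0] := eqVneq (csum X p n) 0.
  have -> : cbeta X p n = 0 by apply: le_anti; rewrite cbeta_ge0 -c0 cbeta_le.
  by rewrite !mul0r.
have cp : 0 < csum X p n by rewrite lt0r c0 csum_ge0.
have dp : 0 < low_mass X p n + csum X p n by rewrite ltr_wpDl ?low_mass_ge0.
rewrite mulrAC ler_pdivlMr// ler_wpM2l ?cbeta_ge0//.
by rewrite lerD2r.
Qed.

(** By linearity the increment is [gamma^N_p(1) / V_p] times the sampling error of
    [Q_{p,n}(F - lambda)]. As [lambda] is random, it is written as [l0] plus a bounded remainder,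
    which leaves the errors of two fixed functions. *)
Lemma ratio_increment_le w :
  `|U F n p w / U ones n p w - Upre F n p w / Upre ones n p w| <=
  min1m X p n * qpn X p n / Qnorm X p n *
   (`|Delta centered w| +
    (betaP X p n + cbeta X p n / (low_mass X p n + csum X p n)) *
    `|Delta (phi X ones n p) w|).
Proof.
have V0 := Upre_ones_gt0 w; have W0 := U_ones_gt0 w.
have Q0 := Qnorm_gt0 X n p; have m0 := massN_gt0 X (xi ^~ w) p.
have c1 := bmeas_phi X n p b1; have c2 := bmeas_phi X n p bF.
have E1 : U F n p w / U ones n p w - Upre F n p w / Upre ones n p w =
    mN p w / U ones n p w *
    (Delta centered w - (lambda w - l0) * Delta (phi X ones n p) w).
  have -> : Delta centered w = Delta (phi X F n p) w - l0 * Delta (phi X ones n p) w.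
    exact: Delta_comb.
  rewrite -/(lambda w).
  have UE := U_incr w bF pn; have U1E := U_incr w b1 pn.
  have LE : Upre F n p w = lambda w * Upre ones n p w by rewrite divfK// gt_eqF.
  apply: (mulIf (lt0r_neq0 W0)); rewrite mulrBl divfK ?gt_eqF//.
  rewrite [RHS]mulrAC [mN p w / _ * _]divfK ?gt_eqF// UE U1E LE; ring.
rewrite E1 normrM [X in X * _ <= _]gtr0_norm ?divr_gt0//.
have h := normalized_weight_le (massN_range w) (etaN_low w).
apply: (@le_trans _ _ (min1m X p n * qpn X p n / Qnorm X p n *
    `|Delta centered w - (lambda w - l0) * Delta (phi X ones n p) w|)).
  rewrite ler_wpM2r// ler_pdivlMr// mulrAC.
  exact: h.
rewrite ler_wpM2l//.
  by rewrite divr_ge0 ?(ltW Q0)// mulr_ge0 ?min1m_ge0// ltW// qpn_gt0.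
rewrite (le_trans (ler_normB _ _))// lerD2l normrM ler_wpM2r//.
Qed.

(** Each error is divided by its natural bound so that [Delta_exp] applies. If [betaP] is 0, the
    first entry is 0 by the convention on inverses, and [centered] then vanishes identically. *)
Definition error_size w : R :=
  Num.max (Num.sqrt N%:R / (4 * (betaP X p n * Qnorm X p n)) * `|Delta centered w|)
          (Num.sqrt N%:R / (4 * Qnorm X p n) * `|Delta (phi X ones n p) w|).

Lemma bmeas_error_size : bmeas error_size.
Proof.
have m1 : bmeas (fun w => Num.sqrt N%:R / (4 * (betaP X p n * Qnorm X p n)) *
    `|Delta centered w|).
  apply: bmeasZ; apply: bmeas_norm; apply: bmeas_Delta; exact: bmeas_centered.
have m2 : bmeas (fun w => Num.sqrt N%:R / (4 * Qnorm X p n) *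
    `|Delta (phi X ones n p) w|).
  apply: bmeasZ; apply: bmeas_norm; apply: bmeas_Delta; exact: bmeas_phi.
have [k1 [C1 H1]] := m1; have [k2 [C2 H2]] := m2.
split; first exact: measurable_maxr.
exists (C1 + C2) => w; rewrite /error_size.
move: (H1 w) (H2 w); have := normr_ge0 (Num.sqrt N%:R / (4 * Qnorm X p n) *
    `|Delta (phi X ones n p) w|).
have := normr_ge0 (Num.sqrt N%:R / (4 * (betaP X p n * Qnorm X p n)) *
    `|Delta centered w|).
by rewrite /Num.max; case: ifP => _; lra.
Qed.

(** The exponential of a maximum is at most the sum of the exponentials, each of mean at most
    [2 * expR 1]. *)
Lemma error_size_exp : \int[P]_w expR (error_size w) <= 4 * expR 1.
Proof.
have fP := prob_finite P; have Q0 := Qnorm_gt0 X n p.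
have e1 : (1 : R) <= expR 1 by rewrite -[leLHS]expR0 ler_expR.
have mc := bmeas_centered; have c1 := bmeas_phi X n p b1.
have i1 : \int[P]_w expR (Num.sqrt N%:R / (4 * (betaP X p n * Qnorm X p n)) *
    `|Delta centered w|) <= 2 * expR 1.
  have [b0|b0] := eqVneq (betaP X p n) 0.
    rewrite b0 mul0r mulr0 invr0 mulr0.
    under eq_Rintegral do rewrite mul0r expR0.
    by rewrite rint_cst mass_prob; lra.
  have bp : 0 < betaP X p n by rewrite lt0r b0 betaP_ge0.
  have := @Delta_exp p (fun=> 1) centered _ (past_const p 1) (fun=> ler01) mc
    (mulr_gt0 bp Q0) centered_le.
  under eq_Rintegral do rewrite mul1r.
  by rewrite rint_cst mass_prob !mulr1.
have i2 : \int[P]_w expR (Num.sqrt N%:R / (4 * Qnorm X p n) *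
    `|Delta (phi X ones n p) w|) <= 2 * expR 1.
  have H y : `|phi X ones n p y| <= Qnorm X p n.
    by rewrite gtr0_norm ?phi_ones_gt0// Qnorm_ge.
  have := @Delta_exp p (fun=> 1) (phi X ones n p) _ (past_const p 1) (fun=> ler01) c1 Q0 H.
  under eq_Rintegral do rewrite mul1r.
  by rewrite rint_cst mass_prob !mulr1.
have m1 : bmeas (fun w => expR (Num.sqrt N%:R / (4 * (betaP X p n * Qnorm X p n)) *
    `|Delta centered w|)).
  by apply: bmeas_exp; apply: bmeasZ; apply: bmeas_norm; exact: bmeas_Delta.
have m2 : bmeas (fun w => expR (Num.sqrt N%:R / (4 * Qnorm X p n) *
    `|Delta (phi X ones n p) w|)).
  by apply: bmeas_exp; apply: bmeasZ; apply: bmeas_norm; exact: bmeas_Delta.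
have -> : (4 : R) * expR 1 = 2 * expR 1 + 2 * expR 1 by ring.
apply: le_trans (lerD i1 i2); rewrite -rintD//; apply: rint_le => //.
- exact: bmeas_exp bmeas_error_size.
- exact: bmeasD.
- by move=> w; rewrite /error_size /Num.max; case: ifP => _;
    rewrite ?lerDl ?lerDr expR_ge0.
Qed.

(** The factor 8 is 4 + 4, the normalizations of the two errors in [error_size]; it multiplies the
    summand of [bsharp]. *)
Definition term_weight : R := 8 * (min1m X p n * qpn X p n *
  (betaP X p n + cbeta X p n / (low_mass X p n + csum X p n))).

Lemma ratio_increment_error w :
  Num.sqrt N%:R * `|U F n p w / U ones n p w - Upre F n p w / Upre ones n p w| <=
  term_weight * error_size w.
Proof.
have Q0 := Qnorm_gt0 X n p.
have sN : 0 < Num.sqrt (N%:R : R) by rewrite sqrtr_gt0 ltr0n.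
have b0 := betaP_ge0 X pn.
set k := min1m X p n * qpn X p n.
have k0 : 0 <= k by rewrite mulr_ge0 ?min1m_ge0// ltW// qpn_gt0.
set om := cbeta X p n / (low_mass X p n + csum X p n).
have om0 : 0 <= om by rewrite divr_ge0 ?cbeta_ge0// addr_ge0 ?low_mass_ge0 ?csum_ge0.
have mc := bmeas_centered.
have z1 : Num.sqrt N%:R * `|Delta centered w| / Qnorm X p n <=
    4 * betaP X p n * error_size w.
  have [bz|bz] := eqVneq (betaP X p n) 0.
    have -> : centered = (fun=> 0).
      apply/funext => y; apply/eqP; rewrite -normr_le0.
      by have := centered_le y; rewrite bz mul0r.
    have -> : @Delta p (fun=> 0) w = 0.
      transitivity (Delta (fun y => ones p y - 1 * ones p y) w).
        by congr (@Delta p _ w); apply/funext => y; rewrite mul1r subrr.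
      by rewrite Delta_comb// mul1r subrr.
    by rewrite bz normr0 !mulr0 !mul0r.
  have bp : 0 < betaP X p n by rewrite lt0r bz.
  have -> : Num.sqrt N%:R * `|Delta centered w| / Qnorm X p n =
      4 * betaP X p n * (Num.sqrt N%:R / (4 * (betaP X p n * Qnorm X p n)) *
      `|Delta centered w|) by field; rewrite !gt_eqF.
  by rewrite ler_wpM2l ?mulr_ge0// /error_size le_max lexx.
have z2 : Num.sqrt N%:R * `|Delta (phi X ones n p) w| / Qnorm X p n <= 4 * error_size w.
  have -> : Num.sqrt N%:R * `|Delta (phi X ones n p) w| / Qnorm X p n =
      4 * (Num.sqrt N%:R / (4 * Qnorm X p n) * `|Delta (phi X ones n p) w|).
    by field; rewrite gt_eqF.
  by rewrite ler_wpM2l// /error_size le_max lexx orbT.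
have e0 : 0 <= error_size w.
  rewrite /error_size le_max; apply/orP; right.
  by rewrite mulr_ge0// divr_ge0 ?(ltW sN)// mulr_ge0// ltW.
apply: (@le_trans _ _ (k * (Num.sqrt N%:R * `|Delta centered w| / Qnorm X p n +
    (betaP X p n + om) * (Num.sqrt N%:R * `|Delta (phi X ones n p) w| / Qnorm X p n)))).
  have := ler_wpM2l (ltW sN) (ratio_increment_le w); rewrite -/k -/om => h.
  apply: (le_trans h); rewrite le_eqVlt; apply/orP; left; apply/eqP.
  by field; rewrite gt_eqF.
rewrite /term_weight -/k -/om.
have -> : 8 * (k * (betaP X p n + om)) * error_size w =
    k * (8 * (betaP X p n + om) * error_size w) by ring.
rewrite ler_wpM2l//.
have z3 := ler_wpM2l (addr_ge0 b0 om0) z2.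
apply: (le_trans (lerD z1 z3)).
have : 0 <= om * error_size w by rewrite mulr_ge0.
lra.
Qed.

End increment_bound.

(** * The [L^r] bound and unbiasedness *)

Lemma etaN_eta_telescope F n w : (forall m, Osc1 (F m)) ->
  etaN (F n) w - \int[Defs.eta X n]_x F n x =
  \sum_(0 <= p < n.+1) (U F n p w / U ones n p w - Upre F n p w / Upre ones n p w).
Proof.
move=> oF; have bF m : bmeas (F m) := Osc1_bmeas (oF m).
have m0 := massN_gt0 X (xi ^~ w) n.
have -> : etaN (F n) w = U F n n w / U ones n n w.
  by rewrite !Unn etaN_ones mulr1 mulrC mulKf// gt_eqF.
have -> : \int[Defs.eta X n]_x F n x = Upre F n 0 w / Upre ones n 0 w.
  by rewrite rint_eta// [in LHS]massE.
suff H k : U F n k w / U ones n k w - Upre F n 0 w / Upre ones n 0 w =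
    \sum_(0 <= p < k.+1) (U F n p w / U ones n p w - Upre F n p w / Upre ones n p w).
  exact: H.
elim: k => [|k IH]; first by rewrite big_nat1.
by rewrite big_nat_recr//= -IH /=; ring.
Qed.

(** With [D] the absolute error, [sqrt N * D / B] has exponential moment at most [4 * expR 1]; then
    [x^r <= r^r e^x] bounds the [r]-th moment, and [4 * expR 1] is at most its own [r]-th power. The
    constant 32 is 8 from [term_weight] times 4. *)
Lemma Lr_bound n (g : E n -> R) (r : R) : Osc1 g -> 1 <= r ->
  ((Num.sqrt N%:R)%:E *
    ('E_P[(fun w => `|\int[emp R (xi n w)]_x g x - \int[Defs.eta X n]_x g x| `^ r)%R])
      `^ r^-1 <= (32 * expR 1 * r * bsharp X n)%:E)%E.
Proof.
move=> /extend_Osc1[F [<- oF]] r1.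
have bF m : bmeas (F m) := Osc1_bmeas (oF m).
have fP := prob_finite P; have r0 : 0 < r by lra.
have sN : 0 < Num.sqrt (N%:R : R) by rewrite sqrtr_gt0 ltr0n.
have e1 : (1 : R) <= expR 1 by rewrite -[leLHS]expR0 ler_expR.
pose D w := `|etaN (F n) w - \int[Defs.eta X n]_x F n x|.
have D0 w : 0 <= D w by exact: normr_ge0.
have bD : bmeas D.
  by apply: bmeas_norm; apply: bmeasB; [exact: bmeas_etaN|exact: bmeas_cst].
have bDr : bmeas (fun w => D w `^ r).
  have [mD [C DC]] := bD; split.
    by apply: (measurableT_comp (measurable_powR r)).
  exists (C `^ r) => w; rewrite ger0_norm ?powR_ge0//.
  have DC' : D w <= C by rewrite -[D w]ger0_norm.
  by apply: ge0_ler_powR; rewrite ?nnegrE//; [lra|exact: le_trans DC'].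
rewrite -[X in ('E_P[X])%E]/(fun w => D w `^ r) expectation_rint// poweR_EFin -EFinM.
apply/lee_addgt0Pr => eps eps0; rewrite -EFinD lee_fin.
have h4 : 0 < 4 * expR 1 * r by rewrite !mulr_gt0// expR_gt0.
(* The term in [eps] keeps [B] positive when [bsharp] vanishes, and is scaled so as to contribute
   exactly [eps] to the final bound. *)
pose B := 8 * bsharp X n + eps / (4 * expR 1 * r).
have B0 : 0 < B by rewrite ltr_wpDl ?divr_gt0// mulr_ge0// bsharp_ge0.
have -> : 32 * expR 1 * r * bsharp X n + eps = 4 * expR 1 * r * B.
  by rewrite /B; field; rewrite !gt_eqF// expR_gt0.
have M : \int[P]_w expR (Num.sqrt N%:R * D w / B) <= 4 * expR 1.
  apply: (@convex_exp_moment _ _ _ P n.+1 (term_weight n) (fun p => error_size n p F)) => //.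
  - by move=> p pn; rewrite /term_weight mulr_ge0// bsharp_term_ge0.
  - by move=> p pn; exact: bmeas_error_size.
  - exact: bmeasZ.
  - lra.
  - by move=> p pn; exact: error_size_exp.
  - by rewrite /term_weight -mulr_sumr -/(bsharp X n) lerDl ltW// divr_gt0.
  - move=> w; rewrite /D etaN_eta_telescope//.
    apply: le_trans (ler_wpM2l (ltW sN) (ler_norm_sum _ _ _)) _.
    rewrite mulr_sumr big_nat [leRHS]big_nat; apply: ler_sum => p /andP[_ pn].
    exact: ratio_increment_error.
have I : \int[P]_w (D w `^ r) <= (4 * expR 1 * r * B / Num.sqrt N%:R) `^ r.
  apply: (@le_trans _ _ (\int[P]_w ((r * B / Num.sqrt N%:R) `^ r *
      expR (Num.sqrt N%:R * D w / B)))).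
    apply: rint_le => //.
      apply: bmeasZ; apply: bmeas_exp.
      rewrite (_ : (fun _ => _) = fun w => (Num.sqrt N%:R / B) * D w).
        exact: bmeasZ.
      by apply/funext => w; rewrite mulrAC.
    move=> w; set t := Num.sqrt N%:R * D w / B.
    have t0 : 0 <= t by rewrite divr_ge0 ?(ltW B0)// mulr_ge0// ltW.
    have k0 : 0 <= B / Num.sqrt N%:R by rewrite divr_ge0// ltW.
    have -> : D w `^ r = t `^ r * (B / Num.sqrt N%:R) `^ r.
      by rewrite -powRM//; congr (_ `^ _); rewrite /t; field; rewrite !gt_eqF.
    have -> : (r * B / Num.sqrt N%:R) `^ r = r `^ r * (B / Num.sqrt N%:R) `^ r.
      by rewrite -powRM ?mulrA// ltW.
    by rewrite [leRHS]mulrAC ler_wpM2r ?powR_ge0// powR_le_expR.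
  have bE : bmeas (fun w => expR (Num.sqrt N%:R * D w / B)).
    apply: bmeas_exp.
    rewrite (_ : (fun _ => _) = fun w => (Num.sqrt N%:R / B) * D w).
      exact: bmeasZ.
    by apply/funext => w; rewrite mulrAC.
  rewrite rintZ//.
  have -> : 4 * expR 1 * r * B / Num.sqrt N%:R = (r * B / Num.sqrt N%:R) * (4 * expR 1).
    by field; rewrite gt_eqF.
  have q4 : 1 <= 4 * expR 1 :> R by lra.
  have x0 : 0 <= r * B / Num.sqrt N%:R by rewrite divr_ge0// ?(ltW sN)// mulr_ge0// ltW.
  have y0 : 0 <= 4 * expR 1 :> R by exact: le_trans q4.
  rewrite [leRHS](powRM _ x0 y0).
  rewrite ler_wpM2l ?powR_ge0//; apply: (le_trans M).
  by rewrite -[leLHS]powRr1 ?ler_powR//; lra.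
have I0 : 0 <= \int[P]_w (D w `^ r) by apply: Rintegral_ge0 => w _; exact: powR_ge0.
have c0 : 0 <= 4 * expR 1 * r * B / Num.sqrt N%:R.
  by rewrite divr_ge0 ?(ltW sN)// mulr_ge0// ltW.
have ri : 0 <= r^-1 by rewrite invr_ge0 ltW.
have := ge0_ler_powR ri I0 (powR_ge0 _ _) I.
rewrite -powRrM mulfV ?gt_eqF// powRr1// => J.
by rewrite mulrC -ler_pdivlMr.
Qed.

Lemma unbiased n (f : E n -> R) : bmeas f ->
  'E_P[(fun w => mN n w * \int[emp R (xi n w)]_x f x)%R]%E = (\int[gamma X n]_x f x)%:E.
Proof.
move=> /extend_family[F [<- bF _]].
have -> : (fun w => mN n w * \int[emp R (xi n w)]_x F n x) = U F n n.
  by apply/funext => w; rewrite Unn.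
by rewrite expectation_rint ?rint_U//; exact: bmeas_U.
Qed.

(** * Variance of the normalized mass *)

(** [t^2 <= 2 e^t] applied to the rescaled error [t]: as [Delta^2 = 16 C^2 t^2 / N], the factor 64
    is 16 times 2 times the 2 of [Delta_exp]. *)
Lemma Delta_sq p W f C : past_fun p W -> (forall w, 0 <= W w) -> bmeas f ->
  0 < C -> (forall y, `|f y| <= C) ->
  \int[P]_w (W w * @Delta p f w ^+ 2) <= 64 * expR 1 * C ^+ 2 / N%:R * \int[P]_w W w.
Proof.
move=> pW W0 bf C0 fC; have fP := prob_finite P.
have NR : (0 : R) < N%:R by rewrite ltr0n.
have sN : 0 < Num.sqrt (N%:R : R) by rewrite sqrtr_gt0 ltr0n.
have bW := past_bmeas pW; have bDl := bmeas_Delta bf.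
have := Delta_exp pW W0 bf C0 fC.
set t := fun w => Num.sqrt N%:R / (4 * C) * `|Delta f w| => h.
have bt : bmeas (fun w => W w * expR (t w)).
  by apply: bmeasM => //; apply: bmeas_exp; apply: bmeasZ; exact: bmeas_norm.
apply: (@le_trans _ _ (\int[P]_w (32 * C ^+ 2 / N%:R * (W w * expR (t w))))).
  apply: rint_le => //.
  - by apply: bmeasM => //; exact: (bmeasM bDl bDl).
  - exact: bmeasZ.
  - move=> w; rewrite [leRHS]mulrCA ler_wpM2l//.
    have tw : 0 <= t w by rewrite /t mulr_ge0// divr_ge0 ?(ltW sN)// mulr_ge0// ltW.
    have := expR_ge1Dxn 1 tw; rewrite (_ : 2`! = 2%N)// => h2.
    have -> : Delta f w ^+ 2 = 16 * C ^+ 2 / N%:R * t w ^+ 2.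
      rewrite /t exprMn (real_normK (num_real _)) expr_div_n sqr_sqrtr ?(ltW NR)//.
      by field; rewrite !gt_eqF.
    have -> : 32 * C ^+ 2 / N%:R * expR (t w) = 16 * C ^+ 2 / N%:R * (2 * expR (t w)) by ring.
    rewrite ler_wpM2l//; last by lra.
    by rewrite divr_ge0 ?(ltW NR)// mulr_ge0// sqr_ge0.
rewrite rintZ//.
have -> : 64 * expR 1 * C ^+ 2 / N%:R * \int[P]_w W w =
  32 * C ^+ 2 / N%:R * (2 * expR 1 * \int[P]_w W w) by ring.
by rewrite ler_wpM2l// divr_ge0 ?(ltW NR)// mulr_ge0// sqr_ge0.
Qed.

(** Orthogonality of the martingale increments: each cross term is a past function times a centered
    error. *)
Lemma massN_variance n : \int[P]_w (mN n w - mass (gamma X n)) ^+ 2 =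
  \sum_(0 <= p < n) \int[P]_w (mN p w ^+ 2 * Delta (phi X ones n p) w ^+ 2).
Proof.
have fP := prob_finite P; set G := mass _.
have b1 := @bmeas_ones R _ E.
have bm p : bmeas (fun w => mN p w) := past_bmeas (past_massN p).
have bDl p : bmeas (Delta (phi X ones n p)) := bmeas_Delta (bmeas_phi X n p b1).
have step p : (p <= n)%N -> \int[P]_w (U ones n p w - G) ^+ 2 =
    \int[P]_w (Upre ones n p w - G) ^+ 2 +
    \int[P]_w (mN p w ^+ 2 * Delta (phi X ones n p) w ^+ 2).
  move=> pn; have pU := past_Upre n p b1.
  have bU := past_bmeas pU.
  have bUG : bmeas (fun w => Upre ones n p w - G) by apply: bmeasB => //; exact: bmeas_cst.
  have pc : past_fun p (fun w => 2 * (Upre ones n p w - G) * mN p w).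
    apply: past_mul; last exact: past_massN.
    apply: past_mul; first exact: past_const.
    case: p pn pU bU bUG => [|p] pn pU bU bUG; last first.
      by apply: (@bmeasB _ _ (Past p)) => //; exact: bmeas_cst.
    by case: pU => c ->; exists (c - G).
  rewrite (@eq_Rintegral _ _ _ P setT (fun w =>
     ((Upre ones n p w - G) ^+ 2 + mN p w ^+ 2 * Delta (phi X ones n p) w ^+ 2) +
     2 * (Upre ones n p w - G) * mN p w * Delta (phi X ones n p) w)); last first.
    by move=> w _; rewrite U_incr//; ring.
  have b2 : bmeas (fun w => (Upre ones n p w - G) ^+ 2) := bmeasM bUG bUG.
  have b3 : bmeas (fun w => mN p w ^+ 2 * Delta (phi X ones n p) w ^+ 2).
    exact: (bmeasM (bmeasM (bm p) (bm p)) (bmeasM (bDl p) (bDl p))).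
  rewrite rintD//; last 2 first.
  - exact: bmeasD.
  - by apply: bmeasM => //; exact: past_bmeas pc.
  rewrite (Delta_mean0 pc) ?addr0 ?rintD//; exact: bmeas_phi.
have tele p : (p <= n)%N -> \int[P]_w (U ones n p w - G) ^+ 2 =
    \sum_(0 <= q < p.+1) \int[P]_w (mN q w ^+ 2 * Delta (phi X ones n q) w ^+ 2).
  elim: p => [|p IH] pn; rewrite step//.
    rewrite big_nat1 -[RHS]add0r; congr (_ + _).
    rewrite /Upre -massE -/G.
    by under eq_Rintegral do rewrite subrr expr0n/=; rewrite rint_cst mul0r.
  by rewrite big_nat_recr//= -IH// ltnW.
have := tele n (leqnn n); rewrite big_nat_recr//=.
(* The last increment vanishes because an empirical measure has mass 1, so the sum stops at
   [p < n]. *)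
have -> : Delta (phi X ones n n) = fun=> 0.
  apply/funext => w; rewrite phinn.
  case: (n) => [|m]; rewrite /Delta etaN_ones.
    by rewrite /ones rint_cst mass_prob mulr1 subrr.
  rewrite (eq_bigr (fun=> 1)) => [|i _].
    by rewrite sumr_const card_ord mulVf ?subrr// gt_eqF// ltr0n.
  by rewrite /kfun /ones rint_cst mul1r /mass prob_kernel.
under [X in _ = _ + X -> _]eq_Rintegral do rewrite expr0n/= mulr0.
rewrite rint_cst mul0r addr0 => <-; apply: eq_Rintegral => w _.
by rewrite Unn etaN_ones mulr1.
Qed.

(** Division by [gamma_n(1)^2] turns the weight of each increment into a second moment of the
    relative mass at an earlier time, which closes the recursion for [discrete_gronwall]. *)
Lemma massN_relative_variance_rec (qs : R) n :
  (forall p, (p < n)%N -> qpn X p n <= qs) ->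
  \int[P]_w (mN n w / mass (gamma X n) - 1) ^+ 2 <=
  64 * expR 1 * qs ^+ 2 / N%:R *
  \sum_(0 <= p < n) \int[P]_w (mN p w / mass (gamma X p)) ^+ 2.
Proof.
move=> Hq; have fP := prob_finite P.
have b1 := @bmeas_ones R _ E.
have bm p : bmeas (fun w => mN p w) := past_bmeas (past_massN p).
have Gn := mass_gamma_gt0 X n.
have NR : (0 : R) < N%:R by rewrite ltr0n.
rewrite (@eq_Rintegral _ _ _ P setT (fun w =>
  (mass (gamma X n)) ^- 2 * (mN n w - mass (gamma X n)) ^+ 2)); last first.
  by move=> w _; field; rewrite gt_eqF.
have bmG : bmeas (fun w => mN n w - mass (gamma X n)).
  by apply: bmeasB => //; exact: bmeas_cst.
rewrite rintZ//; last exact: (bmeasM bmG bmG).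
rewrite massN_variance !mulr_sumr big_nat [leRHS]big_nat; apply: ler_sum => p /andP[_ pn].
have Gp := mass_gamma_gt0 X p.
have m2 : bmeas (fun w => mN p w ^+ 2) := bmeasM (bm p) (bm p).
have H y : `|phi X ones n p y| <= Qnorm X p n.
  by rewrite gtr0_norm ?phi_ones_gt0// Qnorm_ge.
have := @Delta_sq p (fun w => mN p w ^+ 2) (phi X ones n p) (Qnorm X p n)
  (past_mul (past_massN p) (past_massN p)) (fun w => sqr_ge0 _) (bmeas_phi X n p b1)
  (Qnorm_gt0 X n p) H.
set I := \int[P]_w mN p w ^+ 2; set J := \int[P]_w _ => h.
have -> : \int[P]_w (mN p w / mass (gamma X p)) ^+ 2 = (mass (gamma X p)) ^- 2 * I.
  rewrite -rintZ//; apply: eq_Rintegral => w _.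
  by field; rewrite gt_eqF.
have I0 : 0 <= I by apply: Rintegral_ge0 => w _; exact: sqr_ge0.
(* [gamma_n(1)] is at least [gamma_p Q_{p,n}(1)], which is at least [gamma_p(1) * Qnorm / qpn]. *)
have ratio : Qnorm X p n * mass (gamma X p) <= qs * mass (gamma X n).
  have : mass (gamma X p) * (Qnorm X p n / qpn X p n) <= mass (gamma X n).
    rewrite [leRHS]massE (gamma_phi X b1 (ltnW pn)) mulrC -rint_cst.
    apply: ler_wpDr; first by rewrite -csum_ssum csum_ge0.
    apply: rint_le => [||| y].
    - exact: gamma_finite.
    - exact: bmeas_cst.
    - exact: bmeas_phi.
    - exact: Qnorm_qpn.
  rewrite mulrA ler_pdivrMr ?qpn_gt0// mulrC => h1.
  apply: (le_trans h1); rewrite mulrC ler_wpM2r ?(ltW Gn)//; exact: Hq.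
have i2 : 0 <= (mass (gamma X n)) ^- 2 by rewrite invr_ge0 sqr_ge0.
apply: (le_trans (ler_wpM2l i2 h)).
have -> : (mass (gamma X n)) ^- 2 * (64 * expR 1 * Qnorm X p n ^+ 2 / N%:R * I) =
  64 * expR 1 / N%:R * I * ((Qnorm X p n * mass (gamma X p)) ^+ 2 *
     ((mass (gamma X n)) ^- 2 * (mass (gamma X p)) ^- 2)).
  by field; rewrite !gt_eqF.
have -> : 64 * expR 1 * qs ^+ 2 / N%:R * ((mass (gamma X p)) ^- 2 * I) =
  64 * expR 1 / N%:R * I * ((qs * mass (gamma X n)) ^+ 2 *
     ((mass (gamma X n)) ^- 2 * (mass (gamma X p)) ^- 2)).
  by field; rewrite !gt_eqF.
have Q0 := Qnorm_gt0 X n p.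
have QG : 0 <= Qnorm X p n * mass (gamma X p) by rewrite mulr_ge0// ltW.
apply: ler_wpM2l; first by rewrite mulr_ge0// divr_ge0 ?(ltW NR)// mulr_ge0// expR_ge0.
apply: ler_wpM2r; first by rewrite mulr_ge0// invr_ge0 sqr_ge0.
by rewrite lerXn2r// nnegrE// (le_trans QG).
Qed.

Lemma massN_second_moment n :
  \int[P]_w (mN n w / mass (gamma X n)) ^+ 2 =
  1 + \int[P]_w (mN n w / mass (gamma X n) - 1) ^+ 2.
Proof.
have fP := prob_finite P; have Gn := mass_gamma_gt0 X n.
have b1 := @bmeas_ones R _ E.
have bm : bmeas (fun w => mN n w) := past_bmeas (past_massN n).
have bmG : bmeas (fun w => mN n w / mass (gamma X n)).
  by apply: bmeasM => //; exact: bmeas_cst.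
have b2 : bmeas (fun w => (mN n w / mass (gamma X n)) ^+ 2) := bmeasM bmG bmG.
have mean : \int[P]_w (mN n w / mass (gamma X n)) = 1.
  rewrite (@eq_Rintegral _ _ _ P setT (fun w => (mass (gamma X n))^-1 * U ones n n w)).
    rewrite rintZ//; last exact: bmeas_U.
    by rewrite rint_U// -massE mulVf// gt_eqF.
  by move=> w _; rewrite Unn etaN_ones mulr1 mulrC.
rewrite (@eq_Rintegral _ _ _ P setT (fun w => ((mN n w / mass (gamma X n)) ^+ 2 -
   2 * (mN n w / mass (gamma X n))) + 1) (fun w => (mN n w / mass (gamma X n) - 1) ^+ 2)).
  have b3 : bmeas (fun w => 2 * (mN n w / mass (gamma X n))) by exact: bmeasZ.
  rewrite rintD//; [|exact: bmeasB|exact: bmeas_cst].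
  by rewrite rintB// rintZ// mean rint_cst mass_prob; ring.
by move=> w _; ring.
Qed.

End particles.

(** * Recursions and sums of real sequences *)

(** Strong induction and the geometric sum give [1 + v n <= (1 + x)^n]; put back into the
    hypothesis, each of the [n] terms is bounded by the largest power. *)
Lemma discrete_gronwall (R : realType) (x : R) (v : nat -> R) : 0 <= x ->
  (forall n, v n <= x * \sum_(0 <= p < n) (1 + v p)) ->
  forall n, v n <= x * (n%:R * (1 + x) ^+ n.-1).
Proof.
move=> x0 H.
have geo n : x * (\sum_(0 <= p < n) (1 + x) ^+ p) = (1 + x) ^+ n - 1.
  elim: n => [|n IH]; first by rewrite big_geq// mulr0 expr0 subrr.
  by rewrite big_nat_recr//= mulrDr IH exprS; ring.
have u n : 1 + v n <= (1 + x) ^+ n.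
  elim/ltn_ind: n => n IH.
  apply: (@le_trans _ _ (1 + x * \sum_(0 <= p < n) (1 + x) ^+ p)).
    rewrite lerD2l (le_trans (H n))// ler_wpM2l// big_nat [leRHS]big_nat.
    by apply: ler_sum => p /andP[_ pn]; exact: IH.
  by rewrite geo addrC subrK.
move=> n; apply: (le_trans (H n)); rewrite ler_wpM2l//.
apply: (@le_trans _ _ (\sum_(0 <= p < n) (1 + x) ^+ n.-1)).
  rewrite big_nat [leRHS]big_nat; apply: ler_sum => p /andP[_ pn].
  apply: (le_trans (u p)); apply: ler_weXn2l; first by rewrite lerDl.
  by case: n pn => [|n]//; rewrite ltnS.
by rewrite sumr_const_nat subn0 mulr_natl.
Qed.

Section real_sequences.
Context {R : realType}.

Lemma sum_rev (a : nat -> R) p n : (p <= n)%N ->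
  \sum_(p.+1 <= q < n.+1) a (n - q)%N = \sum_(0 <= j < n - p) a j.
Proof.
move=> pn; rewrite big_nat_rev/= -{1}[p.+1]add0n big_addn subSS.
apply: eq_big_nat => i /andP[_ ip]; congr a; lia.
Qed.

Lemma contraction_bound (g y x : R) : g < 1 -> x <= y + g * x -> x <= y / (1 - g).
Proof. by move=> g1 h; rewrite ler_pdivlMr; lra. Qed.

Lemma geometric_bound (g : R) n : 0 <= g < 1 -> \sum_(0 <= j < n) g ^+ j <= (1 - g)^-1.
Proof.
move=> /andP[g0 g1]; rewrite -[leRHS]mul1r; apply: contraction_bound => //.
apply: (@le_trans _ _ (\sum_(0 <= j < n.+1) g ^+ j)).
  by rewrite big_nat_recr//= lerDl exprn_ge0.
by rewrite big_nat_recl//= expr0 mulr_sumr lerD2l; under eq_bigr do rewrite exprS.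
Qed.

(** A shift of the index by [k] adds [k] terms equal to 1 and multiplies the rest by [g]. *)
Lemma block_geometric_bound (g : R) k n : 0 <= g < 1 -> (0 < k)%N ->
  \sum_(0 <= j < n) g ^+ (j %/ k) <= k%:R / (1 - g).
Proof.
move=> /andP[g0 g1] k0; apply: contraction_bound => //.
apply: (@le_trans _ _ (\sum_(0 <= j < k + n) g ^+ (j %/ k))).
  rewrite [leRHS](big_cat_nat (n := n))//= ?leq_addl// lerDl sumr_ge0// => j _.
  exact: exprn_ge0.
rewrite [leLHS](big_cat_nat (n := k))//= ?leq_addr//.
have -> : \sum_(0 <= j < k) g ^+ (j %/ k) = k%:R.
  rewrite (@eq_big_nat _ _ _ _ _ _ (fun=> 1)) => [|i /andP[_ ik]].
    by rewrite sumr_const_nat subn0.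
  by rewrite divn_small.
rewrite lerD2l -{1}[k]add0n big_addn addKn mulr_sumr.
apply: ler_sum => j _; rewrite divnDr// divnn k0 addn1 exprS.
by [].
Qed.

Lemma discounted_sum_bound (g : R) (a e : nat -> R) (S : R) n : 0 <= g < 1 ->
  (forall j, 0 <= a j) -> (forall j, a j.+1 <= g * a j + e j.+1) -> a 0%N <= e 0%N ->
  (forall n, \sum_(0 <= j < n) e j <= S) ->
  \sum_(0 <= j < n) a j <= S / (1 - g).
Proof.
move=> /andP[g0 g1] a0 aS ae eS; apply: contraction_bound => //.
apply: (@le_trans _ _ (\sum_(0 <= j < n.+1) a j)).
  by rewrite big_nat_recr//= lerDl.
apply: (@le_trans _ _ (\sum_(0 <= j < n.+1) e j + g * \sum_(0 <= j < n) a j)); last first.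
  by rewrite lerD2r.
rewrite big_nat_recl//= [in leRHS]big_nat_recl//= mulr_sumr -addrA -big_split/=.
by rewrite lerD//; apply: ler_sum => j _; rewrite addrC; exact: aS.
Qed.

End real_sequences.

(** * The time-homogeneous model under mixing *)

Section domination.
Context (R : realType) d (T : measurableType d) (m1 m2 : {measure set T -> \bar R}).
Variable c : R.
Hypothesis Hm : forall A, measurable A -> (c%:E * m1 A <= m2 A)%E.

Local Open Scope ereal_scope.

Lemma ge0_integral_domination (f : T -> \bar R) : measurable_fun setT f ->
  (forall x, 0 <= f x) -> c%:E * \int[m1]_x f x <= \int[m2]_x f x.
Proof.
move: f; apply: nonneg_measurable_ind => [b A b0 mA|f g mf mg f0 g0 Pf Pg|f_ mf f0 ndf Pf].
- have mE : measurable_fun setT (fun x : T => (\1_A x)%:E : \bar R).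
    by apply/measurable_EFinP; exact: measurable_indic.
  rewrite !ge0_integralZl// !integral_indic// setIT muleCA.
  by rewrite lee_wpmul2l// Hm.
- rewrite !ge0_integralD// ge0_muleDr ?integral_ge0//.
  exact: leeD.
- have mcvg (m : {measure set T -> \bar R}) :
      (\int[m]_y limn (fun n => (f_ n y)%:E) = limn (fun n => \int[m]_y (f_ n y)%:E)) /\
      cvgn (fun n => \int[m]_y (f_ n y)%:E).
    split.
      apply: monotone_convergence => //.
      + by move=> n; exact/measurable_EFinP.
      + by move=> n y _; rewrite lee_fin.
      + by move=> y _ m' n' mn; rewrite lee_fin ndf.
    apply: ereal_nondecreasing_is_cvgn => i j ij; apply: ge0_le_integral => //.
    + by move=> y _; rewrite lee_fin.
    + exact/measurable_EFinP.
    + exact/measurable_EFinP.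
    + by move=> y _; rewrite lee_fin ndf.
  have [-> c1] := mcvg m1; have [-> c2] := mcvg m2.
  rewrite -limeMl//; apply: lee_lim => //.
    exact: is_cvgeZl.
  by apply: nearW => n; exact: Pf.
Qed.

End domination.

Section homogeneous_model.
Context (R : realType) (d : measure_display) (E : measurableType d)
  (X : @model R (fun=> d) (fun=> E)) (G : E -> R) (M : R.-pker E ~> E)
  (mu : {finite_measure set E -> \bar R}).
Hypothesis hom : homogeneous X G M mu.

Let potE n : pot X n = G. Proof. by case: hom. Qed.
Let mutE n : mutation X n = M. Proof. by case: hom. Qed.
Let srcE n : source X n.+1 = mu. Proof. by case: hom. Qed.

Let bG : bmeas G. Proof. by rewrite -(potE 0); exact: bmeas_pot. Qed.

Let G0 x : 0 < G x. Proof. by rewrite -(potE 0); exact: pot_gt0. Qed.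

Let M1 x : M x setT = 1%E. Proof. exact: prob_kernel. Qed.

Let fM x : (M x setT < +oo)%E. Proof. by rewrite M1 ltry. Qed.

Let fmu : (mu setT < +oo)%E. Proof. by rewrite ltey_eq fin_num_measure. Qed.

Definition Qh (f : E -> R) (x : E) : R := G x * kfun M f x.

Lemma bmeas_Qh f : bmeas f -> bmeas (Qh f).
Proof. by move=> bf; apply: bmeasM => //; exact: kfun_bmeas1. Qed.

Lemma bmeas_iter_Qh k f : bmeas f -> bmeas (iter k Qh f).
Proof. by move=> bf; elim: k => //= k IH; exact: bmeas_Qh. Qed.

Lemma bmeas_iter_kfun k f : bmeas f -> bmeas (iter k (kfun M) f).
Proof. by move=> bf; elim: k => //= k IH; exact: kfun_bmeas1. Qed.

Lemma phi_iter (F : nat -> E -> R) n p : (forall m, bmeas (F m)) -> (p <= n)%N ->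
  phi X F n p = iter (n - p) Qh (F n).
Proof.
move=> bF pn; rewrite /phi.
suff H k q : bwd X F k q = iter k Qh (F (k + q)%N) by rewrite H subnK.
elim: k q => [//|k IH] q /=; rewrite IH addnS.
apply/funext => x; rewrite QopE; last exact: bmeas_iter_Qh.
by rewrite potE mutE.
Qed.

Definition H j : E -> R := iter j Qh (fun=> 1).

Lemma phi_ones_iter n p : (p <= n)%N -> phi X ones n p = H (n - p).
Proof. by move=> pn; rewrite phi_iter// => m; exact: bmeas_cst. Qed.

Lemma bmeas_H j : bmeas (H j).
Proof. by apply: bmeas_iter_Qh; exact: bmeas_cst. Qed.

Lemma Qh_le f g x : bmeas f -> bmeas g -> (forall y, f y <= g y) -> Qh f x <= Qh g x.
Proof. by move=> bf bg fg; rewrite ler_wpM2l ?(ltW (G0 x))//; exact: rint_le. Qed.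

Lemma iter_Qh_le k f g x : bmeas f -> bmeas g -> (forall y, f y <= g y) ->
  iter k Qh f x <= iter k Qh g x.
Proof.
by move=> bf bg fg; elim: k x => //= k IH x; apply: Qh_le => //; exact: bmeas_iter_Qh.
Qed.

Lemma iter_Qh_comb k (f g : E -> R) (a c : R) x : bmeas f -> bmeas g ->
  iter k Qh (fun y => a * f y + c * g y) x = a * iter k Qh f x + c * iter k Qh g x.
Proof.
move=> bf bg; elim: k x => //= k IH x; have bif := bmeas_iter_Qh k bf.
have big := bmeas_iter_Qh k bg.
have -> : iter k Qh (fun y => a * f y + c * g y) =
    fun y => a * iter k Qh f y + c * iter k Qh g y by exact/funext.
by rewrite /Qh /kfun rintD ?rintZ//; [ring|exact: bmeasZ|exact: bmeasZ].
Qed.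

Lemma iter_QhZ k (f : E -> R) (a : R) x : bmeas f ->
  iter k Qh (fun y => a * f y) x = a * iter k Qh f x.
Proof.
move=> bf; have := iter_Qh_comb k a 0 x bf bf; rewrite mul0r addr0 => <-.
by congr (iter k Qh _ x); apply/funext => y; rewrite mul0r addr0.
Qed.

Lemma iter_Qh_ge0 k f x : bmeas f -> (forall y, 0 <= f y) -> 0 <= iter k Qh f x.
Proof.
move=> bf f0; have <- : iter k Qh (fun y => 0 * f y) x = 0 by rewrite iter_QhZ// mul0r.
by apply: iter_Qh_le => // [|y]; [exact: bmeasZ|rewrite mul0r].
Qed.

Lemma H_gt0 j x : 0 < H j x.
Proof.
have := phi_ones_gt0 X j (x : (fun=> E) 0%N).
by rewrite phi_ones_iter// subn0.
Qed.

Lemma H_bounds (gl gu : R) j x : 0 <= gl -> (forall y, gl <= G y <= gu) ->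
  gl ^+ j <= H j x <= gu ^+ j.
Proof.
move=> gl0 HG; have gu0 : 0 <= gu by have /andP[a b] := HG x; lra.
elim: j x => [|j IH] x; first by rewrite !expr0 /H/= lexx.
rewrite /H iterS -/(H j) !exprS /Qh; have /andP[a b] := HG x.
have bc (c : R) : kfun M (fun=> c) x = c by rewrite /kfun rint_cst mass_pker ?mulr1.
have K0 : 0 <= kfun M (H j) x by apply: kfun_ge0 => y; exact/ltW/H_gt0.
have bH := bmeas_H j.
apply/andP; split; apply: ler_pM => //; try exact: exprn_ge0.
- by rewrite -[leLHS]bc; apply: rint_le => // [|y]; [exact: bmeas_cst|case/andP: (IH y)].
- exact/ltW/G0.
- by rewrite -[leRHS]bc; apply: rint_le => // [|y]; [exact: bmeas_cst|case/andP: (IH y)].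
Qed.

(** [H j.+1] is [Q^j(G)], and [G] is at least [c]. *)
Lemma H_ratio (c : R) j : (forall y, c <= G y) -> forall x, c * H j x <= H j.+1 x.
Proof.
move=> cG x; have b1 := @bmeas_cst R _ E 1.
rewrite /H iterSr -iter_QhZ//; apply: iter_Qh_le => //; first exact: bmeasZ.
  exact: bmeas_Qh.
by move=> y; rewrite /Qh /kfun rint_cst mass_pker ?mulr1.
Qed.

Lemma rint_kpow k x f : bmeas f -> (kpow M k x setT < +oo)%E /\
  \int[kpow M k x]_y f y = iter k (kfun M) f x.
Proof.
elim: k f => [|k IH] f bf.
  by split; [rewrite /= diracT ltry|rewrite /= rint_dirac//; case: bf].
have [fk _] := IH f bf; split.
  exact: (kpush_finite (fun y => pker_le M1 y) fk).
rewrite /= (rint_kpush (fun y => pker_le M1 y))//.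
by have [_ ->] := IH (kfun M f) (kfun_bmeas1 M1 bf); rewrite -iterSr.
Qed.

Section mixing.
Variables (k : nat) (eps gl gu : R).
Hypotheses (k0 : (0 < k)%N) (eps0 : 0 < eps) (gl0 : 0 < gl).
Hypothesis HG : forall y, gl <= G y <= gu.
Hypothesis mix : forall (x y : E) (A : set E), measurable A ->
  (eps%:E * kpow M k y A <= kpow M k x A)%E.

Let glgu : gl <= gu. Proof. by have /andP[a b] := HG point; lra. Qed.
Let gu0 : 0 < gu. Proof. exact: lt_le_trans glgu. Qed.

Lemma mixing_kfun f x y : bmeas f -> (forall z, 0 <= f z) ->
  eps * iter k (kfun M) f y <= iter k (kfun M) f x.
Proof.
move=> bf f0; have [fx <-] := rint_kpow k x bf; have [fy <-] := rint_kpow k y bf.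
rewrite -lee_fin EFinM !rint_EFin//.
apply: ge0_integral_domination => //.
- by move=> A mA; exact: mix.
- by apply/measurable_EFinP; case: bf.
Qed.

Lemma mixing_rate_le1 : eps <= 1.
Proof.
have b1 := @bmeas_cst R _ E 1.
have := mixing_kfun point point b1 (fun=> ler01).
have -> : iter k (kfun M) (fun=> 1) = (fun=> 1).
  elim: (k) => //= j ->; apply/funext => x.
  by rewrite /kfun rint_cst mass_pker ?mulr1.
by rewrite mulr1.
Qed.

Lemma iter_Qh_kfun j f x : bmeas f -> (forall z, 0 <= f z) ->
  gl ^+ j * iter j (kfun M) f x <= iter j Qh f x <= gu ^+ j * iter j (kfun M) f x.
Proof.
move=> bf f0; elim: j x => [|j IH] x; first by rewrite !expr0 !mul1r lexx.
have bi := bmeas_iter_Qh j bf; have bk := bmeas_iter_kfun j bf.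
have k0' z : 0 <= iter j (kfun M) f z.
  by elim: (j) z => //= i IHi z; apply: kfun_ge0.
have /andP[a b] := HG x; rewrite !iterS /Qh !exprS -!mulrA.
have Z c : c * kfun M (iter j (kfun M) f) x = kfun M (fun z => c * iter j (kfun M) f z) x.
  by rewrite /kfun rintZ.
rewrite !Z; apply/andP; split; apply: ler_pM => //.
- exact: ltW.
- by apply: kfun_ge0 => z; rewrite mulr_ge0// exprn_ge0// ltW.
- by apply: rint_le => // [|z]; [exact: bmeasZ|case/andP: (IH z)].
- exact/ltW/G0.
- by apply: kfun_ge0 => z; exact: iter_Qh_ge0.
- by apply: rint_le => // [|z]; [exact: bmeasZ|case/andP: (IH z)].
Qed.

(** The mixing constant that [Q^k] inherits from [M^k]: replacing each of the [k] potentials by its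
    bounds costs a factor [gl / gu]. *)
Definition delta : R := eps * (gl / gu) ^+ k.

Lemma delta_gt0 : 0 < delta.
Proof. by rewrite mulr_gt0// exprn_gt0// divr_gt0. Qed.

Lemma delta_le1 : delta <= 1.
Proof.
rewrite /delta -[leRHS]mulr1; apply: ler_pM => //; first exact: ltW.
- by rewrite exprn_ge0// divr_ge0// ltW.
- exact: mixing_rate_le1.
- by rewrite exprn_ile1 ?divr_ge0// ?(ltW gl0) ?(ltW gu0)// ler_pdivrMr// mul1r.
Qed.

Lemma mixing_Qh f x y : bmeas f -> (forall z, 0 <= f z) ->
  delta * iter k Qh f y <= iter k Qh f x.
Proof.
move=> bf f0; have /andP[a _] := iter_Qh_kfun k x bf f0.
have /andP[_ b] := iter_Qh_kfun k y bf f0.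
apply: le_trans a; apply: (@le_trans _ _ (gl ^+ k * (eps * iter k (kfun M) f y))).
  have -> : delta * iter k Qh f y = gl ^+ k * (eps * (iter k Qh f y / gu ^+ k)).
    by rewrite /delta expr_div_n; field; rewrite expf_neq0// gt_eqF.
  rewrite ler_wpM2l ?exprn_ge0 ?(ltW gl0)// ler_wpM2l ?(ltW eps0)//.
  by rewrite ler_pdivrMr ?exprn_gt0// mulrC.
by rewrite ler_wpM2l ?exprn_ge0 ?(ltW gl0)// mixing_kfun.
Qed.

(** For [j >= k], mixing of the first [k] transitions is enough. For [j < k] there is no full block,
    but the bounds on [G] give the ratio [(gl / gu)^j], which is at least [delta]. *)
Lemma H_harnack j x y : H j x <= delta^-1 * H j y.
Proof.
have d0 := delta_gt0; rewrite ler_pdivlMl//.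
have [kj|jk] := leqP k j.
  rewrite -(subnKC kj) /H iterD; apply: mixing_Qh; first exact: bmeas_H.
  by move=> z; exact/ltW/H_gt0.
have /andP[_ a] := H_bounds j x (ltW gl0) HG.
have /andP[b _] := H_bounds j y (ltW gl0) HG.
apply: le_trans b; apply: (@le_trans _ _ ((gl / gu) ^+ j * gu ^+ j)); last first.
  by rewrite expr_div_n divfK// expf_neq0// gt_eqF.
apply: ler_pM => //; [exact: ltW|exact/ltW/H_gt0|].
have r0 : 0 <= gl / gu by rewrite divr_ge0// ltW.
have r1 : gl / gu <= 1 by rewrite ler_pdivrMr// mul1r.
apply: (@le_trans _ _ (1 * (gl / gu) ^+ k)).
  by rewrite ler_wpM2r ?exprn_ge0// mixing_rate_le1.
by rewrite mul1r ler_wiXn2l// ltnW.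
Qed.

Lemma qpn_harnack p n : (p <= n)%N -> qpn X p n <= delta^-1.
Proof. by move=> pn; apply: qpn_le => x y; rewrite phi_ones_iter//; exact: H_harnack. Qed.

(** One factor [delta] comes from mixing of [Q^k], the other from comparing the normalizations at
    two points by [H_harnack]. *)
Definition rho : R := 1 - delta ^+ 2.

Lemma rho_range : 0 <= rho < 1.
Proof.
have d0 := delta_gt0; have d1 := delta_le1.
by rewrite /rho subr_ge0 exprn_ile1 ?(ltW d0)//= gtrBl exprn_gt0.
Qed.

(** Contraction over [k] steps: [b - P f] is nonnegative for [b] an upper bound of
    [P f], so mixing compares its averages at two points; letting [b] decrease to
    the best bound is done by averaging over [z]. *)
Lemma oscillation_contracts i (u : E -> R) (c : R) : bmeas u ->
  (forall x y, `|u x / H i x - u y / H i y| <= c) ->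
  forall x y, `|iter k Qh u x / H (k + i) x - iter k Qh u y / H (k + i) y| <= rho * c.
Proof.
move=> bu Hc.
suff one x y : iter k Qh u x / H (k + i) x - iter k Qh u y / H (k + i) y <= rho * c.
  move=> x y; rewrite ler_norml; apply/andP; split; last exact: one.
  by have := one y x; lra.
have hx := H_gt0 (k + i) x; have hy := H_gt0 (k + i) y.
set Ax := iter k Qh u x / _; set Ay := iter k Qh u y / _.
have ux : iter k Qh u x = Ax * H (k + i) x by rewrite divfK// gt_eqF.
have uy : iter k Qh u y = Ay * H (k + i) y by rewrite divfK// gt_eqF.
have HE : iter k Qh (H i) = H (k + i) by rewrite /H iterD.
have bH := bmeas_H i; have d0 := delta_gt0.
have key z : Ax - Ay <= rho * (u z / H i z + c - Ay).
  set b := u z / H i z + c.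
  have pos v : 0 <= b * H i v + (-1) * u v.
    have := Hc v z; rewrite ler_norml => /andP[_ h].
    have : u v / H i v <= b by rewrite /b; lra.
    by rewrite ler_pdivrMr ?H_gt0//; lra.
  have bp : bmeas (fun v => b * H i v + (-1) * u v) by apply: bmeasD; exact: bmeasZ.
  have := mixing_Qh x y bp pos; rewrite !iter_Qh_comb// HE ux uy => h.
  have bA : 0 <= b - Ax.
    have := iter_Qh_ge0 k x bp pos; rewrite iter_Qh_comb// HE ux => h1.
    by rewrite -(pmulr_lge0 _ hx); lra.
  have har := ler_wpM2l bA (H_harnack (k + i) x y).
  have : delta * (b - Ay) * H (k + i) y <= (b - Ax) * delta^-1 * H (k + i) y.
    by rewrite -[leRHS]mulrA; apply: le_trans har; lra.
  rewrite ler_pM2r// ler_pdivlMr// /rho expr2; lra.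
(* [key] is multiplied by [H i v] and integrated by [Q^k] at [y], where the average of [u / H i] is
   [Ay]; this cancels the subtracted [Ay] and leaves [rho * c]. *)
have bp : bmeas (fun v => rho * u v + (rho * (c - Ay) - (Ax - Ay)) * H i v).
  by apply: bmeasD; exact: bmeasZ.
have pos v : 0 <= rho * u v + (rho * (c - Ay) - (Ax - Ay)) * H i v.
  have hv := H_gt0 i v; have := key v.
  have uv : u v = (u v / H i v) * H i v by rewrite divfK// gt_eqF.
  rewrite [in X in _ -> X]uv mulrA -mulrDl; set t := u v / _ => h.
  by rewrite mulr_ge0 ?(ltW hv)//; lra.
have := iter_Qh_ge0 k y bp pos; rewrite iter_Qh_comb// HE uy mulrA -mulrDl.
by rewrite pmulr_lge0//; lra.
Qed.

Lemma oscillation_decay j (f : E -> R) : bmeas f -> (forall x y, `|f x - f y| <= 1) ->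
  forall x y, `|iter j Qh f x / H j x - iter j Qh f y / H j y| <= rho ^+ (j %/ k).
Proof.
move=> bf Hf; have /andP[r0 r1] := rho_range.
have base i x y : `|iter i Qh f x / H i x - iter i Qh f y / H i y| <= 1.
  pose F (n : nat) := f.
  have bF n : bmeas (F n) by [].
  have oF n : @Osc1 R _ ((fun=> E) n) (F n).
    by apply/(@Osc1P R (fun=> d) (fun=> E) n); split => //; case: bf.
  have := @Pnorm_osc1 R (fun=> d) (fun=> E) X F i 0 x y oF (leq0n i).
  by rewrite /Pnorm phi_iter// phi_ones_iter// subn0.
elim/ltn_ind: j => j IH x y.
have [jk|kj] := ltnP j k; first by rewrite divn_small// expr0.
have -> : (j %/ k = ((j - k) %/ k).+1)%N.
  by rewrite -{1}(subnK kj) divnDr ?dvdnn// divnn k0 addn1.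
rewrite -{1 2 3 4}(subnKC kj) !iterD exprS.
apply: oscillation_contracts; first exact: bmeas_iter_Qh.
by apply: IH; rewrite ltn_subrL k0 (leq_trans k0 kj).
Qed.

Lemma betaP_decay p n : (p <= n)%N -> betaP X p n <= rho ^+ ((n - p) %/ k).
Proof.
move=> pn; apply: betaP_le => F x y oF.
have bF m : bmeas (F m) := @Osc1_bmeas R (fun=> d) (fun=> E) m _ (oF m).
rewrite /Pnorm phi_iter// phi_ones_iter//; apply: oscillation_decay => //.
by have /(@Osc1P R (fun=> d) (fun=> E) n)[_] := oF n.
Qed.

(** * Uniform bounds on [b_n] in the three cases for [G] *)

Let e j : R := rho ^+ (j %/ k).
Let S : R := k%:R / (1 - rho).

Let e_ge0 j : 0 <= e j.
Proof. by have /andP[r0 _] := rho_range; exact: exprn_ge0. Qed.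

Let e_sum n : \sum_(0 <= j < n) e j <= S.
Proof. exact: block_geometric_bound rho_range k0. Qed.

Let S_ge0 : 0 <= S.
Proof. by apply: le_trans (e_sum 0); rewrite big_geq. Qed.

Let c j : R := \int[mu]_x H j x.

Let c_ge0 j : 0 <= c j.
Proof. by apply: Rintegral_ge0 => x _; exact/ltW/H_gt0. Qed.

Let cpn_c q n : (0 < q <= n)%N -> cpn X q n = c (n - q).
Proof.
case: q => [//|q] /andP[_ qn]; rewrite /cpn srcE; apply: eq_Rintegral => x _.
by rewrite Qone_phi phi_ones_iter.
Qed.

Let csum_c p n : (p <= n)%N -> csum X p n = \sum_(0 <= j < n - p) c j.
Proof.
move=> pn; rewrite -(sum_rev c pn); apply: eq_big_nat => q /andP[pq qn].
by rewrite cpn_c// (leq_ltn_trans (leq0n p) pq).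
Qed.

Let cbeta_c p n : (p <= n)%N -> cbeta X p n <= \sum_(0 <= j < n - p) c j * e j.
Proof.
move=> pn; rewrite -(sum_rev (fun j => c j * e j) pn) /cbeta big_nat [leRHS]big_nat.
apply: ler_sum => q /andP[pq qn]; rewrite ltnS in qn.
rewrite cpn_c ?(leq_ltn_trans (leq0n p) pq)//.
by rewrite ler_wpM2l// betaP_decay.
Qed.

(** The part of the [p]-th term of [bsharp] due to the sources, without the factor [qpn]. *)
Let T p n : R := min1m X p n * (cbeta X p n / (low_mass X p n + csum X p n)).

Let ratio_ge0 p n : 0 <= cbeta X p n / (low_mass X p n + csum X p n).
Proof. by rewrite divr_ge0 ?cbeta_ge0// addr_ge0 ?low_mass_ge0 ?csum_ge0. Qed.

Let T_ge0 p n : 0 <= T p n.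
Proof. by rewrite mulr_ge0 ?min1m_ge0. Qed.

Let T_le p n : T p n <= cbeta X p n / (low_mass X p n + csum X p n).
Proof. by rewrite -[leRHS]mul1r ler_wpM2r ?min1m_le1. Qed.

Let rev_sum (a : nat -> R) n : \sum_(0 <= p < n) a (n - p.+1)%N = \sum_(0 <= j < n) a j.
Proof. by rewrite [RHS]big_nat_rev/=; under [RHS]eq_bigr do rewrite add0n. Qed.

(** [H_harnack] bounds [qpn], and the terms [betaP] are summable by mixing; at [p = n] no source
    remains, so the sum of [T] runs over [p < n]. *)
Let bsharp_bounded (B : R) n : \sum_(0 <= p < n) T p n <= B ->
  bsharp X n <= delta^-1 * (S + B).
Proof.
move=> TB; have d0 := delta_gt0.
apply: (@le_trans _ _ (\sum_(0 <= p < n.+1) delta^-1 * (e (n - p) + T p n))).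
  rewrite /bsharp big_nat [leRHS]big_nat; apply: ler_sum => p /andP[_ pn].
  rewrite ltnS in pn; have m0 := min1m_ge0 X p n; have m1 := min1m_le1 X p n.
  have b0 := betaP_ge0 X pn.
  rewrite [min1m _ _ _ * _]mulrC -mulrA; apply: ler_pM.
  - by rewrite ltW// qpn_gt0.
  - by rewrite mulr_ge0// addr_ge0.
  - exact: qpn_harnack.
  - rewrite mulrDr lerD2r; apply: le_trans (betaP_decay pn).
    by rewrite ler_piMl.
rewrite -mulr_sumr ler_wpM2l ?invr_ge0 ?(ltW d0)// big_split/= lerD//.
  by rewrite (rev_sum e n.+1) e_sum.
rewrite big_nat_recr//= {2}/T.
by rewrite (_ : cbeta X n n = 0) ?mul0r ?mulr0 ?addr0// /cbeta big_geq.
Qed.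

Let c0_mass : c 0 = mass mu.
Proof. by rewrite /c /H rint_cst mul1r. Qed.

Let c_null j : mass mu = 0 -> c j = 0.
Proof.
move=> m0; apply: le_anti; rewrite c_ge0 andbT.
have [bm [C HC]] := bmeas_H j; have := rint_norm_le fmu (bmeas_H j) HC.
by rewrite m0 mulr0; apply: le_trans; exact: ler_norm.
Qed.

Let T_null p n : (p <= n)%N -> mass mu = 0 -> T p n = 0.
Proof.
move=> pn m0; rewrite /T (_ : cbeta X p n = 0) ?mul0r ?mulr0//.
apply: le_anti; rewrite cbeta_ge0 andbT; apply: (le_trans (cbeta_c pn)).
by rewrite big1// => j _; rewrite c_null// mul0r.
Qed.

(** Here all [H j] are 1, and [low_mass + csum] is at least the total mass [D] at time [n], whatever
    [p]. Each term is at most [mass mu * S / D], and [D] exceeds [n] times [mass mu], so the [n]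
    terms sum to at most [S]. Without [low_mass] the denominator would shrink as [p] approaches
    [n]. *)
Let T_neutral n : G = cst 1 -> \sum_(0 <= p < n) T p n <= S.
Proof.
move=> G1; have H1 j x : H j x = 1.
  have := @H_bounds 1 1 j x ler01; rewrite !expr1n => h.
  by apply: le_anti; rewrite andbC; apply: h => y; rewrite G1 lexx.
have m0 : 0 < mass (source X 0) := mass_source0_gt0 X.
have M0 := mass_ge0 mu; pose D := mass (source X 0) + n%:R * mass mu.
have D0 : 0 < D by rewrite ltr_pwDl ?mulr_ge0.
have cE j : c j = mass mu.
  by rewrite /c; under eq_Rintegral do rewrite H1; rewrite rint_cst mul1r.
have TD p : (p < n)%N -> T p n <= mass mu * S / D.
  move=> pn; apply: (le_trans (T_le p n)).
  have lowD : D <= low_mass X p n + csum X p n.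
    have -> : csum X p n = (n - p)%:R * mass mu.
      rewrite (csum_c (ltnW pn)); under eq_bigr do rewrite cE.
      by rewrite sumr_const_nat subn0 mulr_natl.
    have -> : D = (mass (source X 0) + p%:R * mass mu) + (n - p)%:R * mass mu.
      by rewrite -addrA -mulrDl -natrD subnKC// ltnW.
    rewrite lerD2r /low_mass -[leLHS]mulr1; apply: ler_pM => //.
    - by rewrite addr_ge0 ?mulr_ge0 ?mass_ge0.
    - rewrite /mminus big_nat_recl//= subn0.
      have gm : forall i, gminus X p ^+ (p - i) = 1.
        (* For [p = 0], [gminus] is the infimum of the empty set, but its exponent is then 0. *)
        move=> i; case: (p) => [|p']; first by rewrite expr0.
        rewrite (_ : gminus X p'.+1 = 1) ?expr1n//.
        rewrite /gminus (_ : [set g | _] = [set 1]) ?inf1//.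
        apply/seteqP; split => g /=.
          by move=> [q [x [_ ->]]]; rewrite potE G1.
        by move=> ->; exists 0%N, point; split => //; rewrite potE G1.
      have gm0 := gm 0%N; rewrite subn0 in gm0; rewrite gm0 mulr1 lerD2l.
      under eq_bigr do rewrite gm mulr1 srcE.
      by rewrite sumr_const_nat subn0 mulr_natl.
    - rewrite ler_pdivlMr ?qpn_gt0// mul1r; apply: (@le_trans _ _ 1).
        by apply: qpn_le => x y; rewrite phi_ones_iter ?(ltnW pn)// !H1 mulr1.
      by have := Qnorm_ge X n (point : (fun=> E) p); rewrite phi_ones_iter ?(ltnW pn)// H1.
  have l0 : 0 < low_mass X p n + csum X p n by exact: lt_le_trans lowD.
  apply: ler_pM; rewrite ?cbeta_ge0 ?invr_ge0 ?(ltW l0)//.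
    apply: (le_trans (cbeta_c (ltnW pn))).
    under eq_bigr do rewrite cE.
    by rewrite -mulr_sumr ler_wpM2l.
  by rewrite lef_pV2.
apply: (@le_trans _ _ (\sum_(0 <= p < n) mass mu * S / D)).
  by rewrite big_nat [leRHS]big_nat; apply: ler_sum => p /andP[_ pn]; exact: TD.
rewrite sumr_const_nat subn0 -[leLHS]mulr_natl mulrA ler_pdivrMr//.
by rewrite mulrA mulrC ler_wpM2l// lerDr ltW.
Qed.

(** The factor [min1m] decays geometrically: [Qnorm] is at most [g^(n - p)], [mplus] stays bounded
    by a geometric series, and [csum] is at least the mass of the last source. With no source after
    time 0, [T] vanishes. *)
Let T_subcritical (g : R) n : 0 < g < 1 -> (forall x, G x <= g) ->
  \sum_(0 <= p < n) T p n <=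
  (mass (source X 0) + mass mu) / (1 - g) / mass mu * (1 - g)^-1.
Proof.
move=> /andP[g0 g1] Gg; have m0 : 0 < mass (source X 0) := mass_source0_gt0 X.
have M0 := mass_ge0 mu; have g1' : 0 < 1 - g by lra.
have g01 : 0 <= g < 1 by rewrite (ltW g0) g1.
set C := (_ / mass mu).
have C0 : 0 <= C by rewrite !divr_ge0// ?(ltW g1')// addr_ge0// ltW.
have TD p : (p < n)%N -> T p n <= C * g ^+ (n - p).
  move=> pn; have [mz|mz] := eqVneq (mass mu) 0.
    by rewrite T_null ?(ltnW pn)// mulr_ge0// exprn_ge0// ltW.
  have mp : 0 < mass mu by rewrite lt0r mz.
  have cs : mass mu <= csum X p n.
    rewrite (csum_c (ltnW pn)) -c0_mass.
    have -> : (n - p = (n - p).-1.+1)%N by rewrite prednK// subn_gt0.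
    by rewrite big_nat_recl//= lerDl sumr_ge0.
  have cp : 0 < csum X p n by exact: lt_le_trans cs.
  have T1 : T p n <= min1m X p n.
    rewrite -[leRHS]mulr1 ler_wpM2l ?min1m_ge0//.
    rewrite ler_pdivrMr ?mul1r; last by rewrite ltr_wpDl ?low_mass_ge0.
    by rewrite (le_trans (cbeta_le X p n))// lerDr low_mass_ge0.
  apply: (le_trans T1); rewrite /min1m gt_eqF// ge_min; apply/orP; right.
  rewrite /mpn /C [leRHS]mulrAC; apply: ler_pM.
  - by apply: mulr_ge0; apply: ltW; [exact: mplus_gt0|exact: Qnorm_gt0].
  - by rewrite invr_ge0 ltW.
  - apply: ler_pM.
    + exact/ltW/mplus_gt0.
    + exact/ltW/Qnorm_gt0.
    + have gp : 0 <= gplus X p <= g.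
        case: (p) => [|p'].
          rewrite /gplus (_ : [set g | _] = set0) ?sup0 ?lexx ?(ltW g0)//.
          by apply/seteqP; split => // y [q [x [/=]]]; rewrite ltn0.
        have h0 := @pot_ge0 R (fun=> d) (fun=> E) X 0 point.
        have h1 := @pot_le_gplus R (fun=> d) (fun=> E) X p'.+1 0 point (ltn0Sn p').
        rewrite (le_trans h0 h1)/=.
        apply: ge_sup; first by exists (pot X 0 point), 0%N, point.
        by move=> _ [q [x [_ ->]]]; rewrite potE.
      have /andP[gp0 gpg] := gp.
      apply: (@le_trans _ _ (\sum_(0 <= q < p.+1)
          (mass (source X 0) + mass mu) * g ^+ (p - q))).
        apply: ler_sum => q _; apply: ler_pM; rewrite ?mass_ge0 ?exprn_ge0//.
          by case: q => [|q]; [rewrite lerDl|rewrite srcE lerDr ltW].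
        by rewrite lerXn2r// nnegrE// ltW.
      rewrite -mulr_sumr ler_wpM2l ?addr_ge0 ?(ltW m0)//.
      by rewrite (rev_sum (fun j => g ^+ j) p.+1) geometric_bound.
    + apply: Qnorm_le => x; rewrite phi_ones_iter ?(ltnW pn)//.
      have := @H_bounds 0 g (n - p) x (lexx 0) _.
      by move=> /(_ (fun y => _))/andP[]// y; rewrite ltW//=.
  - by rewrite lef_pV2.
apply: (@le_trans _ _ (\sum_(0 <= p < n) C * g ^+ (n - p))).
  by rewrite big_nat [leRHS]big_nat; apply: ler_sum => p /andP[_ pn]; exact: TD.
rewrite -mulr_sumr ler_wpM2l//.
apply: (@le_trans _ _ (\sum_(0 <= p < n.+1) g ^+ (n.+1 - p.+1))).
  by rewrite big_nat_recr//= lerDl exprn_ge0// ltW.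
by rewrite (rev_sum (fun j => g ^+ j) n.+1) geometric_bound.
Qed.

(** [Nm / C] is the mean of the decaying sequence [e] under the weights [c j], which grow at least
    by the factor [g] at each step. Hence [C J <= g^-1 * C J.+1], and the ratio obeys a recursion
    with contraction [g^-1] and the summable input [e]. *)
Let T_supercritical (g : R) n : 1 < g -> (forall x, g <= G x) ->
  \sum_(0 <= p < n) T p n <= S / (1 - g^-1).
Proof.
move=> g1 gG; have g0 : 0 < g by lra.
have gi : 0 <= g^-1 < 1 by rewrite invr_ge0 (ltW g0) invf_lt1.
pose C J := \sum_(0 <= j < J.+1) c j; pose Nm J := \sum_(0 <= j < J.+1) c j * e j.
have C0 J : 0 <= C J by apply: sumr_ge0.
have N0 J : 0 <= Nm J by apply: sumr_ge0 => j _; rewrite mulr_ge0.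
have Ta p : (p < n)%N -> T p n <= Nm (n - p.+1)%N / C (n - p.+1)%N.
  move=> pn; apply: (le_trans (T_le p n)).
  have h := @cbeta_ratio_le R (fun=> d) (fun=> E) X p n _ (low_mass_ge0 X p n).
  apply: (le_trans h).
  have np : (n - p = (n - p.+1).+1)%N by rewrite -subSn// subSS.
  rewrite (csum_c (ltnW pn)) np; apply: ler_wpM2r; first by rewrite invr_ge0 sumr_ge0.
  by have := cbeta_c (ltnW pn); rewrite np.
apply: (@le_trans _ _ (\sum_(0 <= p < n) Nm (n - p.+1)%N / C (n - p.+1)%N)).
  by rewrite big_nat [leRHS]big_nat; apply: ler_sum => p /andP[_ pn]; exact: Ta.
rewrite (rev_sum (fun J => Nm J / C J) n).
apply: (@discounted_sum_bound _ _ (fun J => Nm J / C J) e) => //.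
- by move=> J; rewrite divr_ge0.
- move=> J; have [mz|mz] := eqVneq (mass mu) 0.
    have -> : Nm J.+1 = 0 by rewrite /Nm big1// => j _; rewrite c_null// mul0r.
    rewrite mul0r; apply: addr_ge0 => //.
    by apply: mulr_ge0; [case/andP: gi|exact: divr_ge0].
  have mp : 0 < mass mu by rewrite lt0r mz mass_ge0.
  have CP i : 0 < C i.
    by rewrite /C big_nat_recl//= c0_mass ltr_pwDl ?sumr_ge0.
  have CS : g * C J <= C J.+1.
    rewrite /C [leRHS]big_nat_recl//= -[leLHS]add0r lerD// mulr_sumr.
    apply: ler_sum => j _; rewrite /c -rintZ//; last exact: bmeas_H.
    by apply: rint_le => //; [apply: bmeasZ; exact: bmeas_H|exact: bmeas_H|exact: H_ratio].
  rewrite /Nm big_nat_recr//= -/(Nm J) mulrDl; apply: lerD.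
    rewrite mulrCA ler_wpM2l// -invfM lef_pV2 ?posrE ?mulr_gt0//.
  rewrite mulrAC ler_piMl// ler_pdivrMr// mul1r /C big_nat_recr//= lerDr.
  exact: C0.
- rewrite /Nm /C !big_nat1; have [->|cn] := eqVneq (c 0) 0; first by rewrite !mul0r.
  by rewrite mulrC mulrA mulVf// mul1r.
Qed.

Lemma bsharp_uniform : [\/ G = cst 1, sup (range G) < 1 | 1 < inf (range G)] ->
  exists B : R, forall n, bsharp X n <= B.
Proof.
have ubG : has_ubound (range G).
  by exists gu => _ [x _ <-]; case/andP: (HG x).
have lbG : has_lbound (range G).
  by exists gl => _ [x _ <-]; case/andP: (HG x).
case=> [G1|Gsup|Ginf].
- by eexists => n; exact/bsharp_bounded/T_neutral.
- have Gg x : G x <= sup (range G) by apply: ub_le_sup => //; exists x.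
  have g0 : 0 < sup (range G) < 1 by rewrite Gsup andbT (lt_le_trans (G0 point)).
  by eexists => n; exact/bsharp_bounded/(T_subcritical n g0 Gg).
- have Gg x : inf (range G) <= G x by apply: ge_inf => //; exists x.
  by eexists => n; exact/bsharp_bounded/(T_supercritical n Ginf Gg).
Qed.

End mixing.
End homogeneous_model.

(** * Assembly of the estimates *)

Lemma Lr_constants_bsharp (R : realType) (d : nat -> measure_display)
    (E : forall n, measurableType (d n)) (X : model R E) (K : kernel_family R E) :
  McKean X K -> Lr_constants X K (fun r => 32 * expR 1 * r) (bsharp X).
Proof.
move=> mcK; split; first by move=> n; rewrite bsharp_ge0 bsharp_le.
move=> r r1 n N d' Om P xi f N0 ps of1; exact: (Lr_bound mcK N0 ps of1 r1).
Qed.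

Lemma massN_relative_variance (R : realType) (d : nat -> measure_display)
    (E : forall n, measurableType (d n)) (X : model R E) (K : kernel_family R E)
    (qs : R) :
  McKean X K -> (forall p n, (p <= n)%N -> qpn X p n <= qs) ->
  forall (n N : nat) (d' : measure_display) (Omega : measurableType d')
    (P : probability Omega R) (xi : forall n, Omega -> N.-tuple (E n)),
  (1 < N)%N -> particle_system X K P xi ->
  ('E_P[(fun w => (massN X (xi ^~ w) n / mass (gamma X n) - 1) ^+ 2)%R]
     <= (64 * expR 1 * qs ^+ 2 * (n.+1%:R / N.-1%:R) *
         (1 + 64 * expR 1 * qs ^+ 2 / N.-1%:R) ^+ n.-1)%:E)%E.
Proof.
move=> mcK Hq n N d' Om P xi N1 ps; have N0 : (0 < N)%N := ltnW N1.
set c := 64 * expR 1 * qs ^+ 2.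
have c0 : 0 <= c by apply: mulr_ge0; [rewrite mulr_ge0 ?expR_ge0|exact: sqr_ge0].
pose v m := \int[P]_w (massN X (xi ^~ w) m / mass (gamma X m) - 1) ^+ 2.
have bm m : bmeas (fun w => massN X (xi ^~ w) m).
  exact: (past_bmeas ps (past_massN X xi N0 m)).
have bmG : bmeas (fun w => massN X (xi ^~ w) n / mass (gamma X n) - 1).
  by apply: bmeasB; [apply: bmeasM|exact: bmeas_cst] => //; exact: bmeas_cst.
rewrite expectation_rint; last exact: (bmeasM bmG bmG).
rewrite lee_fin -/(v n); pose x := c / N%:R.
have NR : (0 : R) < N%:R by rewrite ltr0n.
have N1R : (0 : R) < N.-1%:R by rewrite ltr0n -subn1 subn_gt0.
have x0 : 0 <= x by rewrite divr_ge0// ltW.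
have xN : x <= c / N.-1%:R.
  by rewrite ler_wpM2l// lef_pV2// ler_nat leq_pred.
have Hv m : v m <= x * \sum_(0 <= p < m) (1 + v p).
  rewrite /x /c; apply: (le_trans (massN_relative_variance_rec mcK N0 ps _)).
    by move=> p pm; exact/Hq/ltnW.
  rewrite ler_wpM2l//; apply: ler_sum => p _.
  by rewrite (massN_second_moment mcK N0 ps).
(* The bound obtained has [n] and [N]; it is weakened to [n.+1] and [N.-1]. *)
apply: (le_trans (discrete_gronwall x0 Hv n)).
have -> : c * (n.+1%:R / N.-1%:R) * (1 + c / N.-1%:R) ^+ n.-1 =
   c / N.-1%:R * (n.+1%:R * (1 + c / N.-1%:R) ^+ n.-1) by ring.
apply: ler_pM => //.
  by rewrite mulr_ge0// exprn_ge0// addr_ge0.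
apply: ler_pM => //; first by rewrite exprn_ge0// addr_ge0.
  by rewrite ler_nat.
by rewrite lerXn2r ?nnegrE ?lerD2l// addr_ge0// (le_trans x0).
Qed.

Theorem theorem3p2 (R : realType) :
  exists a : R -> R,
    (forall (d : nat -> measure_display) (E : forall n, measurableType (d n))
        (X : model R E) (K : kernel_family R E),
      McKean X K ->
      [/\ (* (a) *)
          (forall n, mminus X n <= mass (gamma X n) <= mplus X n) /\
          (forall (n N : nat) (d' : measure_display) (Omega : measurableType d')
              (P : probability Omega R)
              (xi : forall n, Omega -> N.-tuple (E n)),
            (0 < N)%N -> particle_system X K P xi ->
            forall w, mminus X n <= massN X (xi ^~ w) n <= mplus X n),
          (* (b) *)
          (exists b : nat -> R, Lr_constants X K a b) &
          (* (c) *)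
          forall (n N : nat) (d' : measure_display) (Omega : measurableType d')
              (P : probability Omega R)
              (xi : forall n, Omega -> N.-tuple (E n)) (f : E n -> R),
            (0 < N)%N -> particle_system X K P xi ->
            measurable_fun setT f -> bounded_fun f ->
            'E_P[(fun w => massN X (xi ^~ w) n * \int[emp R (xi n w)]_x f x)%R]%E
              = (\int[gamma X n]_x f x)%:E]) /\
    (* (d) *)
    (forall (d : measure_display) (E : measurableType d)
        (X : @model R (fun=> d) (fun=> E)) (K : @kernel_family R (fun=> d) (fun=> E))
        (G : E -> R) (M : R.-pker E ~> E)
        (mu : {finite_measure set E -> \bar R}) (k : nat) (eps : R),
      McKean X K -> homogeneous X G M mu ->
      (0 < k)%N -> 0 < eps ->
      (forall (x y : E) (A : set E), measurable A ->
        (eps%:E * kpow M k y A <= kpow M k x A)%E) ->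
      [\/ G = cst 1, sup (range G) < 1 | 1 < inf (range G)] ->
      (exists b : nat -> R,
        Lr_constants X K a b /\ exists B : R, forall n, b n <= B) /\
      (exists2 c : R, 0 <= c &
        forall (n N : nat) (d' : measure_display) (Omega : measurableType d')
            (P : probability Omega R) (xi : nat -> Omega -> N.-tuple E),
          (0 < n)%N -> (1 < N)%N -> particle_system X K P xi ->
          ('E_P[(fun w => (massN X (xi ^~ w) n / mass (gamma X n) - 1) ^+ 2)%R]
            <= (c * (n.+1%:R / N.-1%:R) * (1 + c / N.-1%:R) ^+ n.-1)%:E)%E)).

Proof.
exists (fun r => 32 * expR 1 * r); split.
  move=> d E X K mcK; split.
  - split; first exact: mass_gamma_bounds.
    by move=> n N d' Om P xi N0 ps w; exact: massN_bounds.
  - by exists (bsharp X); exact: Lr_constants_bsharp.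
  - move=> n N d' Om P xi f N0 ps mf bf.
    exact: (unbiased mcK N0 ps (bounded_bmeas mf bf)).
move=> d E X K G M mu k eps mcK hom k0 eps0 mix cases.
have [lo [hi [lo0 Hlo]]] := pot_bounds X 0.
have HG y : lo <= G y <= hi by case: hom => /(_ 0%N) <- _ _; exact: Hlo.
split.
  exists (bsharp X); split; first exact: Lr_constants_bsharp.
  exact: (bsharp_uniform hom k0 eps0 lo0 HG mix cases).
have Hq p n : (p <= n)%N -> qpn X p n <= (delta k eps lo hi)^-1.
  exact: (qpn_harnack hom eps0 lo0 HG mix).
(* The constant involves only the mixing parameters and the bounds of [G]; it comes from [Delta_sq]
   and the uniform bound on [qpn]. *)
exists (64 * expR 1 * (delta k eps lo hi)^-1 ^+ 2).
  by apply: mulr_ge0; [rewrite mulr_ge0 ?expR_ge0|exact: sqr_ge0].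
move=> n N d' Om P xi n0 N1 ps.
exact: (massN_relative_variance mcK Hq n N1 ps).
Qed.
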